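(* Let $\mathfrak g$ be an indecomposable and symmetrizable Kac-Moody algebra, finitely $\Sigma$-graded with indecomposable grading subalgebra $\mathfrak m$. Then: (1) The Kac-Moody Lie algebra $\mathfrak g$ and the grading subalgebra $\mathfrak m$ are of the same type (finite, affine or indefinite). (2) If $\mathfrak g$ is of indefinite type and Lorentzian, then $\mathfrak m$ is also Lorentzian.
   Context: Complex Kac-Moody algebras $\mathfrak g=\mathfrak g(A)$ are associated to generalized Cartan matrices $A=(a_{i,j})_{i,j\in I}$ and (minimal) realizations $(\mathfrak h,\{\alpha_i\},\{\alpha_i^\vee\})$, $\dim\mathfrak h=|I|+\mathrm{corank}(A)$, $\langle\alpha_j,\alpha_i^\vee\rangle=a_{i,j}$; $\mathfrak g$ is called indecomposable, symmetrizable, of finite/affine/indefinite type, Lorentzian, if $A$ is. An indecomposable generalized Cartan matrix is of exactly one of the three types finite, affine, indefinite (Kac's classification). An indecomposable symmetrizable $A$ is Lorentzian if it is nonsingular and the corresponding symmetric matrix $DA$ ($D$ diagonal with positive entries) has signature $(++\dots+-)$. Finite gradation: for a root system $\Sigma$ of Kac-Moody type, $\mathfrak g$ is finitely $\Sigma$-graded with grading subalgebra $\mathfrak m$ if (i) $\mathfrak m\subset\mathfrak g$ is a subalgebra which is a Kac-Moody algebra whose root system relative to a Cartan subalgebra $\mathfrak a$ of $\mathfrak m$ is $\Sigma$; (ii) $\mathfrak g=\sum_{\gamma\in\Sigma\cup\{0\}}V_\gamma$, $V_\gamma=\{x\in\mathfrak g:[a,x]=\langle\gamma,a\rangle x\ \forall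 a\in\mathfrak a\}$; (iii) every $V_\gamma$ ($\gamma\in\Sigma\cup\{0\}$) is finite dimensional. One assumes $\mathfrak a\subset\mathfrak h$, where $\mathfrak h$ is the standard Cartan subalgebra of $\mathfrak g$. *)

(* Defs.v *)
From HB Require Import structures.
From mathcomp Require Import all_boot all_order all_algebra.
From mathcomp Require Import classical_sets reals.
From mathcomp.real_closed Require Import complex.

Set Implicit Arguments.
Unset Strict Implicit.
Unset Printing Implicit Defensive.

Import Order.TTheory GRing.Theory Num.Theory.
Local Open Scope ring_scope.

HB.mixin Record Lmodule_isLie (K : fieldType) L of GRing.Lmodule K L := {
  bracket : L -> L -> L;
  bracket_linearl : forall (k : K) (x y z : L),
    bracket (k *: x + y) z = k *: bracket x z + bracket y z;
  bracket_linearr : forall (k : K) (x y z : L),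
    bracket z (k *: x + y) = k *: bracket z x + bracket z y;
  bracketxx : forall x : L, bracket x x = 0;
  bracket_jacobi : forall x y z : L,
    bracket x (bracket y z) + bracket y (bracket z x)
      + bracket z (bracket x y) = 0
}.

#[short(type="lieType")]
HB.structure Definition Lie (K : fieldType) :=
  { L of GRing.Lmodule K L & Lmodule_isLie K L }.

Definition lie_morphism (K : fieldType) (L L' : lieType K)
    (f : {linear L -> L'}) : Prop :=
  forall x y : L, f (bracket x y) = bracket (f x) (f y).

Definition lie_ideal (K : fieldType) (L : lieType K) (J : set L) : Prop :=
  [/\ J 0,
      (forall (k : K) (x y : L), J x -> J y -> J (k *: x + y)) &
      (forall x y : L, J y -> J (bracket x y))].

Definition finite_dimensional (K : fieldType) (V : lmodType K) (S : set V)
    : Prop :=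
  exists (d : nat) (b : 'I_d -> V),
    (forall k, S (b k)) /\
    (forall x, S x -> exists c : 'I_d -> K, x = \sum_(k < d) c k *: b k).

Definition gcm (n : nat) (A : 'M[int]_n) : Prop :=
  [/\ (forall i, A i i = 2),
      (forall i j, i != j -> A i j <= 0) &
      (forall i j, A i j = 0 -> A j i = 0)].

(* The empty matrix is not counted as indecomposable. *)
Definition indecomposable (n : nat) (A : 'M[int]_n) : Prop :=
  (0 < n)%N /\
  forall J : {set 'I_n}, (0 < #|J| < n)%N ->
    exists i j, [/\ i \in J, j \notin J & (A i j != 0) || (A j i != 0)].

Definition intr_mx (R : realType) (n : nat) (A : 'M[int]_n) : 'M[R]_n :=
  map_mx (intr : int -> R) A.

Definition symmetrizable (R : realType) (n : nat) (A : 'M[int]_n) : Prop :=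
  exists d : 'rV[R]_n, (forall i, d 0 i != 0) /\
    (diag_mx d *m intr_mx R A)^T = diag_mx d *m intr_mx R A.

Definition vec_gt0 (R : realType) (n : nat) (v : 'cV[R]_n) : Prop :=
  forall i, 0 < v i 0.

Definition vec_ge0 (R : realType) (n : nat) (v : 'cV[R]_n) : Prop :=
  forall i, 0 <= v i 0.

(* The three types are Kac's (Infinite dimensional Lie algebras, Thm 4.3). *)
Definition finite_type (R : realType) (n : nat) (A : 'M[int]_n) : Prop :=
  [/\ \det (intr_mx R A) != 0,
      (exists u : 'cV[R]_n, vec_gt0 u /\ vec_gt0 (intr_mx R A *m u)) &
      (forall v : 'cV[R]_n, vec_ge0 (intr_mx R A *m v) -> vec_gt0 v \/ v = 0)].

Definition affine_type (R : realType) (n : nat) (A : 'M[int]_n) : Prop :=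
  [/\ (n - \rank (intr_mx R A))%N = 1%N,
      (exists u : 'cV[R]_n, vec_gt0 u /\ intr_mx R A *m u = 0) &
      (forall v : 'cV[R]_n,
         vec_ge0 (intr_mx R A *m v) -> intr_mx R A *m v = 0)].

Definition indefinite_type (R : realType) (n : nat) (A : 'M[int]_n) : Prop :=
  (exists u : 'cV[R]_n, vec_gt0 u /\ vec_gt0 (- (intr_mx R A *m u))) /\
  (forall v : 'cV[R]_n, vec_ge0 (intr_mx R A *m v) -> vec_ge0 v -> v = 0).

Definition has_signature (R : realType) (n : nat) (M : 'M[R]_n) (p q : nat)
    : Prop :=
  M^T = M /\
  exists (P : 'M[R]_n) (d : 'rV[R]_n),
    [/\ P \in unitmx, P *m M *m P^T = diag_mx d,
        #|[pred i | 0 < d 0 i]| = p & #|[pred i | d 0 i < 0]| = q].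

Definition lorentzian (R : realType) (n : nat) (A : 'M[int]_n) : Prop :=
  [/\ indecomposable A,
      symmetrizable R A,
      \det (intr_mx R A) != 0 &
      exists d : 'rV[R]_n, (forall i, 0 < d 0 i) /\
        has_signature (diag_mx d *m intr_mx R A) n.-1 1].

Definition dual (K : fieldType) (V : vectType K) := 'Hom(V, K^o).

Record realization (R : realType) (n : nat) (A : 'M[int]_n) := Realization {
  cartan :> vectType R[i];
  simple_coroot : n.-tuple cartan;
  simple_root : n.-tuple (dual cartan);
  coroot_free : free simple_coroot;
  root_free : free simple_root;
  root_coroot : forall i j : 'I_n, tnth simple_root j (tnth simple_coroot i) = (A i j)%:~R;
  cartan_dim : \dim {:cartan} = (n + (n - \rank (intr_mx R A)))%N
}.

Record generators (R : realType) (n : nat) (A : 'M[int]_n)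
    (h : realization R A) (L : lieType R[i]) := Generators {
  gen_h : {linear h -> L};
  gen_e : 'I_n -> L;
  gen_f : 'I_n -> L
}.

Definition defining_relations (R : realType) (n : nat) (A : 'M[int]_n)
    (h : realization R A) (L : lieType R[i]) (X : generators h L) : Prop :=
  [/\ (forall x y : h, bracket (gen_h X x) (gen_h X y) = 0),
      (forall i j, bracket (gen_e X i) (gen_f X j) =
         if i == j then gen_h X (tnth (simple_coroot h) i) else 0),
      (forall (x : h) i,
         bracket (gen_h X x) (gen_e X i) = tnth (simple_root h) i x *: gen_e X i) &
      (forall (x : h) i,
         bracket (gen_h X x) (gen_f X i) = - tnth (simple_root h) i x *: gen_f X i)].

Definition preserves_generators (R : realType) (n : nat) (A : 'M[int]_n)
    (h : realization R A) (L L' : lieType R[i]) (X : generators h L)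
    (X' : generators h L') (p : {linear L -> L'}) : Prop :=
  [/\ (forall x : h, p (gen_h X x) = gen_h X' x),
      (forall i, p (gen_e X i) = gen_e X' i) &
      (forall i, p (gen_f X i) = gen_f X' i)].

(* The auxiliary algebra ~g(A): the Lie algebra presented by the generators
   h, e_i, f_i and the defining relations (no Serre relations). *)
Definition is_auxiliary_algebra (R : realType) (n : nat) (A : 'M[int]_n)
    (h : realization R A) (L : lieType R[i]) (X : generators h L) : Prop :=
  defining_relations X /\
  forall (L' : lieType R[i]) (X' : generators h L'), defining_relations X' ->
    exists p : {linear L -> L'},
      [/\ lie_morphism p, preserves_generators X X' p &
          forall q : {linear L -> L'}, lie_morphism q ->
            preserves_generators X X' q -> q =1 p].

(* g(A) is the quotient of ~g(A) by the largest ideal meeting h trivially.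
   Injectivity of [gen_h X] (automatic, by a theorem of Kac) is included so
   that h may be regarded as a subalgebra of g(A). *)
Definition is_kac_moody (R : realType) (n : nat) (A : 'M[int]_n)
    (h : realization R A) (g : lieType R[i]) (X : generators h g) : Prop :=
  [/\ gcm A,
      injective (gen_h X) &
      exists (gt : lieType R[i]) (Xt : generators h gt)
             (p : {linear gt -> g}),
        [/\ is_auxiliary_algebra Xt,
            lie_morphism p,
            preserves_generators Xt X p,
            (forall y : g, exists x : gt, p x = y) &
            (forall x : h, p (gen_h Xt x) = 0 -> gen_h Xt x = 0) /\
            (forall J : set gt, lie_ideal J ->
               (forall x : h, J (gen_h Xt x) -> gen_h Xt x = 0) ->
               forall x : gt, J x -> p x = 0)]].

Definition weight_space (K : fieldType) (a : vectType K) (L : lieType K)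
    (i : {linear a -> L}) (c : dual a) : set L :=
  [set x : L | forall t : a, bracket (i t) x = (c t : K) *: x]%classic.

Definition root_system (K : fieldType) (a : vectType K) (L : lieType K)
    (i : {linear a -> L}) : set (dual a) :=
  [set c : dual a | c <> 0 /\ exists x : L, x <> 0 /\ weight_space i c x]%classic.

(* The subalgebra m of g is given by an injective morphism j : m -> g, and its
   Cartan subalgebra a by the generators Xm. *)
Definition finitely_graded (R : realType) (n k : nat) (A : 'M[int]_n)
    (B : 'M[int]_k) (h : realization R A) (a : realization R B)
    (g m : lieType R[i]) (Xg : generators h g) (Xm : generators a m)
    (j : {linear m -> g}) (Sigma : set (dual a)) : Prop :=
  let V (c : dual a) := weight_space (j \o gen_h Xm) c in
  let Sigma0 : set (dual a) := (Sigma `|` [set 0])%classic in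
  [/\ [/\ is_kac_moody Xm, lie_morphism j, injective j &
          root_system (gen_h Xm) = Sigma],
      (forall t : a, exists s : h, j (gen_h Xm t) = gen_h Xg s),
      (forall x : g, exists (r : seq (dual a)) (v : dual a -> g),
         (forall c, c \in r -> Sigma0 c /\ V c (v c)) /\
         x = \sum_(c <- r) v c) &
      (forall c, Sigma0 c -> finite_dimensional (V c))].

(* Main.v *)
Require Import Defs.
From HB Require Import structures.
From mathcomp Require Import all_boot all_order all_algebra.
From mathcomp Require Import classical_sets reals boolp.
From mathcomp.real_closed Require Import complex.
From mathcomp Require Import ring lra zify.

Set Implicit Arguments.
Unset Strict Implicit.
Unset Printing Implicit Defensive.

Import Order.TTheory GRing.Theory Num.Theory.
Local Open Scope ring_scope.

(** Each root of [g] restricts to a root of [m] or to zero, and the [l]-th Chevalley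
    generators of [m] decompose into root vectors of [g] for roots restricting to the
    simple root [l].  The invariant form of [g] therefore puts the coroots [H_l] of [m],
    modulo the centre, in the real span of the coroots of [g], and their scalar products
    are [(H_l, H_l') = c_l b_{l' l}] for some scalars [c_l].  Once [c_l > 0], the Gram
    matrix of the vectors [H_l / c_l] is a positive symmetrization of [B], so the form
    of [m] is a pullback of that of [g]; types are read off from definiteness.

    If the form is semidefinite, [c_l > 0] is clear.  In the indefinite case the roots of
    [g] restricting to the simple root [l] have finite strings, since all [V_gamma] are
    finite dimensional, and hence have positive norm; being stable under the reflections
    in them, the finite set of the roots restricting to zero or to plus or minus that
    simple root carries a positive semidefinite invariant trace form, which is proportional
    to the invariant form in the relevant directions.

    Two cases remain, both excluded because the norm of a root of [m] is bounded.  If [g]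
    is indefinite and [m] is not, then some strictly negative weights of [g] have all
    their multiples among the roots, hence restrict to isotropic weights of [m]; since
    they span, the coroots of [m] would be central.  If [g] is affine and [m] finite, then
    [m], and hence [g] by finite dimensionality of the [V_gamma], has finitely many roots.

    For the second claim, a nondegenerate restriction of a Lorentzian form to a subspace
    containing a vector of negative norm is again Lorentzian. *)

(** * Symmetric matrices and the types of Cartan matrices *)

(** The obstacle is the sign of [c_l]. No anti-involution of [g] is assumed to preserve [m], so the
    components of [e_l] and [f_l] in opposite root spaces are unrelated, and each of their scalar
    products is a priori an arbitrary complex number; only their sum matters. Since
    [<alpha_l, H_l> = 2], the norm of [H_l] is [2 c_l], which settles the semidefinite case.
    Otherwise positivity has to come from finiteness: the trace form of a finite set of weights is a
    sum of squares whatever the signature of the invariant form, and stability under reflections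
    makes the two proportional, with a positive factor. Roots are encoded as integer rows of
    coordinates in the simple roots. Restriction to [m] is then an integer matrix, and norms are
    real although the algebras are complex. The invariant form is built only as far as needed: in
    degree zero it lives on the span of the simple coroots, where all brackets of opposite root
    spaces lie. *)

Section BilinearForm.
Variables (R : realType) (n : nat).
Implicit Types (S : 'M[R]_n) (u v w : 'rV[R]_n) (t : R).

Definition bform S u v : R := (u *m S *m v^T) 0 0.

Definition psd S := forall u, 0 <= bform S u u.
Definition pd S := forall u, u != 0 -> 0 < bform S u u.
Definition offdiag_npos S := forall i j, i != j -> S i j <= 0.
Definition irreducible_mx S := forall J : {set 'I_n}, (0 < #|J| < n)%N ->
  exists i j, [/\ i \in J, j \notin J & S i j != 0].

Lemma bformDl S u v w : bform S (u + v) w = bform S u w + bform S v w.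
Proof. by rewrite /bform !mulmxDl mxE. Qed.

Lemma bformDr S u v w : bform S w (u + v) = bform S w u + bform S w v.
Proof. by rewrite /bform linearD mulmxDr mxE. Qed.

Lemma bformZl S t u v : bform S (t *: u) v = t * bform S u v.
Proof. by rewrite /bform -!scalemxAl mxE. Qed.

Lemma bformZr S t u v : bform S u (t *: v) = t * bform S u v.
Proof. by rewrite /bform linearZ -scalemxAr mxE. Qed.

Lemma bform0l S u : bform S 0 u = 0.
Proof. by rewrite /bform !mul0mx mxE. Qed.

Lemma bform_sym S u v : S^T = S -> bform S u v = bform S v u.
Proof.
move=> symS; rewrite /bform -[in RHS]symS.
have -> : v *m S^T *m u^T = (u *m S *m v^T)^T by rewrite !trmx_mul trmxK mulmxA.
by rewrite [RHS]mxE.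
Qed.

Lemma bform_row S u v : bform S u v = \sum_i (u *m S) 0 i * v 0 i.
Proof. by rewrite /bform mxE; apply: eq_bigr => i _; rewrite [_^T _ _]mxE. Qed.

Lemma bform_sum S u v : bform S u v = \sum_i \sum_j u 0 i * S i j * v 0 j.
Proof.
rewrite bform_row exchange_big /=; apply: eq_bigr => j _.
by rewrite mxE mulr_suml.
Qed.

Lemma bform_delta S u i : bform S u (delta_mx 0 i) = (u *m S) 0 i.
Proof. by rewrite /bform trmx_delta -colE mxE. Qed.

Lemma pd_psd S : pd S -> psd S.
Proof.
by move=> pdS u; have [->|/pdS/ltW//] := eqVneq u 0; rewrite bform0l.
Qed.

Lemma psd_npd_null S : psd S -> ~ pd S -> exists2 v, v != 0 & bform S v v = 0.
Proof.
move=> psdS npdS; apply: contrapT => nv; apply: npdS => u u0.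
rewrite lt_neqAle psdS andbT eq_sym; apply/eqP => q0; apply: nv.
by exists u.
Qed.

Lemma psd_cauchy S u v : S^T = S -> psd S ->
  bform S u v ^+ 2 <= bform S u u * bform S v v.
Proof.
move=> symS psdS.
have key (t : R) : 0 <= bform S u u + 2 * t * bform S u v + t ^+ 2 * bform S v v.
  have := psdS (u + t *: v).
  rewrite !(bformDl, bformDr, bformZl, bformZr) (bform_sym v u) //.
  by congr (_ <= _); ring.
set a := bform S u u in key *; set b := bform S u v in key *.
set c := bform S v v in key *.
have c0 : 0 <= c := psdS v.
have [c00|cN0] := eqVneq c 0.
  have [-> | bN0] := eqVneq b 0; first by rewrite c00 mulr0 expr0n.
  (* With [c = 0] the expression is affine in [t]; this [t] gives it the value [-1]. *)
  have := key (- (a + 1) / (2 * b)).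
  rewrite c00 mulr0 addr0.
  have -> : 2 * (- (a + 1) / (2 * b)) * b = - (a + 1) by field.
  by rewrite opprD addrA subrr sub0r lerNr oppr0 ler10.
have cp : 0 < c by rewrite lt_neqAle eq_sym cN0.
have := key (- b / c).
have -> : a + 2 * (- b / c) * b + (- b / c) ^+ 2 * c = (a * c - b ^+ 2) / c.
  by field.
by rewrite pmulr_lge0 ?invr_gt0 // subr_ge0.
Qed.

Lemma psd_null_ker S v : S^T = S -> psd S -> bform S v v = 0 -> v *m S = 0.
Proof.
move=> symS psdS v0; apply/rowP => i; rewrite [RHS]mxE -bform_delta.
have := psd_cauchy v (delta_mx 0 i) symS psdS.
rewrite v0 mul0r => h; apply/eqP; rewrite -sqrf_eq0 eq_le h.
exact: sqr_ge0.
Qed.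

Lemma rV_neq0 v : v != 0 -> exists i, v 0 i != 0.
Proof.
move=> vN0; apply/existsP; apply: contraNT vN0 => /existsPn v00.
by apply/eqP/rowP => l; move: (v00 l); rewrite negbK mxE => /eqP.
Qed.

(** Irreducibility links the zero set [J] of [v] to its complement; at the linked index of [J] all
    terms of [v *m S] are nonpositive and one is negative. The sign condition is asked only where
    [v] vanishes, which is what [root_of_negative] can provide. *)
Lemma nonneg_pos S v : offdiag_npos S -> irreducible_mx S ->
  S^T = S ->
  v != 0 -> (forall i, 0 <= v 0 i) ->
  (forall i, v 0 i = 0 -> 0 <= (v *m S) 0 i) -> forall i, 0 < v 0 i.
Proof.
move=> zS irS symS vN0 v0 vS i; rewrite lt_neqAle v0 andbT eq_sym.
apply/negP => /eqP vi0.
pose J := [set l | v 0 l == 0].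
have Ji : i \in J by rewrite inE vi0.
have JP : (0 < #|J| < n)%N.
  rewrite card_gt0; apply/andP; split; first by apply/set0Pn; exists i.
  have [l vl] := rV_neq0 vN0.
  rewrite -[X in (_ < X)%N]card_ord -(cardsC J) -[X in (X < _)%N]addn0 ltn_add2l.
  by rewrite card_gt0; apply/set0Pn; exists l; rewrite !inE.
have [l [m [Jl Jm Slm]]] := irS _ JP.
have vl : v 0 l = 0 by apply/eqP; rewrite inE in Jl.
have vm : 0 < v 0 m by rewrite lt_neqAle v0 andbT eq_sym; rewrite inE in Jm.
have lm : l != m by apply: contraNneq Jm => <-.
have Sml : S m l < 0.
  by rewrite lt_neqAle -symS mxE Slm zS.
have := vS _ vl; rewrite mxE (bigD1 m) //= leNgt => /negP; apply.
rewrite ltr_nwDl ?nmulr_llt0 //; apply: sumr_le0 => p pm.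
have [->|pl] := eqVneq p l; first by rewrite vl mul0r.
by rewrite mulr_ge0_le0 // zS.
Qed.

Definition absv v : 'rV[R]_n := \row_i `|v 0 i|.

Lemma bform_absv S v : offdiag_npos S -> bform S (absv v) (absv v) <= bform S v v.
Proof.
move=> zS; rewrite !bform_sum; apply: ler_sum => i _; apply: ler_sum => j _.
rewrite !mxE; have [->|ij] := eqVneq i j.
  by rewrite mulrAC -normrM -expr2 ger0_norm ?sqr_ge0 // [leRHS]mulrAC expr2.
rewrite mulrAC -normrM [leRHS]mulrAC.
by rewrite ler_wnM2r ?zS ?ler_norm.
Qed.

Lemma absv_eq0 v : (absv v == 0) = (v == 0).
Proof.
apply/eqP/eqP => [/rowP h|->]; apply/rowP => i; last by rewrite !mxE normr0.
by apply/eqP; move: (h i); rewrite !mxE => /eqP; rewrite normr_eq0.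
Qed.

(** Absolute values can only lower the form, so [absv v] is isotropic too; semidefiniteness puts it
    in the kernel, and [nonneg_pos] makes it positive. *)
Lemma psd_null_absv S v : S^T = S -> offdiag_npos S -> irreducible_mx S ->
  psd S -> v != 0 -> bform S v v = 0 ->
  (forall i, 0 < absv v 0 i) /\ absv v *m S = 0.
Proof.
move=> symS zS irS psdS vN0 v0.
have a0 : absv v *m S = 0.
  apply: psd_null_ker => //; apply/eqP; rewrite eq_le psdS andbT -[leRHS]v0.
  exact: bform_absv.
split=> //; apply: (nonneg_pos zS irS symS); rewrite ?absv_eq0 //.
  by move=> i; rewrite mxE.
by move=> i _; rewrite a0 mxE.
Qed.

(** Subtract the multiple of [w] that cancels one coordinate: a nonzero kernel vector has no zero
    coordinate. *)
Lemma psd_null_colinear S v w : S^T = S -> offdiag_npos S -> irreducible_mx S ->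
  psd S -> (forall i, 0 < w 0 i) -> w *m S = 0 -> v *m S = 0 ->
  exists t, v = t *: w.
Proof.
move=> symS zS irS psdS w0 wS vS.
have [->|vN0] := eqVneq v 0; first by exists 0; rewrite scale0r.
have [i vi] := rV_neq0 vN0.
exists (v 0 i / w 0 i); apply/eqP; rewrite -subr_eq0; apply/negPn/negP => dN0.
set d := v - _ in dN0.
have dS : d *m S = 0 by rewrite mulmxBl -scalemxAl vS wS scaler0 subr0.
have [|h _] := psd_null_absv symS zS irS psdS dN0; first by rewrite /bform dS mul0mx mxE.
by have := h i; rewrite !mxE divfK ?gt_eqF // subrr normr0 ltxx.
Qed.

Lemma pd_unitmx S : pd S -> S \in unitmx.
Proof.
move=> pdS; rewrite -row_free_unit -kermx_eq0; apply/rowV0P => u /sub_kermxP uS.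
by apply/eqP/negPn/negP => /pdS; rewrite /bform uS mul0mx mxE ltxx.
Qed.

Lemma pd_coercive S : S^T = S -> pd S ->
  exists2 e, 0 < e & forall u, e * \sum_i u 0 i ^+ 2 <= bform S u u.
Proof.
move=> symS pdS; have uS := pd_unitmx pdS.
pose f i : 'rV[R]_n := delta_mx 0 i *m invmx S.
pose C := 1 + \sum_i bform S (f i) (f i).
have C0 : 0 < C.
  by rewrite ltr_pwDl // sumr_ge0 // => i _; apply: pd_psd.
exists C^-1; rewrite ?invr_gt0 // => u; rewrite ler_pdivrMl //.
rewrite mulrDl mul1r -[leLHS]add0r lerD ?(pd_psd pdS) //.
rewrite mulr_suml; apply: ler_sum => i _.
apply: le_trans (psd_cauchy (f i) u symS (pd_psd pdS)).
by rewrite /bform /f mulmxKV // -rowE !mxE.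
Qed.

Lemma bform_bound S : exists2 C, 0 < C &
  forall u, `|bform S u u| <= C * \sum_i u 0 i ^+ 2.
Proof.
pose C := 1 + \sum_i \sum_j `|S i j|.
have C0 : 0 < C.
  by rewrite ltr_pwDl // sumr_ge0 // => i _; rewrite sumr_ge0.
exists C => // u; set N := \sum_i _.
have N0 : 0 <= N by apply: sumr_ge0 => i _; apply: sqr_ge0.
have leN i : u 0 i ^+ 2 <= N.
  by rewrite /N (bigD1 i) //= lerDl sumr_ge0 // => l _; apply: sqr_ge0.
rewrite bform_sum mulrDl mul1r -[leLHS]add0r lerD // mulr_suml.
apply: le_trans (ler_norm_sum _ _ _) _; apply: ler_sum => i _.
rewrite mulr_suml; apply: le_trans (ler_norm_sum _ _ _) _; apply: ler_sum => j _.
rewrite mulrAC !normrM [leLHS]mulrC ler_wpM2l //.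
have := leN i; have := leN j; have := sqr_ge0 (`|u 0 i| - `|u 0 j|).
rewrite -(real_normK (num_real (u 0 i))) -(real_normK (num_real (u 0 j))).
move: `|_| `|_| => a b; nra.
Qed.

Lemma sumsq_gt0 u : u != 0 -> 0 < \sum_i u 0 i ^+ 2.
Proof.
move=> uN0; have [i ui] := rV_neq0 uN0.
rewrite (bigD1 i) //= ltr_pwDl ?sumr_ge0 // => [|l _]; last exact: sqr_ge0.
by rewrite exprn_even_gt0.
Qed.

(* The lowest eigenvalue of [S] is minus the supremum [s] of the Rayleigh
   quotients of [- S]; [S + s] is semidefinite but not definite, so its kernel
   contains a positive vector. *)
Lemma perron_neg S : S^T = S -> offdiag_npos S -> irreducible_mx S -> ~ psd S ->
  exists u, (forall i, 0 < u 0 i) /\ (forall i, (u *m S) 0 i < 0).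
Proof.
move=> symS zS irS npsd.
have [u0 u0N] : exists u0, bform S u0 u0 < 0.
  apply: contrapT => h; apply: npsd => u; rewrite leNgt; apply/negP => ?.
  by apply: h; exists u.
have u0N0 : u0 != 0 by apply: contraTneq u0N => ->; rewrite bform0l ltxx.
pose T := [set t | exists2 u : 'rV[R]_n, u != 0 &
              t = - bform S u u / \sum_i u 0 i ^+ 2]%classic.
have Tb : has_sup T.
  split; first by exists (- bform S u0 u0 / \sum_i u0 0 i ^+ 2); exists u0.
  have [C C0 hC] := bform_bound S.
  exists C => _ [u uN0 ->]; rewrite ler_pdivrMr ?sumsq_gt0 //.
  by apply: le_trans (hC u); rewrite -normrN ler_norm.
pose s := sup T.
have s0 : 0 < s.
  have /(ub_le_sup Tb.2) : T (- bform S u0 u0 / \sum_i u0 0 i ^+ 2) by exists u0.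
  by apply: lt_le_trans; rewrite divr_gt0 ?sumsq_gt0 // oppr_gt0.
pose M := S + s%:M.
have bM u : bform M u u = bform S u u + s * \sum_i u 0 i ^+ 2.
  rewrite /bform mulmxDr mulmxDl mxE mul_mx_scalar -scalemxAl [X in _ + X]mxE.
  by congr (_ + _ * _); rewrite mxE; apply: eq_bigr => i _; rewrite mxE -expr2.
have psdM : psd M.
  move=> u; have [->|uN0] := eqVneq u 0; first by rewrite bform0l.
  rewrite bM -lerBlDl sub0r -ler_pdivrMr ?sumsq_gt0 //.
  by apply: (ub_le_sup Tb.2); exists u.
have symM : M^T = M by rewrite /M linearD /= symS tr_scalar_mx.
have MS i j : i != j -> M i j = S i j.
  by move=> ij; rewrite !mxE (negbTE ij) mulr0n addr0.
have zM : offdiag_npos M by move=> i j ij; rewrite MS // zS.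
have irM : irreducible_mx M.
  move=> J /irS [i [j [Ji Jj Sij]]]; exists i, j; split => //.
  by rewrite MS //; apply: contraNneq Jj => <-.
(* If [M] were definite, coercivity would make [s - e] an upper bound of the Rayleigh quotients. *)
have npdM : ~ pd M.
  move=> /(pd_coercive symM)[e e0 he].
  suff : s <= s - e by rewrite leNgt ltrBlDr ltrDl e0.
  apply: ge_sup; first exact: Tb.1.
  move=> _ [u uN0 ->]; rewrite ler_pdivrMr ?sumsq_gt0 //.
  by have := he u; rewrite bM; lra.
have [v vN0 v0] := psd_npd_null psdM npdM.
have [w0 wM] := psd_null_absv symM zM irM psdM vN0 v0.
exists (absv v); split => // i.
have /rowP/(_ i) := wM; rewrite mulmxDr mul_mx_scalar mxE [X in _ + X]mxE [RHS]mxE.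
move/eqP; rewrite addr_eq0 => /eqP ->; rewrite oppr_lt0 mulr_gt0 //.
Qed.

(** Otherwise pair [v] with the vector [u] of [perron_neg]: the result is nonnegative seen from
    [v *m S] and negative seen from [u *m S]. *)
Lemma supersolution_psd S v : S^T = S -> offdiag_npos S -> irreducible_mx S ->
  (forall i, 0 <= v 0 i) -> v != 0 -> (forall i, 0 <= (v *m S) 0 i) -> psd S.
Proof.
move=> symS zS irS v0 vN0 vS; apply: contrapT => npsd.
have [u [u0 uS]] := perron_neg symS zS irS npsd.
have vp := nonneg_pos zS irS symS vN0 v0 (fun i _ => vS i).
have : 0 <= bform S v u.
  by rewrite bform_row sumr_ge0 // => i _; rewrite mulr_ge0 // ltW.
rewrite bform_sym // bform_row leNgt => /negP; apply.
have [i vi] := rV_neq0 vN0.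
rewrite (bigD1 i) //= ltr_nwDl ?nmulr_rlt0 //.
by apply: sumr_le0 => l _; rewrite mulr_le0_ge0 // ltW.
Qed.
End BilinearForm.

(** * The three types as definiteness properties of the symmetrized matrix *)

Section CartanMatrixTypes.
Variables (R : realType) (n : nat) (A : 'M[int]_n) (d : 'rV[R]_n).

Definition symmetrized : 'M[R]_n := diag_mx d *m intr_mx R A.
Local Notation S := symmetrized.

Hypotheses (A_gcm : gcm A) (A_indec : indecomposable A).
Hypotheses (d_gt0 : forall i, 0 < d 0 i) (S_sym : S^T = S).

Lemma symmetrizedE i j : S i j = d 0 i * (A i j)%:~R.
Proof. by rewrite /S mul_diag_mx !mxE. Qed.

Lemma symmetrized_npos : offdiag_npos S.
Proof.
move=> i j ij; rewrite symmetrizedE pmulr_rle0 // -[0]/(0%:~R) ler_int.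
by case: A_gcm => _ ->.
Qed.

Lemma symmetrized_irr : irreducible_mx S.
Proof.
move=> J /A_indec.2 [i [j [Ji Jj Aij]]]; exists i, j; split=> //.
rewrite symmetrizedE mulf_eq0 gt_eqF //= intr_eq0.
case/orP: Aij => // Aji; apply: contraNneq Aji => Aij0.
by case: A_gcm => _ _ /(_ _ _ Aij0) ->.
Qed.

Lemma symmetrized_col (v : 'cV[R]_n) i :
  (v^T *m S) 0 i = d 0 i * (intr_mx R A *m v) i 0.
Proof.
rewrite -[in LHS]S_sym -trmx_mul mxE /S -mulmxA mul_diag_mx.
by rewrite [LHS]mxE.
Qed.

Let ord0n : exists i : 'I_n, true.
Proof. by case: A_indec => n0 _; exists (Ordinal n0). Qed.

Let vec_ge0_col (v : 'cV[R]_n) : vec_ge0 (intr_mx R A *m v) ->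
  forall i, 0 <= (v^T *m S) 0 i.
Proof. by move=> v0 i; rewrite symmetrized_col mulr_ge0 // ltW. Qed.

Let trmx_neq0 (v : 'cV[R]_n) : v != 0 -> v^T != 0.
Proof. by apply: contraNneq => /(congr1 trmx); rewrite trmxK trmx0 => ->. Qed.

Lemma pd_finite_type : pd S -> finite_type R A.
Proof.
move=> pdS; have Su := pd_unitmx pdS.
have H (v : 'cV[R]_n) : vec_ge0 (intr_mx R A *m v) -> vec_gt0 v \/ v = 0.
  move=> Av; have vS := vec_ge0_col Av.
  (* The negative part of [v]. It pairs nonnegatively with [v] and nonpositively with the positive
     part [v^T + vm], whose support is disjoint from its own; so its norm is at most zero. *)
  pose vm : 'rV[R]_n := \row_i Num.max 0 (- v i 0).
  have [vm0|vmN0] := eqVneq vm 0; last first.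
    exfalso; have := pdS _ vmN0; rewrite ltNge => /negP; apply.
    have : 0 <= bform S v^T vm.
      rewrite bform_row sumr_ge0 // => i _; rewrite mulr_ge0 // mxE.
      by rewrite le_max lexx.
    have -> : v^T = (v^T + vm) - vm by rewrite addrK.
    rewrite bformDl -scaleN1r bformZl mulN1r subr_ge0 => /le_trans; apply.
    rewrite bform_sum; apply: sumr_le0 => i _; apply: sumr_le0 => j _.
    have vmE l : vm 0 l = Num.max 0 (- v l 0) by rewrite mxE.
    rewrite [(v^T + vm) _ _]mxE [v^T _ _]mxE !vmE; have [->|ij] := eqVneq i j.
      by case: (lerP 0 (- v j 0)) => h; rewrite ?mulr0 // subrr !mul0r.
    rewrite mulr_le0_ge0 ?le_max ?lexx // mulr_ge0_le0 ?symmetrized_npos //.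
    by case: (lerP 0 (- v i 0)) => h; rewrite ?subrr // addr0 -oppr_le0 ltW.
  have v0 l : 0 <= v^T 0 l.
    move/rowP/(_ l): vm0; rewrite !mxE.
    case: (lerP 0 (- v l 0)) => h; last by rewrite -oppr_le0 ltW.
    by move=> /eqP; rewrite oppr_eq0 => /eqP ->.
  have [->|vN0] := eqVneq v 0; [by right | left => l].
  have := nonneg_pos symmetrized_npos symmetrized_irr S_sym (trmx_neq0 vN0) v0.
  by move=> /(_ (fun i _ => vS i))/(_ l); rewrite mxE.
have detA : \det (intr_mx R A) != 0.
  by move: Su; rewrite unitmxE det_mulmx unitrM => /andP[_]; rewrite unitfE.
split=> //.
pose u : 'cV[R]_n := invmx (intr_mx R A) *m const_mx 1.
have Au : intr_mx R A *m u = const_mx 1.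
  by rewrite /u mulmxA mulmxV ?mul1mx // unitmxE unitfE.
have Au0 : vec_gt0 (intr_mx R A *m u) by rewrite Au => i; rewrite mxE.
exists u; split => //; have [|//|u0] := H u; first by move=> i; rewrite ltW.
have [i _] := ord0n.
by have := Au0 i; rewrite u0 mulmx0 mxE ltxx.
Qed.

Lemma psd_affine_type : psd S -> ~ pd S -> affine_type R A.
Proof.
move=> psdS npdS; have [v vN0 v0] := psd_npd_null psdS npdS.
have [w0 wS] := psd_null_absv S_sym symmetrized_npos symmetrized_irr psdS vN0 v0.
set w := absv v in w0 wS.
have Aw : intr_mx R A *m w^T = 0.
  apply/colP => i; rewrite [RHS]mxE; apply/eqP.
  have /rowP/(_ i) := wS; rewrite -{1}[w]trmxK symmetrized_col [RHS]mxE.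
  by move/eqP; rewrite mulf_eq0 gt_eqF.
have rk : \rank (intr_mx R A) = \rank S.
  have h : row_full (diag_mx d).
    rewrite row_full_unit unitmxE det_diag unitfE.
    by apply/prodf_neq0 => i _; rewrite gt_eqF.
  by rewrite /S (eqmxMfull _ h).
have n0 := A_indec.1.
have wN0 : w != 0.
  have [i _] := ord0n; apply/negP => /eqP/rowP/(_ i) w00.
  by have := w0 i; rewrite w00 mxE ltxx.
split.
- rewrite rk -mxrank_ker; have -> : \rank (kermx S) = \rank w; last first.
    by rewrite rank_rV wN0.
  apply/eqP; rewrite eqn_leq; apply/andP; split; apply: mxrankS.
    apply/row_subP => i; apply/sub_rVP.
    have [|t ->] := psd_null_colinear (v := row i (kermx S)) S_sym symmetrized_npos
      symmetrized_irr psdS w0 wS; last by exists t.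
    by rewrite -row_mul mulmx_ker row0.
  exact/sub_kermxP.
- by exists w^T; split => // i; rewrite mxE.
- move=> x Ax; have xS := vec_ge0_col Ax.
  (* Pairing with the positive kernel vector gives a vanishing sum of nonnegative terms. *)
  have : bform S x^T w = 0 by rewrite bform_sym // /bform wS mul0mx mxE.
  rewrite bform_row => /eqP.
  rewrite psumr_eq0 => [/allP h|i _]; last by rewrite mulr_ge0 // ltW.
  apply/colP => i; rewrite [RHS]mxE.
  have /= := h i (mem_index_enum i).
  by rewrite mulf_eq0 (gt_eqF (w0 i)) orbF symmetrized_col mulf_eq0 gt_eqF //= => /eqP.
Qed.

Lemma npsd_indefinite_type : ~ psd S -> indefinite_type R A.
Proof.
move=> npsd; split.
  have [u [u0 uS]] := perron_neg S_sym symmetrized_npos symmetrized_irr npsd.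
  exists u^T; split => i; first by rewrite mxE.
  have := uS i; rewrite -{1}[u]trmxK symmetrized_col pmulr_rlt0 // => Au.
  by rewrite mxE oppr_gt0.
move=> v Av v0; apply/eqP/negPn/negP => vN0; apply: npsd.
apply: (supersolution_psd (v := v^T)) => //.
- exact: symmetrized_npos.
- exact: symmetrized_irr.
- by move=> i; rewrite mxE.
- exact: trmx_neq0.
- exact: vec_ge0_col.
Qed.

Let finite_naffine : finite_type R A -> affine_type R A -> False.
Proof.
move=> [dA _ _] [_ [u [u0 Au]] _]; have [i _] := ord0n.
have uA : intr_mx R A \in unitmx by rewrite unitmxE unitfE.
have := u0 i; rewrite -[u](mulKmx uA).
by rewrite Au mulmx0 mxE ltxx.
Qed.

Let finite_nindefinite : finite_type R A -> indefinite_type R A -> False.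
Proof.
move=> [_ _ H] [[u [u0 Au]] _]; have [i _] := ord0n.
have [|h|/eqP] := H (- u); first by move=> l; rewrite mulmxN ltW.
  by have := h i; rewrite mxE oppr_gt0 ltNge ltW.
by rewrite oppr_eq0 => /eqP u00; have := u0 i; rewrite u00 mxE ltxx.
Qed.

Let affine_nindefinite : affine_type R A -> indefinite_type R A -> False.
Proof.
move=> [_ [u [u0 Au]] _] [_ H]; have [i _] := ord0n.
have u00 : u = 0 by apply: H => l; rewrite ?Au ?mxE // ltW.
by have := u0 i; rewrite u00 mxE ltxx.
Qed.

(** The three implications from definiteness cover all cases and the types exclude one another, so
    each implication reverses. *)
Lemma finite_typeP : finite_type R A <-> pd S.
Proof.
split=> [fA|]; last exact: pd_finite_type.
apply: contrapT => npd; have [psdS|npsd] := pselect (psd S).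
  exact: finite_naffine fA (psd_affine_type psdS npd).
exact: finite_nindefinite fA (npsd_indefinite_type npsd).
Qed.

Lemma affine_typeP : affine_type R A <-> psd S /\ ~ pd S.
Proof.
split=> [aA|[]]; last exact: psd_affine_type.
split=> [|pdS]; last exact: finite_naffine (pd_finite_type pdS) aA.
apply: contrapT => npsd; exact: affine_nindefinite aA (npsd_indefinite_type npsd).
Qed.

Lemma indefinite_typeP : indefinite_type R A <-> ~ psd S.
Proof.
split=> [iA psdS|]; last exact: npsd_indefinite_type.
have [pdS|npd] := pselect (pd S); first exact: finite_nindefinite (pd_finite_type pdS) iA.
exact: affine_nindefinite (psd_affine_type psdS npd) iA.
Qed.

End CartanMatrixTypes.

Notation "{[ x , y ]}" := (bracket x y) (at level 0, format "{[ x ,  y ]}").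

(** * Weights and root spaces *)

Section LieBracket.
Variables (K : fieldType) (L : lieType K).
Implicit Types (x y z : L) (k : K).

Lemma brDl x y z : {[x + y, z]} = {[x, z]} + {[y, z]}.
Proof. by have := bracket_linearl 1 x y z; rewrite !scale1r. Qed.

Lemma brDr x y z : {[z, x + y]} = {[z, x]} + {[z, y]}.
Proof. by have := bracket_linearr 1 x y z; rewrite !scale1r. Qed.

Lemma br0l z : {[0, z]} = 0 :> L.
Proof. by apply: (addrI {[0, z]}); rewrite -brDl !addr0. Qed.

Lemma br0r z : {[z, 0]} = 0 :> L.
Proof. by apply: (addrI {[z, 0]}); rewrite -brDr !addr0. Qed.

Lemma brZl k x z : {[k *: x, z]} = k *: {[x, z]}.
Proof. by have := bracket_linearl k x 0 z; rewrite br0l !addr0. Qed.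

Lemma brZr k x z : {[z, k *: x]} = k *: {[z, x]}.
Proof. by have := bracket_linearr k x 0 z; rewrite br0r !addr0. Qed.

Lemma brNl x z : {[- x, z]} = - {[x, z]}.
Proof. by rewrite -scaleN1r brZl scaleN1r. Qed.

Lemma brNr x z : {[z, - x]} = - {[z, x]}.
Proof. by rewrite -scaleN1r brZr scaleN1r. Qed.

Lemma brC x y : {[x, y]} = - {[y, x]}.
Proof.
apply/eqP; rewrite -addr_eq0; apply/eqP.
by have := bracketxx (x + y); rewrite brDl !brDr !bracketxx add0r addr0.
Qed.

Lemma br_jacobi x y z : {[x, {[y, z]}]} = {[{[x, y]}, z]} + {[y, {[x, z]}]}.
Proof.
have /eqP := bracket_jacobi x y z.
rewrite -addrA addr_eq0 => /eqP ->; rewrite opprD addrC.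
by congr (_ + _); [rewrite brC opprK | rewrite (brC z x) brNr opprK].
Qed.

Lemma br_jacobil x y z : {[{[x, y]}, z]} = {[x, {[y, z]}]} - {[y, {[x, z]}]}.
Proof. by rewrite br_jacobi addrK. Qed.

Lemma br_suml I (r : seq I) (P : pred I) (F : I -> L) z :
  {[\sum_(i <- r | P i) F i, z]} = \sum_(i <- r | P i) {[F i, z]}.
Proof. by apply: (big_morph (fun x => {[x, z]})) => [x y|]; rewrite ?brDl ?br0l. Qed.

Lemma br_sumr I (r : seq I) (P : pred I) (F : I -> L) z :
  {[z, \sum_(i <- r | P i) F i]} = \sum_(i <- r | P i) {[z, F i]}.
Proof. by apply: (big_morph (fun x => {[z, x]})) => [x y|]; rewrite ?brDr ?br0r. Qed.

End LieBracket.

Section SubLie.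
Variables (K : fieldType) (L : lieType K) (P : {pred L}).
Hypotheses (Psub : GRing.submod_closed P).
Hypothesis (Pbr : forall x y, x \in P -> y \in P -> {[x, y]} \in P).

Definition sublie : Type := {x : L | x \in P}.
HB.instance Definition _ := SubType.copy sublie {x : L | x \in P}.
HB.instance Definition _ := [Choice of sublie by <:].
HB.instance Definition _ := GRing.SubChoice_isSubLmodule.Build K L _ sublie Psub.

Definition sublie_bracket (x y : sublie) : sublie :=
  Sub {[val x, val y]} (Pbr (valP x) (valP y)).

Let sval_inj (x y : sublie) : val x = val y :> L -> x = y.
Proof. exact: val_inj. Qed.

Let svalP k (x y : sublie) : val (k *: x + y) = k *: val x + val y :> L.
Proof. exact: (linearP (val : {linear sublie -> L})). Qed.

Let sval0 : val (0 : sublie) = 0 :> L.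
Proof. exact: (raddf0 (val : {linear sublie -> L})). Qed.

Let sval_bracket (x y : sublie) : val (sublie_bracket x y) = {[val x, val y]} :> L.
Proof. exact: SubK. Qed.

Fact sublie_bracket_linearl (k : K) (x y z : sublie) :
  sublie_bracket (k *: x + y) z = k *: sublie_bracket x z + sublie_bracket y z.
Proof. by apply: sval_inj; rewrite svalP !sval_bracket svalP bracket_linearl. Qed.

Fact sublie_bracket_linearr (k : K) (x y z : sublie) :
  sublie_bracket z (k *: x + y) = k *: sublie_bracket z x + sublie_bracket z y.
Proof. by apply: sval_inj; rewrite svalP !sval_bracket svalP bracket_linearr. Qed.

Fact sublie_bracketxx (x : sublie) : sublie_bracket x x = 0.
Proof. by apply: sval_inj; rewrite sval_bracket bracketxx sval0. Qed.

Fact sublie_bracket_jacobi (x y z : sublie) :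
  sublie_bracket x (sublie_bracket y z) + sublie_bracket y (sublie_bracket z x)
    + sublie_bracket z (sublie_bracket x y) = 0.
Proof.
apply: sval_inj; rewrite sval0 -[_ + _ + _]scale1r -[X in X + _]scale1r.
by rewrite scale1r !svalP !scale1r !sval_bracket bracket_jacobi.
Qed.

HB.instance Definition _ := Lmodule_isLie.Build K sublie
  sublie_bracket_linearl sublie_bracket_linearr sublie_bracketxx sublie_bracket_jacobi.

(** A subalgebra as a Lie algebra in its own right, to which the universal property of the auxiliary
    algebra can be applied. *)
Lemma sublie_exists : exists (L' : lieType K) (v : {linear L' -> L}),
  [/\ lie_morphism v, injective v & forall x, x \in P <-> exists y, v y = x].
Proof.
exists sublie, (val : {linear sublie -> L}); split.
- by move=> x y; exact: sval_bracket.
- exact: sval_inj.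
- move=> x; split=> [Px|[y <-]]; last exact: valP.
  by exists (Sub x Px); exact: SubK.
Qed.

End SubLie.

(** * What is extracted from the definition of a Kac-Moody algebra *)

Section KacMoodyStructure.
Variables (R : realType) (n : nat) (A : 'M[int]_n) (h : realization R A).
Variables (L : lieType R[i]).
Implicit Types (X : generators h L).

(** Generation in the form of an induction principle, ready for [elim]. *)
Definition generated X := forall P : L -> Prop,
  (forall k x y, P x -> P y -> P (k *: x + y)) ->
  (forall x y, P x -> P y -> P {[x, y]}) ->
  (forall s, P (gen_h X s)) -> (forall i, P (gen_e X i)) ->
  (forall i, P (gen_f X i)) -> forall x, P x.

Definition ideal_free X := forall J : set L, lie_ideal J ->
  (forall s, J (gen_h X s) -> gen_h X s = 0) -> forall x, J x -> x = 0.

Record kac_moody_structure X : Prop := KacMoodyStructure {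
  km_rel : defining_relations X;
  km_inj : injective (gen_h X);
  km_gcm : gcm A;
  km_gen : generated X;
  km_ideal : ideal_free X }.

Lemma is_kac_moodyP X : is_kac_moody X -> kac_moody_structure X.
Proof.
move=> [gcmA injX [gt [Xt [p [[relt univ] pm [ph pe pf] psurj [pinj pmax]]]]]].
have relX : defining_relations X.
  case: relt => r1 r2 r3 r4; split.
  - by move=> x y; rewrite -!ph -pm r1 raddf0.
  - by move=> i j; rewrite -pe -pf -pm r2; case: ifP; rewrite ?raddf0 ?ph.
  - by move=> x i; rewrite -ph -pe -pm r3 linearZ.
  - by move=> x i; rewrite -ph -pf -pm r4 linearZ.
split=> //.
- move=> P Plin Pbr Ph Pe Pf.
  (* The generators lift to the subalgebra [L'] cut out by [P], so the universal property gives a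
     map [q] into [L']. By uniqueness [v \o q] agrees with [p], whose surjectivity puts every
     element in [P]. *)
  pose S : {pred L} := fun x => `[< P x >].
  have SP x : (x \in S) = `[< P x >] by [].
  have Ssub : GRing.submod_closed S.
    split; first by rewrite SP; apply/asboolP; rewrite -(raddf0 (gen_h X)); exact: Ph.
    by move=> k x y; rewrite !SP => /asboolP Px /asboolP Py; apply/asboolP/Plin.
  have Sbr x y : x \in S -> y \in S -> {[x, y]} \in S.
    by rewrite !SP => /asboolP Px /asboolP Py; apply/asboolP/Pbr.
  have [L' [v [vm vinj vsurj]]] := sublie_exists Ssub Sbr.
  have lift x : P x -> exists y, v y = x.
    by move=> Px; apply/vsurj; rewrite SP; apply/asboolP.
  pose gh s := projT1 (cid (lift _ (Ph s))).
  have ghE s : v (gh s) = gen_h X s by rewrite /gh; case: cid.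
  have gh_lin : linear gh.
    by move=> k s t; apply: vinj; rewrite linearP !ghE linearP.
  pose ghl : {linear h -> L'} := HB.pack gh (GRing.isLinear.Build _ _ _ _ gh gh_lin).
  pose ge i := projT1 (cid (lift _ (Pe i))).
  have geE i : v (ge i) = gen_e X i by rewrite /ge; case: cid.
  pose gf i := projT1 (cid (lift _ (Pf i))).
  have gfE i : v (gf i) = gen_f X i by rewrite /gf; case: cid.
  pose X' := @Generators _ _ _ h L' ghl ge gf.
  have relX' : defining_relations X'.
    case: relX => r1 r2 r3 r4; split => /=.
    - by move=> x y; apply: vinj; rewrite vm !ghE r1 raddf0.
    - move=> i j; apply: vinj; rewrite vm geE gfE r2.
      by case: ifP; rewrite ?raddf0 ?ghE.
    - by move=> x i; apply: vinj; rewrite vm linearZ ghE /= geE r3.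
    - by move=> x i; apply: vinj; rewrite vm linearZ ghE /= gfE r4.
  have [q [qm [qh qe qf] _]] := univ _ _ relX'.
  have [q1 [_ _ q1u]] := univ _ _ relX.
  have pq : p =1 q1 by exact: q1u pm (And3 ph pe pf).
  have vq : [the {linear gt -> L} of v \o q] =1 q1.
    apply: q1u => /=; first by move=> x y /=; rewrite qm vm.
    split=> [x|i|i] /=; first by rewrite qh /= ghE.
      by rewrite qe /= geE.
    by rewrite qf /= gfE.
  move=> x; have [z <-] := psurj x.
  rewrite pq -vq /=; apply/asboolP; rewrite -SP; apply/vsurj.
  by exists (q z).
(* The preimage of [J] is an ideal of the auxiliary algebra meeting the Cartan part trivially, hence
   killed by [p]. *)
- move=> J [J0 Jlin Jbr] Jh x Jx; have [z xz] := psurj x.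
  rewrite -xz; apply: (pmax [set z | J (p z)]%classic); last by rewrite /= xz.
    split => /=; first by rewrite raddf0.
      by move=> k y1 y2 ? ?; rewrite linearP; apply: Jlin.
    by move=> y1 y2 ?; rewrite pm; apply: Jbr.
  by move=> s /=; rewrite ph => /Jh ps0; apply: pinj; rewrite ph.
Qed.

End KacMoodyStructure.

(** Applying [ad (f t) - w a t] to the relation removes the term of [a]; induction treats the rest.
    The weights are arbitrary functions, so that the lemma serves both integer rows and elements of
    a dual space. *)
Lemma weights_independent (K : fieldType) (L : lieType K) (T : Type) (f : T -> L)
    (I : eqType) (w : I -> T -> K) (r : seq I) (v : I -> L) :
  uniq r ->
  {in r &, forall a b, a != b -> exists t, w a t != w b t} ->
  {in r, forall a t, {[f t, v a]} = w a t *: v a} ->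
  \sum_(a <- r) v a = 0 -> {in r, forall a, v a = 0}.
Proof.
elim: r v => [|a r IH] v //= /andP[ar ur] dist wv.
rewrite big_cons => sum0.
have wr b : b \in r -> v b = 0.
  move=> br; have ab : b != a by apply: contraNneq ar => <-.
  have br' : b \in a :: r by rewrite inE br orbT.
  have [t wt] := dist b a br' (mem_head _ _) ab.
  pose u c := (w c t - w a t) *: v c.
  suff ub : u b = 0.
    by move/eqP: ub; rewrite scaler_eq0 subr_eq0 (negbTE wt) => /eqP.
  apply: IH (br) => // [c d cr dr|c cr s|].
  - by apply: dist; rewrite inE ?cr ?dr orbT.
  - by rewrite brZr wv ?inE ?cr ?orbT // !scalerA mulrC.
  have /(congr1 (fun x => {[f t, x]} - w a t *: x)) := sum0.
  rewrite br0r scaler0 subrr brDr br_sumr scalerDr wv ?mem_head // opprD addrACA.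
  rewrite subrr add0r scaler_sumr -sumrB => s0.
  rewrite -[RHS]s0 big_seq [RHS]big_seq; apply: eq_bigr => c cr.
  by rewrite wv ?inE ?cr ?orbT // /u scalerBl.
move: sum0; rewrite big_seq big1 ?addr0 // => va0 b.
by rewrite inE => /predU1P[->|/wr].
Qed.

Section Weights.
Variables (R : realType) (n : nat) (A : 'M[int]_n) (h : realization R A).
Implicit Types (a b : 'rV[int]_n) (s t : h) (i j : 'I_n).
Local Notation d_ i := (delta_mx (0 : 'I_1) (i : 'I_n) : 'rV[int]_n).

(** Weights are integer rows in the simple roots; freeness of the simple roots embeds them into the
    dual ([wt_inj]). *)
Definition wt a s : R[i] := \sum_i (a 0 i)%:~R * tnth (simple_root h) i s.

Definition pairing i a : int := \sum_j A i j * a 0 j.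

Lemma wtD a b s : wt (a + b) s = wt a s + wt b s.
Proof.
by rewrite -big_split; apply: eq_bigr => i _; rewrite mxE intrD mulrDl.
Qed.

Lemma wtZ (m : int) a s : wt (m *: a) s = m%:~R * wt a s.
Proof. by rewrite mulr_sumr; apply: eq_bigr => i _; rewrite mxE intrM mulrA. Qed.

Lemma wtN a s : wt (- a) s = - wt a s.
Proof. by rewrite -scaleN1r wtZ mulN1r. Qed.

Lemma wtB a b s : wt (a - b) s = wt a s - wt b s.
Proof. by rewrite wtD wtN. Qed.

Lemma wt0 s : wt 0 s = 0.
Proof. by rewrite -[0](subrr 0) wtB subrr. Qed.

Lemma wt_linear a (k : R[i]) s t : wt a (k *: s + t) = k * wt a s + wt a t.
Proof.
rewrite /wt mulr_sumr -big_split; apply: eq_bigr => i _ /=.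
by rewrite linearP /= mulrDr mulrCA.
Qed.

Lemma wt_sumr a I (r : seq I) (k : I -> R[i]) (f : I -> h) :
  wt a (\sum_(x <- r) k x *: f x) = \sum_(x <- r) k x * wt a (f x).
Proof.
elim: r => [|x r IH]; last by rewrite !big_cons wt_linear IH.
rewrite !big_nil; have := wt_linear a 1 0 0; rewrite scale1r addr0 mul1r.
by move/eqP; rewrite -[X in X == _]addr0 (inj_eq (addrI _)) => /eqP.
Qed.

Lemma wt_delta i s : wt (d_ i) s = tnth (simple_root h) i s.
Proof.
rewrite /wt (bigD1 i) //= mxE !eqxx mul1r big1 ?addr0 // => j ji.
by rewrite mxE (negbTE ji) andbF mul0r.
Qed.

Lemma wt_coroot i a : wt a (tnth (simple_coroot h) i) = (pairing i a)%:~R.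
Proof.
rewrite /pairing rmorph_sum; apply: eq_bigr => j _ /=.
by rewrite root_coroot intrM mulrC.
Qed.

Lemma wt_inj a b : (forall s, wt a s = wt b s) -> a = b.
Proof.
move=> ab; apply/eqP; rewrite -subr_eq0; apply/eqP/rowP => i; rewrite [RHS]mxE.
have /freeP/(_ (fun i => ((a - b) 0 i)%:~R)) := root_free h.
move=> H; apply/eqP; rewrite -(@intr_eq0 R[i]); apply/eqP; apply: H.
apply/lfunP => s; rewrite sum_lfunE zero_lfunE.
transitivity (wt (a - b) s); last by rewrite wtB ab subrr.
by apply: eq_bigr => j _; rewrite scale_lfunE -tnth_nth.
Qed.

Lemma pairing_delta i j : pairing i (d_ j) = A i j.
Proof.
rewrite /pairing (bigD1 j) //= mxE !eqxx mulr1 big1 ?addr0 // => l lj.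
by rewrite mxE (negbTE lj) andbF mulr0.
Qed.

Lemma pairingD i a b : pairing i (a + b) = pairing i a + pairing i b.
Proof. by rewrite -big_split; apply: eq_bigr => j _; rewrite mxE mulrDr. Qed.

Lemma pairingZ i (m : int) a : pairing i (m *: a) = m * pairing i a.
Proof. by rewrite mulr_sumr; apply: eq_bigr => j _; rewrite mxE mulrCA. Qed.

Definition weight_ge0 a := [forall i, 0 <= a 0 i].

Lemma weight_ge0P a : reflect (forall i, 0 <= a 0 i) (weight_ge0 a).
Proof. exact: forallP. Qed.

Lemma delta_neq0 i : d_ i != 0.
Proof. by apply/eqP => /rowP/(_ i); rewrite !mxE !eqxx. Qed.

Lemma delta_ge0 i : weight_ge0 (d_ i).
Proof. by apply/weight_ge0P => j; rewrite mxE; case: (_ && _). Qed.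

Lemma weight_ge0D a b : weight_ge0 a -> weight_ge0 b -> weight_ge0 (a + b).
Proof.
by move=> /weight_ge0P a0 /weight_ge0P b0; apply/weight_ge0P => i; rewrite mxE addr_ge0.
Qed.

Lemma weight_ge0_anti a : weight_ge0 a -> weight_ge0 (- a) -> a = 0.
Proof.
move=> /weight_ge0P a0 /weight_ge0P b0; apply/rowP => i; apply/eqP.
by rewrite eq_le [X in _ <= X]mxE -oppr_ge0; move: (b0 i) (a0 i); rewrite !mxE => -> ->.
Qed.

Lemma weight_ge0D_neq0 a b : weight_ge0 a -> weight_ge0 b -> a != 0 -> a + b != 0.
Proof.
move=> a0 b0; apply: contraNneq => ab; rewrite (weight_ge0_anti a0) //.
by rewrite (_ : - a = b) // -[b](addKr a) ab addr0.
Qed.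

Variables (L : lieType R[i]).

(** The span of the right-normed brackets of weight [a]. With [gen_f] for [e] the same definition
    describes the negative half, weights being negated. *)
Inductive npos (e : 'I_n -> L) : 'rV[int]_n -> L -> Prop :=
| npos0 a : npos e a 0
| npos_gen i : npos e (d_ i) (e i)
| npos_bracket i a x : npos e a x -> npos e (d_ i + a) {[e i, x]}
| npos_lin a k x y : npos e a x -> npos e a y -> npos e a (k *: x + y).

Lemma nposZ e a k x : npos e a x -> npos e a (k *: x).
Proof. by move=> ex; rewrite -[k *: x]addr0; apply: npos_lin => //; apply: npos0. Qed.

Lemma nposD e a x y : npos e a x -> npos e a y -> npos e a (x + y).
Proof. by move=> ex ey; rewrite -[x]scale1r; apply: npos_lin. Qed.

Lemma npos_sign e a x : npos e a x -> x = 0 \/ weight_ge0 a /\ a != 0.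
Proof.
elim=> [b|i|i b y _ IH|b k y z _ IHy _ IHz].
- by left.
- by right; rewrite delta_ge0 delta_neq0.
- have [->|[b0 bN0]] := IH; first by left; rewrite br0r.
  by right; rewrite weight_ge0D ?delta_ge0 // weight_ge0D_neq0 ?delta_ge0 ?delta_neq0.
- by have [->|?] := IHy; [have [->|?] := IHz; [left; rewrite scaler0 addr0|right]|right].
Qed.

Implicit Types (X : generators h L).

Definition weightsp X a x := forall s, {[gen_h X s, x]} = wt a s *: x.

Lemma weightsp0 X a : weightsp X a 0.
Proof. by move=> s; rewrite br0r scaler0. Qed.

Lemma weightsp_lin X a k x y :
  weightsp X a x -> weightsp X a y -> weightsp X a (k *: x + y).
Proof. by move=> ax ay s; rewrite brDr brZr ax ay scalerDr !scalerA mulrC. Qed.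

Lemma weightspZ X a k x : weightsp X a x -> weightsp X a (k *: x).
Proof. by move=> ax; rewrite -[k *: x]addr0; apply: weightsp_lin => //; apply: weightsp0. Qed.

Lemma weightsp_bracket X a b x y :
  weightsp X a x -> weightsp X b y -> weightsp X (a + b) {[x, y]}.
Proof. by move=> ax ay s; rewrite br_jacobi ax ay brZl brZr wtD scalerDl. Qed.

Section Relations.
Variable X : generators h L.
Hypothesis rel : defining_relations X.

Lemma weightsp_e i : weightsp X (d_ i) (gen_e X i).
Proof. by move=> s; case: rel => _ _ -> _; rewrite wt_delta. Qed.

Lemma weightsp_f i : weightsp X (- d_ i) (gen_f X i).
Proof. by move=> s; case: rel => _ _ _ ->; rewrite wtN wt_delta. Qed.

Lemma weightsp_h s : weightsp X 0 (gen_h X s).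
Proof. by move=> t; case: rel => -> _ _ _; rewrite wt0 scale0r. Qed.

Lemma npos_weightsp a x : npos (gen_e X) a x -> weightsp X a x.
Proof.
elim=> [b|i|i b y _ IH|b k y z _ IHy _ IHz].
- exact: weightsp0.
- exact: weightsp_e.
- exact: weightsp_bracket (weightsp_e i) IH.
- exact: weightsp_lin.
Qed.

(** Moving [f_i] through a right-normed bracket creates only Cartan elements acting by scalars; one
    survives by itself only in weight [d_ i]. *)
Lemma npos_f a x i : npos (gen_e X) a x ->
  (a = d_ i /\ exists c, {[gen_f X i, x]} = c *: gen_h X (tnth (simple_coroot h) i))
  \/ npos (gen_e X) (a - d_ i) {[gen_f X i, x]}.
Proof.
have fe j : {[gen_f X i, gen_e X j]} =
    if j == i then - gen_h X (tnth (simple_coroot h) i) else 0.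
  case: rel => _ r _ _; rewrite brC r.
  by case: eqP => [->|] //; rewrite oppr0.
elim=> [b|j|j b y ey IH|b k y z ey IHy ez IHz].
- by right; rewrite br0r; apply: npos0.
- rewrite fe; case: eqP => [->|_]; last by right; apply: npos0.
  by left; split=> //; exists (-1); rewrite scaleN1r.
- rewrite br_jacobi fe; right.
  have -> : d_ j + b - d_ i = d_ j + (b - d_ i) by rewrite addrA.
  apply: nposD.
    case: eqP => [->|_]; last by rewrite br0l; apply: npos0.
    rewrite brNl (npos_weightsp ey) -scaleNr addrC subrK; exact: nposZ.
  case: IH => [[-> [c ->]]|IH]; last exact: npos_bracket.
  rewrite brZr brC (weightsp_e j) -scaleNr scalerA subrr addr0.
  by apply: nposZ; apply: npos_gen.
- rewrite brDr brZr; case: IHy => [[bi [c cE]]|IHy].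
    left; split=> //; case: IHz => [[_ [c' c'E]]|].
      by exists (k * c + c'); rewrite cE c'E scalerDl scalerA.
    rewrite bi subrr => /npos_sign[->|[_ /eqP//]].
    by exists (k * c); rewrite cE addr0 scalerA.
  case: IHz => [[bi [c cE]]|IHz]; last by right; apply: npos_lin.
  left; split=> //; exists c; rewrite cE; move: IHy; rewrite bi subrr.
  by move=> /npos_sign[->|[_ /eqP//]]; rewrite scaler0 add0r.
Qed.

End Relations.

End Weights.

Section OppositeGenerators.
Variables (R : realType) (n : nat) (A : 'M[int]_n) (h : realization R A).
Variables (L : lieType R[i]) (X : generators h L).

Definition opp_gen_h s := - gen_h X s.

Fact opp_gen_h_linear : linear opp_gen_h.
Proof. by move=> k s t; rewrite /opp_gen_h linearP opprD scalerN. Qed.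

HB.instance Definition _ := GRing.isLinear.Build _ _ _ _ opp_gen_h opp_gen_h_linear.

(** The Chevalley involution, performed on the generators instead of the algebra: each result on [e]
    and positive weights yields its mirror image for [f]. *)
Definition opp_generators : generators h L :=
  Generators opp_gen_h (gen_f X) (gen_e X).

Lemma opp_kac_moody : kac_moody_structure X -> kac_moody_structure opp_generators.
Proof.
move=> [[r1 r2 r3 r4] inj gcmA gen idf].
have hE s : gen_h X s = gen_h opp_generators (- s) by rewrite /= /opp_gen_h linearN opprK.
split=> //.
- split=> /=; rewrite /opp_gen_h.
  + by move=> x y; rewrite brNl brNr opprK r1.
  + by move=> i j; rewrite brC r2 eq_sym; case: eqP => [->|]; rewrite ?oppr0.
  + by move=> x i; rewrite brNl r4 scaleNr opprK.
  + by move=> x i; rewrite brNl r3 scaleNr.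
- by move=> s t /oppr_inj/inj.
- move=> P Plin Pbr Ph Pf Pe; apply: gen => // s.
  by rewrite hE; apply: Ph.
- move=> J Jid JX; apply: idf => // s; rewrite hE => /JX.
  by [].
Qed.

Lemma weightsp_opp a x : weightsp opp_generators a x <-> weightsp X (- a) x.
Proof.
split=> ax s; have := ax s; rewrite /= /opp_gen_h brNl wtN.
  by move/(congr1 (fun z => - z)); rewrite opprK scaleNr.
by rewrite scaleNr => ->; rewrite opprK.
Qed.

End OppositeGenerators.

Section RootSpaces.
Variables (R : realType) (n : nat) (A : 'M[int]_n) (h : realization R A).
Variables (L : lieType R[i]) (X : generators h L).
Hypothesis km : kac_moody_structure X.
Let rel := km_rel km.
Let relN := km_rel (opp_kac_moody km).
Implicit Types (a b : 'rV[int]_n) (s t : h) (i j : 'I_n).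
Local Notation d_ i := (delta_mx (0 : 'I_1) (i : 'I_n) : 'rV[int]_n).

(** The elements whose adjoint action preserves [S] form a subalgebra. *)
Lemma generated_stable (S : L -> Prop) :
  (forall k x y, S x -> S y -> S (k *: x + y)) ->
  (forall s x, S x -> S {[gen_h X s, x]}) ->
  (forall i x, S x -> S {[gen_e X i, x]}) ->
  (forall i x, S x -> S {[gen_f X i, x]}) ->
  forall x y, S y -> S {[x, y]}.
Proof.
move=> Slin Sh Se Sf; apply: (km_gen km) => //.
- by move=> k x y Px Py z Sz; rewrite brDl brZl; apply: Slin; [apply: Px | apply: Py].
- move=> x y Px Py z Sz; rewrite br_jacobil addrC -scaleN1r.
  by apply: Slin; [apply/Py/Px | apply/Px/Py].
Qed.

(** The explicit candidate for the weight space of [a], shown to be all of it in [homogP]. A weight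
    with coordinates of both signs falls into the last case, where [npos_sign] leaves only zero. *)
Definition homog a x : Prop :=
  if a == 0 then exists s, x = gen_h X s
  else if weight_ge0 a then npos (gen_e X) a x else npos (gen_f X) (- a) x.

Lemma npos_e_homog a x : npos (gen_e X) a x -> a != 0 -> homog a x.
Proof.
move=> ax aN0; rewrite /homog (negbTE aN0); case: ifPn => // aN.
by have [->|[]] := npos_sign ax; [apply: npos0|rewrite (negbTE aN)].
Qed.

Lemma npos_f_homog a x : npos (gen_f X) (- a) x -> a != 0 -> homog a x.
Proof.
move=> ax aN0; rewrite /homog (negbTE aN0); case: ifPn => // a0.
have [->|[b0 bN0]] := npos_sign ax; first exact: npos0.
by rewrite (weight_ge0_anti a0 b0) eqxx in aN0.
Qed.

Lemma homog0 a : homog a 0.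
Proof.
rewrite /homog; case: ifP => _; first by exists 0; rewrite raddf0.
by case: ifP => _; apply: npos0.
Qed.

Lemma homog_lin a k x y : homog a x -> homog a y -> homog a (k *: x + y).
Proof.
rewrite /homog; case: ifP => _.
  by move=> [s ->] [t ->]; exists (k *: s + t); rewrite linearP.
by case: ifP => _; apply: npos_lin.
Qed.

Lemma homogZ a k x : homog a x -> homog a (k *: x).
Proof. by move=> ax; rewrite -[k *: x]addr0; apply: homog_lin => //; apply: homog0. Qed.

Lemma homog_weightsp a x : homog a x -> weightsp X a x.
Proof.
rewrite /homog; case: ifP => [/eqP ->[s ->]|_]; first exact: weightsp_h.
case: ifP => _; first exact: npos_weightsp.
by move=> ax; rewrite -[a]opprK; apply/weightsp_opp; apply: (npos_weightsp relN).
Qed.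

Lemma homog_e a x i : homog a x -> homog (d_ i + a) {[gen_e X i, x]}.
Proof.
have [->|aN0] := eqVneq a 0.
  rewrite {1}/homog eqxx => -[s ->].
  rewrite addr0 brC (weightsp_e rel) -scaleNr; apply: homogZ.
  exact: npos_e_homog (npos_gen _ _) (delta_neq0 i).
rewrite {1}/homog (negbTE aN0); case: ifPn => [a0 ax|_ ax].
  apply: npos_e_homog; first exact: npos_bracket.
  by apply: weight_ge0D_neq0; rewrite ?delta_ge0 ?delta_neq0.
(* On negative weights [e_i] is the lowering operator of [opp_generators]. *)
case: (npos_f relN i ax) => [[ai [c]]|] /=.
  move=> ->; apply: homogZ; rewrite -ai addNr /homog eqxx.
  by exists (- tnth (simple_coroot h) i); rewrite linearN.
rewrite -opprD (addrC a); have [->|daN0] := eqVneq (d_ i + a) 0; last first.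
  by move=> H; apply: npos_f_homog.
by rewrite oppr0 => /npos_sign[->|[_ /eqP//]]; apply: homog0.
Qed.

End RootSpaces.

Section RootDecomposition.
Variables (R : realType) (n : nat) (A : 'M[int]_n) (h : realization R A).
Variables (L : lieType R[i]) (X : generators h L).
Hypothesis km : kac_moody_structure X.
Let rel := km_rel km.
Let kmN := opp_kac_moody km.
Implicit Types (a b : 'rV[int]_n) (s t : h) (i j : 'I_n).
Local Notation d_ i := (delta_mx (0 : 'I_1) (i : 'I_n) : 'rV[int]_n).

Lemma homog_opp (Y : generators h L) a x :
  homog Y a x -> homog (opp_generators Y) (- a) x.
Proof.
rewrite /homog oppr_eq0; case: ifPn => [_ [s ->]|aN0].
  by exists (- s); rewrite /= /opp_gen_h linearN opprK.
rewrite opprK /=; case: ifPn => a0 ax; case: ifPn => // aN.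
  by rewrite (weight_ge0_anti a0 aN) eqxx in aN0.
have [->|[]] := npos_sign ax; first exact: npos0.
by rewrite (negbTE aN).
Qed.

Lemma homog_f a x i : homog X a x -> homog X (- d_ i + a) {[gen_f X i, x]}.
Proof.
move=> /homog_opp ax; have /homog_opp /= := homog_e kmN i ax.
rewrite opprD opprK /homog; case: ifP => // _ [s ->].
by exists s; rewrite /= /opp_gen_h opprK.
Qed.

Lemma homog_h a x s : homog X a x -> homog X a {[gen_h X s, x]}.
Proof. by move=> ax; rewrite (homog_weightsp km ax); apply: homogZ. Qed.

Inductive homog_sum : L -> Prop :=
| homog_sum0 : homog_sum 0
| homog_sumS a x y : homog X a x -> homog_sum y -> homog_sum (x + y).

Let homog_sumD x y : homog_sum x -> homog_sum y -> homog_sum (x + y).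
Proof.
elim=> [|a {}x z ax _ IH] hy; first by rewrite add0r.
by rewrite -addrA; apply: homog_sumS ax (IH hy).
Qed.

Let homog_sum_map (f : L -> L) : {morph f : x y / x + y} -> f 0 = 0 ->
  (forall a x, homog X a x -> exists b, homog X b (f x)) ->
  forall x, homog_sum x -> homog_sum (f x).
Proof.
move=> fD f0 fh x; elim=> [|a {}x y /fh[b bx] _ IH].
  by rewrite f0; apply: homog_sum0.
by rewrite fD; apply: homog_sumS bx IH.
Qed.

Let homog_sum1 a x : homog X a x -> homog_sum x.
Proof. by move=> ax; rewrite -[x]addr0; apply: homog_sumS ax homog_sum0. Qed.

Let homog_sum_lin k x y : homog_sum x -> homog_sum y -> homog_sum (k *: x + y).
Proof.
move=> hx; apply: homog_sumD; apply: (homog_sum_map _ _ _ hx).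
- by move=> u v; rewrite scalerDr.
- exact: scaler0.
- by move=> a u au; exists a; apply: homogZ.
Qed.

Lemma homog_sumT x : homog_sum x.
Proof.
have stab := @generated_stable _ _ _ _ _ _ km homog_sum homog_sum_lin.
have {}stab : forall x y, homog_sum y -> homog_sum {[x, y]}.
  apply: stab => [s|i|i]; apply: homog_sum_map; rewrite ?br0r //;
    try (by move=> u v; rewrite brDr); move=> a u au.
  - by exists a; apply: homog_h.
  - by exists (d_ i + a); apply: homog_e.
  - by exists (- d_ i + a); apply: homog_f.
elim/(km_gen km): x => // [x y _|s|i|i]; first exact: stab.
- by apply: (@homog_sum1 0); rewrite /homog eqxx; exists s.
- apply: (@homog_sum1 (d_ i)); apply: npos_e_homog (delta_neq0 i); exact: npos_gen.
- apply: (@homog_sum1 (- d_ i)); apply: npos_f_homog; last by rewrite oppr_eq0 delta_neq0.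
  by rewrite opprK; apply: npos_gen.
Qed.

(** As [v] is total and vanishes outside [r], it does not depend on [r], and uniqueness can be
    stated pointwise. *)
Definition components (r : seq 'rV[int]_n) (v : 'rV[int]_n -> L) x : Prop :=
  [/\ uniq r, forall a, homog X a (v a), forall a, a \notin r -> v a = 0 &
      x = \sum_(a <- r) v a].

Lemma components_exist x : exists r v, components r v x.
Proof.
elim: (homog_sumT x) => [|a {}x y ax _ [r [v [ur hv v0 yE]]]].
  exists [::], (fun=> 0); split=> //; last by rewrite big_nil.
  by move=> a; apply: homog0.
exists (undup (a :: r)), (fun b => (if b == a then x else 0) + v b); split.
- exact: undup_uniq.
- move=> b; rewrite -[if _ then _ else _]scale1r; apply: homog_lin => //.
  by case: eqP => [->|_] //; apply: homog0.
- by move=> b; rewrite mem_undup inE negb_or => /andP[/negbTE -> br]; rewrite v0 ?addr0.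
- rewrite big_split /= -big_mkcond /= yE; congr (_ + _).
    rewrite -big_filter (_ : [seq b <- undup (a :: r) | b == a] = [:: a]) ?big_seq1 //.
    by rewrite filter_pred1_uniq ?undup_uniq // mem_undup mem_head.
  rewrite /=; case: ifP => ar; first by rewrite undup_id.
  by rewrite big_cons v0 ?ar // add0r undup_id.
Qed.

End RootDecomposition.

(** * Integrability and reflections *)

Section Sl2.
Variables (K : numFieldType) (L : lieType K).
Implicit Types (x y z v : L) (m : K).

Definition adn N x v := iter N (bracket x) v.

Definition sl2_triple x y z :=
  [/\ {[x, y]} = z, {[z, x]} = 2 *: x & {[z, y]} = - 2 *: y].

Lemma sl2_sym x y z : sl2_triple x y z -> sl2_triple y x (- z).
Proof.
by case=> xy zx zy; split; [rewrite brC xy|rewrite brNl zy scaleNr opprK|rewrite brNl zx scaleNr].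
Qed.

Lemma adnS N x v : adn N.+1 x v = {[x, adn N x v]}.
Proof. by []. Qed.

Lemma adnSr N x v : adn N.+1 x v = adn N x {[x, v]}.
Proof. by rewrite /adn iterSr. Qed.

Lemma adn0r N x : adn N x 0 = 0.
Proof. by elim: N => // N IH; rewrite adnS IH br0r. Qed.

Lemma adnZr N x m v : adn N x (m *: v) = m *: adn N x v.
Proof. by elim: N => // N IH; rewrite !adnS IH brZr. Qed.

Lemma adnDr N x v w : adn N x (v + w) = adn N x v + adn N x w.
Proof. by elim: N => // N IH; rewrite !adnS IH brDr. Qed.

Lemma adn_stop M N x v : (M <= N)%N -> adn M x v = 0 -> adn N x v = 0.
Proof.
by move=> /subnK <- H; rewrite /adn iterD -/(adn M x v) H -/(adn _ x 0) adn0r.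
Qed.

Lemma sl2_weight_lower x y z v m N : sl2_triple x y z -> {[z, v]} = m *: v ->
  {[z, adn N y v]} = (m - 2 * N%:R) *: adn N y v.
Proof.
move=> [_ _ zy] zv; elim: N => [|N IH]; first by rewrite mulr0 subr0.
rewrite adnS br_jacobi zy IH brZl brZr -scalerDl; congr (_ *: _).
by rewrite -[in RHS]natr1; ring.
Qed.

Lemma sl2_weight_raise x y z v m : sl2_triple x y z -> {[z, v]} = m *: v ->
  {[z, {[x, v]}]} = (m + 2) *: {[x, v]}.
Proof. by move=> [_ zx _] zv; rewrite br_jacobi zx zv brZl brZr -scalerDl addrC. Qed.

Lemma sl2_raise_lower x y z v m N : sl2_triple x y z -> {[z, v]} = m *: v ->
  {[x, adn N.+1 y v]} =
    adn N.+1 y {[x, v]} + (N.+1%:R * (m - N%:R)) *: adn N y v.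
Proof.
move=> sl zv; have [xy _ _] := sl; elim: N => [|N IH].
  by rewrite /adn /= br_jacobi xy zv mul1r subr0 addrC.
rewrite adnS br_jacobi xy (sl2_weight_lower N.+1 sl zv) IH brDr brZr -!adnS.
rewrite addrCA -scalerDl; congr (_ + _ *: _).
by rewrite -!natr1; ring.
Qed.

Lemma sl2_highest_nat x y z v m N : sl2_triple x y z -> {[z, v]} = m *: v ->
  v != 0 -> {[x, v]} = 0 -> adn N y v = 0 -> exists p : nat, m = p%:R.
Proof.
move=> sl zv v0 xv; elim: N => [/eqP|N IH yv]; first by rewrite (negbTE v0).
have := sl2_raise_lower N sl zv; rewrite yv br0r xv adn0r add0r => /esym/eqP.
rewrite scaler_eq0 mulf_eq0 pnatr_eq0 /= subr_eq0 => /orP[/eqP ->|/eqP/IH//].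
by exists N.
Qed.

(** Injectivity of the [p]-th power of [ad y] on weight [p]. Induction on the nilpotency order of
    [x] first kills [{[x, v]}], of weight [p + 2]; for such a [v] the coefficients of
    [sl2_raise_lower] below step [p] are nonzero, so one can descend to [v] itself. *)
Lemma sl2_lower_inj x y z v p N : sl2_triple x y z -> {[z, v]} = p%:R *: v ->
  adn N x v = 0 -> adn p y v = 0 -> v = 0.
Proof.
move=> sl; elim: N v p => // N IH v p zv xv yv.
have xv0 : {[x, v]} = 0.
  apply: (IH _ p.+2).
  - by rewrite (sl2_weight_raise sl zv) -natrD addn2.
  - by rewrite -adnSr.
  - have /eqP := sl2_raise_lower p.+1 sl zv.
    have yv1 : adn p.+1 y v = 0 by rewrite adnS yv br0r.
    by rewrite adnS yv1 !br0r scaler0 addr0 eq_sym => /eqP.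
have H q : (q <= p)%N -> adn (p - q) y v = 0.
  elim: q => [|q IHq] qp; first by rewrite subn0.
  have := IHq (ltnW qp); rewrite -(prednK (_ : 0 < p - q)%N) ?subn_gt0 // -subnS => yq.
  have := sl2_raise_lower (p - q.+1) sl zv; rewrite yq br0r xv0 adn0r add0r.
  move/esym/eqP; rewrite scaler_eq0 mulf_eq0 pnatr_eq0 /= => /orP[|/eqP//].
  by rewrite -natrB ?leq_subr // pnatr_eq0 subKn.
by have := H p (leqnn p); rewrite subnn.
Qed.

Lemma adn_bracket M N x u v : adn M x u = 0 -> adn N x v = 0 ->
  adn (M + N) x {[u, v]} = 0.
Proof.
have [P le] := ubnP (M + N)%N; elim: P M N u v le => // P IH M N u v le.
case: M le => [|M] le; first by move=> u0 _; rewrite (_ : u = 0) // br0l adn0r.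
case: N le => [|N] le; first by move=> _ v0; rewrite (_ : v = 0) // br0r adn0r.
rewrite addSn ltnS in le; move=> ux vx; rewrite addSn adnSr br_jacobi adnDr IH -?adnSr ?add0r //.
by rewrite -addSnnS IH -?adnSr // addSnnS.
Qed.

End Sl2.

Lemma sum_superset (V : nmodType) (I : eqType) (r r' : seq I) (v : I -> V) :
  uniq r -> uniq r' -> (forall b, b \notin r -> v b = 0) -> {subset r <= r'} ->
  \sum_(b <- r') v b = \sum_(b <- r) v b.
Proof.
move=> ur ur' v0 rr'; rewrite (bigID (mem r)) /= [X in _ + X]big1 => [|b /v0 //].
rewrite addr0 -[LHS]big_filter; apply: perm_big; apply: uniq_perm => //.
  exact: filter_uniq.
by move=> b; rewrite mem_filter; case br: (b \in r) => //=; rewrite rr'.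
Qed.

Lemma sum_undup_cat (V : nmodType) (I : eqType) (r r' : seq I) (v w : I -> V) :
  uniq r -> uniq r' -> (forall b, b \notin r -> v b = 0) ->
  (forall b, b \notin r' -> w b = 0) ->
  \sum_(b <- undup (r ++ r')) v b = \sum_(b <- r) v b /\
  \sum_(b <- undup (r ++ r')) w b = \sum_(b <- r') w b.
Proof.
by move=> ur ur' v0 w0; split; apply: sum_superset; rewrite ?undup_uniq // => b;
  rewrite mem_undup mem_cat => ->; rewrite ?orbT.
Qed.

Section RootTheory.
Variables (R : realType) (n : nat) (A : 'M[int]_n) (h : realization R A).
Variables (L : lieType R[i]) (X : generators h L).
Hypothesis km : kac_moody_structure X.
Let rel := km_rel km.
Implicit Types (a b : 'rV[int]_n) (s t : h) (i j : 'I_n).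
Local Notation d_ i := (delta_mx (0 : 'I_1) (i : 'I_n) : 'rV[int]_n).

Lemma weightsp_indep (r : seq 'rV[int]_n) v : uniq r ->
  (forall a, weightsp X a (v a)) -> \sum_(a <- r) v a = 0 ->
  forall a, a \in r -> v a = 0.
Proof.
move=> ur hv s0 a ar.
apply: (weights_independent (f := gen_h X) (w := @wt _ _ _ h) ur _ _ s0 ar).
- move=> b c _ _ bc; apply: contrapT => H; case/eqP: bc; apply: (@wt_inj _ _ _ h) => s.
  by apply: contrapT => /eqP ?; apply: H; exists s.
- by move=> b _ s; apply: hv.
Qed.

Lemma components_uniq r1 v1 r2 v2 x :
  components X r1 v1 x -> components X r2 v2 x -> v1 =1 v2.
Proof.
move=> [u1 h1 z1 e1] [u2 h2 z2 e2] a.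
apply/eqP; rewrite -subr_eq0; apply/eqP.
have [ar|] := boolP (a \in undup (r1 ++ r2)); last first.
  by rewrite mem_undup mem_cat negb_or => /andP[/z1 -> /z2 ->]; rewrite subr0.
apply: (@weightsp_indep (undup (r1 ++ r2)) (fun a => v1 a - v2 a)) ar.
- exact: undup_uniq.
- move=> b; rewrite -scaleN1r addrC; apply: weightsp_lin.
    exact: (homog_weightsp km (h2 b)).
  exact: (homog_weightsp km (h1 b)).
- have [s1 s2] := sum_undup_cat u1 u2 z1 z2.
  by rewrite sumrB s1 s2 -e1 -e2 subrr.
Qed.

Definition wcomp x : 'rV[int]_n -> L :=
  projT1 (cid (let: ex_intro r (ex_intro v H) := components_exist km x in
               ex_intro (fun v => exists r, components X r v x) v (ex_intro _ r H))).

Lemma wcompP x : exists r, components X r (wcomp x) x.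
Proof. by rewrite /wcomp; case: cid. Qed.

Lemma wcomp_homog a x : homog X a (wcomp x a).
Proof. by case: (wcompP x) => r []. Qed.

Lemma wcomp_weightsp a x : weightsp X a (wcomp x a).
Proof. exact: (homog_weightsp km (wcomp_homog a x)). Qed.

Lemma wcomp_unique r v x : components X r v x -> wcomp x =1 v.
Proof. by case: (wcompP x) => r' H /(components_uniq H). Qed.

Lemma wcomp_homog1 a x b : homog X a x -> wcomp x b = if b == a then x else 0.
Proof.
move=> ax; apply: (@wcomp_unique [:: a] (fun b => if b == a then x else 0)).
split=> // [c|c|]; last by rewrite big_seq1 eqxx.
  by case: eqP => [->|_] //; apply: homog0.
by rewrite inE => /negbTE ->.
Qed.

Lemma wcomp_lin k x y b : wcomp (k *: x + y) b = k *: wcomp x b + wcomp y b.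
Proof.
have [r1 [u1 h1 z1 e1]] := wcompP x; have [r2 [u2 h2 z2 e2]] := wcompP y.
pose r := undup (r1 ++ r2).
apply: (@wcomp_unique r (fun b => k *: wcomp x b + wcomp y b)).
split; first exact: undup_uniq.
- by move=> c; apply: homog_lin.
- move=> c; rewrite mem_undup mem_cat negb_or => /andP[/z1 -> /z2 ->].
  by rewrite scaler0 addr0.
- have [s1 s2] := sum_undup_cat u1 u2 z1 z2.
  by rewrite big_split /= -scaler_sumr s1 s2 -e1 -e2.
Qed.

Lemma wcomp0 b : wcomp 0 b = 0.
Proof. by rewrite (wcomp_homog1 _ (homog0 X 0)); case: eqP. Qed.

Lemma wcompD x y b : wcomp (x + y) b = wcomp x b + wcomp y b.
Proof. by have := wcomp_lin 1 x y b; rewrite !scale1r. Qed.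

Lemma wcompZ k x b : wcomp (k *: x) b = k *: wcomp x b.
Proof. by have := wcomp_lin k x 0 b; rewrite wcomp0 !addr0. Qed.

Lemma wcomp_sum I (r : seq I) (F : I -> L) b :
  wcomp (\sum_(i <- r) F i) b = \sum_(i <- r) wcomp (F i) b.
Proof. by apply: (big_morph (wcomp^~ b)) => [x y|]; rewrite ?wcompD ?wcomp0. Qed.

(** The element [x], placed in weight [a], minus its own components is a relation between distinct
    weights. *)
Lemma homogP a x : weightsp X a x <-> homog X a x.
Proof.
split; last exact: (homog_weightsp km).
move=> ax; have [r [ur hr zr er]] := wcompP x.
suff -> : x = wcomp x a by [].
apply/eqP; rewrite -subr_eq0; apply/eqP.
have zero : \sum_(b <- undup (a :: r)) ((if b == a then x else 0) - wcomp x b) = 0.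
  rewrite sumrB -big_mkcond /=.
  have -> : \sum_(b <- undup (a :: r) | b == a) x = x.
    by rewrite -big_filter filter_pred1_uniq ?undup_uniq ?mem_undup ?mem_head // big_seq1.
  rewrite [X in _ - X](_ : _ = x) ?subrr //.
  rewrite /=; case: ifP => ar; first by rewrite undup_id.
  by rewrite big_cons zr ?ar // add0r undup_id.
have H := weightsp_indep (undup_uniq _) _ zero.
have := H _ a; rewrite eqxx; apply; last by rewrite mem_undup mem_head.
move=> b; rewrite -scaleN1r addrC; apply: weightsp_lin; first exact: wcomp_weightsp.
by case: eqP => [->|_] //; apply: weightsp0.
Qed.

Lemma wcomp_weight a x b : weightsp X a x -> wcomp x b = if b == a then x else 0.
Proof. by move/homogP/wcomp_homog1. Qed.

Lemma wcomp_bracket c y z b : weightsp X c y ->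
  wcomp {[y, z]} b = {[y, wcomp z (b - c)]}.
Proof.
move=> cy; have [r [ur hr zr er]] := wcompP z.
rewrite {1}er br_sumr wcomp_sum.
under eq_bigr => a _.
  rewrite (wcomp_weight _ (weightsp_bracket cy (wcomp_weightsp a z))).
  rewrite (_ : (b == c + a) = (a == b - c)); last by rewrite [RHS]eq_sym subr_eq addrC.
  over.
have [br|br] := boolP (b - c \in r).
  rewrite -big_mkcond -big_filter filter_pred1_uniq // big_seq1 //.
rewrite (zr _ br) br0r big1_seq // => a /andP[_ ar].
by case: eqP => [ab|//]; rewrite -ab ar in br.
Qed.

Lemma weightsp0P x : weightsp X 0 x <-> exists s, x = gen_h X s.
Proof. by split=> [/homogP|[s ->]]; [rewrite /homog eqxx|apply: weightsp_h]. Qed.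

Lemma weightsp_sign a x : weightsp X a x -> x != 0 -> weight_ge0 a || weight_ge0 (- a).
Proof.
move/homogP; rewrite /homog; case: ifP => [/eqP ->|_].
  by move=> _ _; apply/orP; left; apply/weight_ge0P => i; rewrite mxE.
case: ifP => // _ /npos_sign[->|[->]]; by rewrite ?eqxx ?orbT.
Qed.

Lemma weightsp_npos a x : weightsp X a x -> weight_ge0 a -> a != 0 -> npos (gen_e X) a x.
Proof. by move=> /homogP; rewrite /homog => + a0 aN0; rewrite (negbTE aN0) a0. Qed.

(** Only [e i] can enter a bracket of such a weight, and [{[e i, e i]} = 0]. *)
Lemma npos_simple (e : 'I_n -> L) a x i : npos e a x -> (forall j, j != i -> a 0 j = 0) ->
  x = 0 \/ a = d_ i /\ exists c, x = c *: e i.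
Proof.
have dj j : (forall l, l != i -> (d_ j) 0 l = 0) -> j = i.
  by move=> H; apply/eqP/negPn/negP => /H; rewrite mxE !eqxx.
elim=> [b|j|j b y ey IH|b k y z _ IHy _ IHz] bi.
- by left.
- by right; rewrite (dj j bi); split=> //; exists 1; rewrite scale1r.
- have [->|[b0 bN0]] := npos_sign ey; first by left; rewrite br0r.
  have H l : l != i -> (d_ j) 0 l = 0 /\ b 0 l = 0.
    move=> /bi; rewrite mxE => /eqP.
    have := weight_ge0P _ (delta_ge0 j) l; have := weight_ge0P _ b0 l.
    by move=> p q; rewrite paddr_eq0 // => /andP[/eqP-> /eqP->].
  have ji : j = i by apply: dj => l /H[].
  left; case: IH => [l /H[]//|->|[_ [c ->]]]; first by rewrite br0r.
  by rewrite ji brZr bracketxx scaler0.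
- have [->|[ai [c ->]]] := IHy bi; have [->|[ai' [c' ->]]] := IHz bi.
  + by left; rewrite scaler0 addr0.
  + by right; split=> //; exists c'; rewrite scaler0 add0r.
  + by right; split=> //; exists (k * c); rewrite addr0 scalerA.
  + by right; split=> //; exists (k * c + c'); rewrite scalerDl scalerA.
Qed.

Lemma weightsp_delta i x : weightsp X (d_ i) x -> exists c, x = c *: gen_e X i.
Proof.
move=> /weightsp_npos; rewrite delta_ge0 delta_neq0 => /(_ isT isT) ix.
have [j ji|->|[_ //]] := npos_simple (i := i) ix; last by exists 0; rewrite scale0r.
by rewrite mxE (negbTE ji) andbF.
Qed.

Lemma weightsp_multiple i (m : int) x : weightsp X (m *: d_ i) x -> 1 < m -> x = 0.
Proof.
move=> ax m1; have /npos_simple : npos (gen_e X) (m *: d_ i) x.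
  apply: weightsp_npos => //.
    by apply/weight_ge0P => j; rewrite !mxE mulr_ge0 ?(ltW (lt_trans _ m1)) //; case: (_ && _).
  by apply/eqP => /rowP/(_ i); rewrite !mxE !eqxx mulr1 => m0; move: m1; rewrite m0.
case/(_ i) => [j ji|//|[/rowP/(_ i)]]; first by rewrite !mxE (negbTE ji) andbF mulr0.
by rewrite !mxE !eqxx mulr1 => m1'; move: m1; rewrite m1' ltxx.
Qed.

End RootTheory.

Section Integrability.
Variables (R : realType) (n : nat) (A : 'M[int]_n) (h : realization R A).
Variables (L : lieType R[i]) (X : generators h L).
Hypothesis km : kac_moody_structure X.
Let rel := km_rel km.
Implicit Types (a b : 'rV[int]_n) (s t : h) (i j : 'I_n).
Local Notation d_ i := (delta_mx (0 : 'I_1) (i : 'I_n) : 'rV[int]_n).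

(* When [x] is killed by all [f_i] this is the ideal generated by [x]. *)
Inductive raised (x : L) : L -> Prop :=
| raised_base : raised x x
| raised_e i z : raised x z -> raised x {[gen_e X i, z]}
| raised_lin k y z : raised x y -> raised x z -> raised x (k *: y + z).

(** The ideal [raised x] has only nonzero nonnegative weights, so it misses the Cartan subalgebra
    and [km_ideal] annihilates it. *)
Lemma lowest_vector_eq0 a x : weightsp X a x -> weight_ge0 a -> a != 0 ->
  (forall i, {[gen_f X i, x]} = 0) -> x = 0.
Proof.
move=> ax a0 aN0 fx.
have r0 : raised x 0.
  have := raised_lin (-1) (raised_base x) (raised_base x).
  by rewrite scaleN1r addNr.
have rZ k z : raised x z -> raised x (k *: z).
  by move=> rz; rewrite -[k *: z]addr0; apply: raised_lin.
have rh s z : raised x z -> raised x {[gen_h X s, z]}.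
  elim=> [|i {}z rz IH|k y {}z _ IHy _ IHz].
  - by rewrite ax; apply: rZ; apply: raised_base.
  - rewrite br_jacobi (weightsp_e rel) brZl; apply: raised_lin; first exact: raised_e.
    exact: raised_e.
  - by rewrite brDr brZr; apply: raised_lin.
have rf i z : raised x z -> raised x {[gen_f X i, z]}.
  elim=> [|j {}z rz IH|k y {}z _ IHy _ IHz].
  - by rewrite fx.
  - rewrite br_jacobi -[X in X + _]scale1r; apply: raised_lin; last exact: raised_e.
    rewrite (brC (gen_f X i)); case: rel => _ -> _ _; case: eqP => _; last by rewrite oppr0 br0l.
    by rewrite brNl -scaleN1r; apply/rZ/rh.
  - by rewrite brDr brZr; apply: raised_lin.
have rcomp z : raised x z -> forall b, ~~ (weight_ge0 b && (b != 0)) -> wcomp km z b = 0.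
  elim=> [b|i {}z rz IH b|k y {}z _ IHy _ IHz b] bP.
  - by rewrite (wcomp_weight km _ ax); case: eqP => // ba; rewrite ba a0 aN0 in bP.
  - rewrite (wcomp_bracket km _ _ (weightsp_e rel i)) IH ?br0r //.
    apply: contra bP => /andP[b0 bN0].
    rewrite -[b](subrK (d_ i)) weight_ge0D ?delta_ge0 //=.
    exact: weight_ge0D_neq0 (delta_ge0 i) bN0.
  - by rewrite wcomp_lin IHy // IHz // scaler0 addr0.
apply: (km_ideal km (J := [set z | raised x z]%classic)) (raised_base x).
- split=> //=; first by move=> k y z; apply: raised_lin.
  exact: (generated_stable km (@raised_lin x) rh (@raised_e x) rf).
- move=> s /rcomp/(_ 0); rewrite (wcomp_weight km _ (weightsp_h rel s)) !eqxx andbF.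
  exact.
Qed.

Lemma sl2_simple i :
  sl2_triple (gen_e X i) (gen_f X i) (gen_h X (tnth (simple_coroot h) i)).
Proof.
case: rel => _ r2 r3 r4; case: (km_gcm km) => Aii _ _.
by split; rewrite ?r2 ?r3 ?r4 ?eqxx // root_coroot Aii.
Qed.

Lemma weightsp_adn a b x v N : weightsp X a x -> weightsp X b v ->
  weightsp X (b + N%:Z *: a) (adn N x v).
Proof.
move=> ax bv; elim: N => [|N IH]; first by rewrite scale0r addr0.
rewrite adnS intS scalerDl scale1r addrCA; exact: weightsp_bracket.
Qed.

(** Each [f_l] kills this element, so [lowest_vector_eq0] applies. For [l = i] this is the vanishing
    of the coefficient in [sl2_raise_lower] at the exponent [1 - A i j]. *)
Lemma serre i j : i != j -> adn `|1 - A i j| (gen_e X i) (gen_e X j) = 0.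
Proof.
move=> ij; case: (km_gcm km) => Aii Aij0 Asym; have {}Aij0 := Aij0 _ _ ij.
set N := `|_|%N; have NE : N%:Z = 1 - A i j by rewrite /N; lia.
have wN : weightsp X (d_ j + N%:Z *: d_ i) (adn N (gen_e X i) (gen_e X j)).
  exact: weightsp_adn (weightsp_e rel i) (weightsp_e rel j).
apply: (lowest_vector_eq0 wN).
- apply: weight_ge0D; rewrite ?delta_ge0 //; apply/weight_ge0P => l.
  by rewrite !mxE; case: (_ && _); lia.
- by apply/eqP => /rowP/(_ j); rewrite !mxE !eqxx [j == i]eq_sym (negbTE ij); lia.
move=> l; have [-> |li] := eqVneq l i.
  have sl := sl2_sym (sl2_simple i).
  have zv : {[- gen_h X (tnth (simple_coroot h) i), gen_e X j]} = (- (A i j)%:~R) *: gen_e X j.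
    by rewrite brNl (weightsp_e rel) wt_delta root_coroot scaleNr.
  have fe : {[gen_f X i, gen_e X j]} = 0.
    by rewrite brC; case: rel => _ -> _ _; rewrite eq_sym (negbTE ij) oppr0.
  have -> : N = N.-1.+1 by rewrite prednK //; lia.
  rewrite (sl2_raise_lower _ sl zv) fe adn0r add0r.
  have -> : - (A i j)%:~R - N.-1%:R = 0 :> R[i].
    by rewrite -[N.-1%:R]/(N.-1%:Z%:~R) -mulrNz -mulrzBr (_ : - A i j - N.-1%:Z = 0) //; lia.
  by rewrite mulr0 scale0r.
have comm M v : {[gen_f X l, adn M (gen_e X i) v]} = adn M (gen_e X i) {[gen_f X l, v]}.
  elim: M => // M IH; rewrite !adnS br_jacobi IH (brC (gen_f X l)).
  by case: rel => _ -> _ _; rewrite eq_sym (negbTE li) oppr0 br0l add0r.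
rewrite comm brC; case: rel => _ -> _ _; case: (eqVneq j l) => [jl|_]; last first.
  by rewrite oppr0 adn0r.
have -> : N = N.-1.+1 by rewrite prednK //; lia.
rewrite adnSr brNr brC opprK (weightsp_e rel) wt_delta root_coroot.
(* What remains for [l = j] is [A j i] times a power of [ad e_i] on [e_i]: the scalar vanishes with
   [A i j], and otherwise the power is positive. *)
have [A0|AN0] := eqVneq (A i j) 0.
  by rewrite (Asym _ _ A0) scale0r adn0r.
have -> : N.-1 = N.-2.+1 by rewrite prednK //; lia.
by rewrite adnSr brZr bracketxx scaler0 adn0r.
Qed.

Lemma e_locally_nilpotent i x : exists N, adn N (gen_e X i) x = 0.
Proof.
elim/(km_gen km): x => [k x y [M xM] [N yN]|x y [M xM] [N yN]|s|j|j].
- exists (maxn M N); rewrite adnDr adnZr (adn_stop (leq_maxl M N) xM).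
  by rewrite (adn_stop (leq_maxr M N) yN) scaler0 addr0.
- by exists (M + N)%N; apply: adn_bracket.
- exists 2%N; rewrite adnS /adn /= (brC _ (gen_h X s)) (weightsp_e rel).
  by rewrite -scaleNr brZr bracketxx scaler0.
- have [->|ij] := eqVneq i j; first by exists 1%N; rewrite /adn /= bracketxx.
  by exists `|1 - A i j|%N; apply: serre.
- exists 3%N; rewrite /adn /=; case: rel => _ -> _ _; case: eqP => _.
    by rewrite (brC _ (gen_h _ _)) (weightsp_e rel) -scaleNr brZr bracketxx scaler0.
  by rewrite !br0r.
Qed.

End Integrability.

Section Roots.
Variables (R : realType) (n : nat) (A : 'M[int]_n) (h : realization R A).
Variables (L : lieType R[i]) (X : generators h L).
Hypothesis km : kac_moody_structure X.
Let rel := km_rel km.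
Implicit Types (a b : 'rV[int]_n) (s t : h) (i j : 'I_n).
Local Notation d_ i := (delta_mx (0 : 'I_1) (i : 'I_n) : 'rV[int]_n).

Lemma f_locally_nilpotent i x : exists N, adn N (gen_f X i) x = 0.
Proof. exact: (e_locally_nilpotent (opp_kac_moody km) i x). Qed.

Definition km_root a := a != 0 /\ exists2 x, x != 0 & weightsp X a x.

(** Stated for any sl2-triple in opposite weight spaces acting locally nilpotently: it is used for
    simple roots and for the components of the Chevalley generators of [m]. *)
Lemma root_reflection a x y s : weightsp X a x -> weightsp X (- a) y -> wt a s = 2 ->
  sl2_triple x y (gen_h X s) ->
  (forall b v, weightsp X b v -> exists N, adn N x v = 0) ->
  (forall b v, weightsp X b v -> exists N, adn N y v = 0) ->
  forall b, km_root b -> exists p : int, wt b s = p%:~R /\ km_root (b - p *: a).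
Proof.
move=> ax ay as2 sl xnil ynil b [bN0 [v vN0 bv]].
have [p ps] : exists p : int, wt b s = p%:~R.
  (* The last nonzero vector under [ad x] is a highest one; its weight is a natural number since [y]
     acts nilpotently on it. *)
  have [N Nmin] : exists N, adn N x v = 0 /\ forall M, adn M x v = 0 -> (N <= M)%N.
    have ex : exists N, `[< adn N x v = 0 >].
      by have [N xN] := xnil _ _ bv; exists N; apply/asboolP.
    exists (ex_minn ex); case: ex_minnP => N /asboolP xN Nmin; split=> // M xM.
    by apply: Nmin; apply/asboolP.
  case: N Nmin => [[v0]|N [xN Nmin]]; first by rewrite -[v]/(adn 0 x v) v0 eqxx in vN0.
  have bw := weightsp_adn N ax bv; set w := adn N x v in bw *.
  have wN0 : w != 0 by apply/eqP => /Nmin; rewrite ltnn.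
  have [M yM] := ynil _ _ bw.
  have [q qE] := sl2_highest_nat sl (bw s) wN0 xN yM.
  exists (q%:Z - 2 * N%:Z); move: qE; rewrite wtD wtZ as2 => /(canRL (addrK _)) ->.
  by rewrite rmorphB rmorphM /= mulrC.
exists p; split=> //; split.
  apply: contraNneq bN0 => /eqP; rewrite subr_eq0 => /eqP bpa.
  have : p%:~R = p%:~R * 2 :> R[i] by rewrite -{1}ps {1}bpa wtZ as2.
  rewrite mulr_natr mulr2n => /eqP; rewrite -[X in X == _]addr0 (inj_eq (addrI _)) eq_sym.
  by rewrite intr_eq0 bpa => /eqP ->; rewrite scale0r.
have zv := bv s; rewrite ps in zv.
(* By [sl2_lower_inj] the power of [ad y], or of [ad x] when [p] is negative, sends [v] to a nonzero
   vector of the reflected weight. *)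
case: p ps zv => p ps zv.
  exists (adn p y v); last first.
    by have := weightsp_adn p ay bv; rewrite scalerN.
  have [N xN] := xnil _ _ bv.
  by apply: contraNneq vN0 => yp; rewrite (sl2_lower_inj sl zv xN yp).
exists (adn p.+1 x v); last first.
  by rewrite NegzE scaleNr opprK; apply: weightsp_adn.
have [N yN] := ynil _ _ bv.
apply: contraNneq vN0 => xp; rewrite (sl2_lower_inj (p := p.+1) (sl2_sym sl) _ yN xp) //.
by rewrite brNl zv NegzE mulrNz scaleNr opprK.
Qed.

Definition simple_reflection i b := b - pairing A i b *: d_ i.

Lemma root_simple_reflection i b : km_root b -> km_root (simple_reflection i b).
Proof.
move=> rb; have Aii : A i i = 2 by case: (km_gcm km).
have [|p [pb]] := root_reflection (weightsp_e rel i) (weightsp_f rel i) _ (sl2_simple km i)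
    (fun _ v _ => e_locally_nilpotent km i v) (fun _ v _ => f_locally_nilpotent i v) rb.
  by rewrite wt_delta root_coroot Aii.
have -> // : p = pairing A i b.
by apply: (@intr_inj R[i]); rewrite -pb wt_coroot.
Qed.

Lemma root_sign a : km_root a -> weight_ge0 a \/ weight_ge0 (- a).
Proof. by move=> [_ [x x0 ax]]; apply/orP; apply: (weightsp_sign km ax). Qed.

Lemma gen_e_neq0 i : gen_e X i != 0.
Proof.
apply/eqP => e0; have [xy _ _] := sl2_simple km i.
move: xy; rewrite e0 br0l -(raddf0 (gen_h X)) => /(km_inj km) c0.
have := root_coroot h i i; rewrite -c0 raddf0.
by case: (km_gcm km) => -> _ _ /esym/eqP; rewrite intr_eq0.
Qed.

Lemma root_delta i : km_root (d_ i).
Proof.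
split; first exact: delta_neq0.
by exists (gen_e X i); [exact: gen_e_neq0 | exact: weightsp_e].
Qed.

Lemma root_multiple i (m : int) : km_root (m *: d_ i) -> m = 1 \/ m = -1.
Proof.
move=> [mN0 [x xN0 mx]].
have [m1|m1] := ltP 1 m; first by rewrite (weightsp_multiple km mx m1) eqxx in xN0.
have [m1'|m1'] := ltP m (-1).
  have mx' : weightsp (opp_generators X) (- m *: d_ i) x.
    by apply/weightsp_opp; rewrite scaleNr opprK.
  have mm : 1 < - m by lia.
  by rewrite (weightsp_multiple (opp_kac_moody km) mx' mm) eqxx in xN0.
have m0 : m != 0 by apply: contraNneq mN0 => ->; rewrite scale0r.
lia.
Qed.

End Roots.

Lemma root_opp (R : realType) (n : nat) (A : 'M[int]_n) (h : realization R A)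
    (L : lieType R[i]) (X : generators h L) a :
  km_root (opp_generators X) a <-> km_root X (- a).
Proof.
by rewrite /km_root oppr_eq0; split=> -[aN0 [x xN0 /weightsp_opp ax]]; split=> //; exists x.
Qed.

(** * The invariant form *)

Section InvariantForm.
Variables (K : numFieldType) (L : lieType K) (G : zmodType) (D : G -> L -> Prop).
Variable (b0 : L -> L -> K).
Hypothesis D_bracket : forall a b x y, D a x -> D b y -> D (a + b) {[x, y]}.
Hypothesis b0_linl : forall k x y z, b0 (k *: x + y) z = k * b0 x z + b0 y z.
Hypothesis b0_sym : forall x y, b0 x y = b0 y x.

(* With [p] the height of [x] and [lam] the pairing with [rho^vee], the invariance
   under [rho^vee] forces [p (x, y) = lam {[x, y]}]. *)
Definition graded_form (lam : L -> K) (p : int) x y :=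
  if p == 0 then b0 x y else lam {[x, y]} / p%:~R.

Definition linear_functional (lam : L -> K) :=
  forall k x y, lam (k *: x + y) = k * lam x + lam y.

(** The induction parameter [N] bounds the heights of all three arguments; the integer passed to
    [graded_form] is the height of its first one. *)
Definition invariant_upto (ht : G -> int) lam (N : nat) := forall a b c x y z,
  a + b + c = 0 -> D a x -> D b y -> D c z ->
  `|ht a| <= N%:Z -> `|ht b| <= N%:Z -> `|ht c| <= N%:Z ->
  graded_form lam (ht (a + b)) {[x, y]} z = graded_form lam (ht a) x {[y, z]}.

Definition commutator_spanned (ht : G -> int) := forall a x, 1 < ht a -> D a x ->
  exists (m : nat) (f g : 'I_m -> G) (u v : 'I_m -> L),
    x = \sum_k {[u k, v k]} /\
    forall k, [/\ f k + g k = a, D (f k) (u k), D (g k) (v k), 0 < ht (f k) & 0 < ht (g k)].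

Section Functional.
Variables (lam : L -> K) (ht : G -> int).
Hypothesis lamP : linear_functional lam.
Hypothesis htD : forall a b, ht (a + b) = ht a + ht b.
Local Notation B := (graded_form lam).

Let lam0 : lam 0 = 0.
Proof. by have := lamP (-1) 0 0; rewrite scaler0 addr0 mulN1r addNr. Qed.

Let lamD x y : lam (x + y) = lam x + lam y.
Proof. by have := lamP 1 x y; rewrite scale1r mul1r. Qed.

Let lamN x : lam (- x) = - lam x.
Proof. by have := lamP (-1) x 0; rewrite !addr0 scaleN1r mulN1r lam0 addr0. Qed.

Let b0D x y z : b0 (x + y) z = b0 x z + b0 y z.
Proof. by have := b0_linl 1 x y z; rewrite scale1r mul1r. Qed.

Let b00 z : b0 0 z = 0.
Proof. by have := b0_linl (-1) 0 0 z; rewrite scaler0 addr0 mulN1r addNr. Qed.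

Let b0N x z : b0 (- x) z = - b0 x z.
Proof. by have := b0_linl (-1) x 0 z; rewrite !addr0 scaleN1r mulN1r b00 addr0. Qed.

Lemma graded_formC p x y : B (- p) y x = B p x y.
Proof.
rewrite /graded_form oppr_eq0; case: eqP => _; first exact: b0_sym.
by rewrite mulrNz invrN mulrN -mulNr -lamN -brC.
Qed.

Lemma graded_formDl p x y z : B p (x + y) z = B p x z + B p y z.
Proof.
by rewrite /graded_form; case: eqP => _; [exact: b0D|rewrite brDl lamD mulrDl].
Qed.

Lemma graded_formNl p x z : B p (- x) z = - B p x z.
Proof.
by rewrite /graded_form; case: eqP => _; [exact: b0N|rewrite brNl lamN mulNr].
Qed.

Lemma graded_formDr p x y z : B p z (x + y) = B p z x + B p z y.
Proof. by rewrite -!(graded_formC p z) graded_formDl. Qed.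

Lemma graded_formNr p x z : B p z (- x) = - B p z x.
Proof. by rewrite -!(graded_formC p z) graded_formNl. Qed.

Lemma graded_form0r p z : B p z 0 = 0.
Proof. by apply: (addrI (B p z 0)); rewrite -graded_formDr !addr0. Qed.

Lemma graded_form_sumr p z I (r : seq I) (F : I -> L) :
  B p z (\sum_(i <- r) F i) = \sum_(i <- r) B p z (F i).
Proof.
by apply: (big_morph (B p z)) => [x y|]; rewrite ?graded_formDr ?graded_form0r.
Qed.

Let ht0 : ht 0 = 0.
Proof. by apply: (addrI (ht 0)); rewrite -htD !addr0. Qed.

Let htN a : ht (- a) = - ht a.
Proof. by apply: (addrI (ht a)); rewrite -htD !subrr ht0. Qed.

(* The value at top degree is forced by invariance in lower degrees. *)
Lemma graded_form_extend N a b f g s t u v : invariant_upto ht lam N ->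
  D a s -> D b t -> D f u -> D g v -> a + b + (f + g) = 0 ->
  0 < ht a -> 0 < ht b -> ht f < 0 -> ht g < 0 -> ht a + ht b = N.+1%:Z ->
  B (ht (a + b)) {[s, t]} {[u, v]} = B (ht a) s {[t, {[u, v]}]}.
Proof.
move=> inv Ds Dt Du Dv abfg a0 b00' f0 g0 abN.
have fgN : ht f + ht g = - N.+1%:Z.
  by have := congr1 ht abfg; rewrite !htD ht0; lia.
(* The Jacobi identity splits the left side into pieces that involve only heights at most [N], where
   invariance is available. *)
have key f' g' u' v' : D f' u' -> D g' v' -> a + b + (f' + g') = 0 ->
    ht f' < 0 -> ht g' < 0 -> ht f' + ht g' = - N.+1%:Z ->
    B (ht (a + b + f')) {[{[s, t]}, u']} v' = B (ht a) s {[t, {[u', v']}]}.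
  move=> Du' Dv' abfg' f0' g0' fgN'.
  have -> : {[{[s, t]}, u']} = {[{[s, u']}, t]} + {[s, {[t, u']}]}.
    by rewrite br_jacobil (brC t {[s, u']}) opprK addrC.
  rewrite graded_formDl.
  have na : `|ht a| <= N%:Z by lia.
  have nb : `|ht b| <= N%:Z by lia.
  have nf : `|ht f'| <= N%:Z by lia.
  have ng : `|ht g'| <= N%:Z by lia.
  have naf : `|ht (a + f')| <= N%:Z by rewrite htD; lia.
  have nbf : `|ht (b + f')| <= N%:Z by rewrite htD; lia.
  have nbg : `|ht (b + g')| <= N%:Z by rewrite htD; lia.
  have e1 : a + f' + b + g' = 0 by rewrite -abfg' addrA (addrAC a b).
  have e2 : a + f' + (b + g') = 0 by rewrite -e1 addrA.
  have e3 : a + (b + f') + g' = 0 by rewrite -abfg' !addrA.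
  have i1 := inv _ _ _ _ _ _ e1 (D_bracket Ds Du') Dt Dv' naf nb ng.
  have i2 := inv _ _ _ _ _ _ e2 Ds Du' (D_bracket Dt Dv') na nf nbg.
  have i3 := inv _ _ _ _ _ _ e3 Ds (D_bracket Dt Du') Dv' na nbf ng.
  rewrite {1}addrAC i1 i2 -addrA i3.
  by rewrite -graded_formDr (br_jacobi t) addrC.
(* The two orders of [u] and [v] evaluate both terms of the Jacobi expansion of [{[{[s, t]},
   {[u, v]}]}] under [lam]: they contribute [- ht g] and [- ht f] times the wanted value, in total
   [ht a + ht b] times, which is the denominator. *)
have k1 := key f g u v Du Dv abfg f0 g0 fgN.
have k2 := key g f v u Dv Du.
rewrite [g + f]addrC [ht g + ht f]addrC in k2; move/(_ abfg g0 f0 fgN): k2 => k2.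
rewrite (brC v u) !(brNr, graded_formNr) in k2.
move: k1 k2; set B1 := B (ht a) s _; rewrite /graded_form !htD.
have -> : ht a + ht b + ht f = - ht g by lia.
have -> : ht a + ht b + ht g = - ht f by lia.
rewrite !oppr_eq0 (negbTE (ltr0_neq0 f0)) (negbTE (ltr0_neq0 g0)) => k1 k2.
rewrite ifN; last by rewrite abN.
have gR : (ht g)%:~R != 0 :> K by rewrite intr_eq0 ltr0_neq0.
have fR : (ht f)%:~R != 0 :> K by rewrite intr_eq0 ltr0_neq0.
rewrite br_jacobi lamD (brC u) lamN.
move/(canRL (divfK _)): k1 => ->; last by rewrite mulrNz oppr_eq0.
move/(canRL (divfK _)): k2 => ->; last by rewrite mulrNz oppr_eq0.
have abR : (ht a + ht b)%:~R != 0 :> K by rewrite abN intr_eq0.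
rewrite mulNr opprK -mulrDr -intrD (_ : - ht g - ht f = ht a + ht b) ?mulfK //.
by lia.
Qed.

Lemma graded_form_top N a b s t z : invariant_upto ht lam N ->
  commutator_spanned (fun a => - ht a) ->
  D a s -> D b t -> D (- (a + b)) z -> 0 < ht a -> 0 < ht b ->
  ht a + ht b = N.+1%:Z ->
  B (ht (a + b)) {[s, t]} z = B (ht a) s {[t, z]}.
Proof.
move=> inv span Ds Dt Dz a0 b0' abN.
have [|m [f [g [u [v [-> H]]]]]] := span _ z _ Dz; first by rewrite !(htD, htN); lia.
rewrite br_sumr !graded_form_sumr; apply: eq_bigr => k _.
have [fg Du Dv f0 g0] := H k.
by apply: (graded_form_extend inv Ds Dt Du Dv) => //; rewrite ?fg ?subrr //; lia.
Qed.

End Functional.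

Section Invariance.
Variables (lam : L -> K) (ht : G -> int).
Hypothesis lamP : linear_functional lam.
Hypothesis htD : forall a b, ht (a + b) = ht a + ht b.
Hypothesis Dcomm : forall a b x y, ht a = 0 -> ht b = 0 -> D a x -> D b y -> {[x, y]} = 0.
Hypothesis span : commutator_spanned ht.
Hypothesis spanN : commutator_spanned (fun a => - ht a).
Hypothesis base : forall a b e x y z, a + b + e = 0 -> D a x -> D b y -> D e z ->
  ht a = 1 -> ht e = 0 -> b0 {[x, y]} z = lam {[x, {[y, z]}]}.
Local Notation B := (graded_form lam).

Let lamN x : lam (- x) = - lam x.
Proof.
have l0 : lam 0 = 0 by have := lamP (-1) 0 0; rewrite scaler0 addr0 mulN1r addNr.
by have := lamP (-1) x 0; rewrite !addr0 scaleN1r mulN1r l0 addr0.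
Qed.

Let lamNP : linear_functional (fun x => - lam x).
Proof. by move=> k x y; rewrite lamP opprD mulrN. Qed.

Let htND a b : - ht (a + b) = - ht a + - ht b.
Proof. by rewrite htD opprD. Qed.

Let ht0 : ht 0 = 0.
Proof. by apply: (addrI (ht 0)); rewrite -htD !addr0. Qed.

Let htN a : ht (- a) = - ht a.
Proof. by apply: (addrI (ht a)); rewrite -htD !subrr ht0. Qed.

Let formN p x y : graded_form (fun x => - lam x) (- p) x y = B p x y.
Proof.
by rewrite /graded_form oppr_eq0; case: eqP => // _; rewrite mulrNz invrN mulrNN.
Qed.

Let formC p x y : B (- p) y x = B p x y.
Proof. exact: graded_formC. Qed.

Let formNl p x z : B p (- x) z = - B p x z.
Proof. exact: graded_formNl. Qed.

Let formNr p x z : B p z (- x) = - B p z x.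
Proof. exact: graded_formNr. Qed.

Let form_top N a b s t z : invariant_upto ht lam N ->
  D a s -> D b t -> D (- (a + b)) z -> 0 < ht a * ht b ->
  `|ht a + ht b| = N.+1%:Z ->
  B (ht (a + b)) {[s, t]} z = B (ht a) s {[t, z]}.
Proof.
move=> inv Ds Dt Dz ab abN; have [a0|a0|a0] := ltgtP 0 (ht a).
- apply: (graded_form_top lamP htD inv spanN Ds Dt Dz) => //; last by nia.
  by rewrite pmulr_rgt0 in ab.
(* Both heights negative: changing the signs of [ht] and [lam] leaves the form unchanged. *)
- rewrite -!formN.
  apply: (graded_form_top lamNP htND (N := N) _ _ Ds Dt Dz); try nia.
    move=> p q r x y w pqr Dx Dy Dw p0 q0 r0; rewrite !formN.
    by apply: (inv p q r) => //; lia.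
  move=> p x; rewrite opprK => p1 Dx.
  have [m [f [g [u [v [-> H]]]]]] := span p1 Dx; exists m, f, g, u, v; split=> // k.
  by case: (H k) => *; rewrite !opprK.
- by rewrite -a0 mul0r ltxx in ab.
Qed.

(** The second term of the Jacobi identity is a bracket of two elements of height zero. *)
Let form_mid a e x y z : D a x -> D e y -> ht e = 0 -> D (- (a + e)) z -> ht a != 0 ->
  B (ht (a + e)) {[x, y]} z = B (ht a) x {[y, z]}.
Proof.
move=> Dx Dy e0 Dz a0; rewrite /graded_form htD e0 addr0 (negbTE a0); congr (lam _ / _).
rewrite br_jacobil (Dcomm e0 _ Dy (D_bracket Dx Dz)) ?subr0 //.
by rewrite htD htN htD e0 addr0 subrr.
Qed.

(** A top element [x] is a sum of commutators of lower height, and the pieces of the Jacobi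
    expansion of [{[{[s0, t0]}, y]}] fall under the induction hypothesis. Height one is the
    hypothesis [base]. *)
Let form_zero N a e x y z : invariant_upto ht lam N ->
  D a x -> D (- (a + e)) y -> D e z -> ht e = 0 -> ht a = N.+1%:Z ->
  b0 {[x, y]} z = B (ht a) x {[y, z]}.
Proof.
case: N => [|N] inv Dx Dy Dz e0 aN.
  rewrite (base _ Dx Dy Dz) ?aN //; first by rewrite /graded_form divr1.
  by rewrite opprD addrA subrr add0r addNr.
have [|m [f [g [u [v [-> H]]]]]] := span _ Dx; first by rewrite aN.
rewrite -[b0 _ _]/(B 0 _ _) -(formC 0) -(formC (ht a)) br_suml !graded_form_sumr //.
apply: eq_bigr => k _; rewrite !formC; move: (H k).
move: (f k) (g k) (u k) (v k) => p0 q0 s0 t0 [pq0 Ds0 Dt0 p0_gt0 q0_gt0].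
have eN : `|ht e| <= N.+1%:Z by rewrite e0.
have half p q s' t' : p + q = a -> D p s' -> D q t' -> 0 < ht p -> 0 < ht q ->
    B 0 {[s', {[t', y]}]} z =
    B (ht a) {[s', t']} {[y, z]} + B (ht a) {[s', {[t', z]}]} y.
  move=> pq Dp Dq p0' q0'.
  have pN : `|ht p| <= N.+1%:Z by have := htD p q; rewrite pq aN; lia.
  have qeN : `|ht (q - (a + e))| <= N.+1%:Z.
    by have := htD p q; rewrite pq aN !(htD, htN) e0; lia.
  have sum1 : p + (q - (a + e)) + e = 0 by rewrite addrA pq opprD addrA subrr add0r addNr.
  have i1 := inv _ _ _ _ _ _ sum1 Dp (D_bracket Dq Dy) Dz pN qeN eN.
  have h0 : ht (p + (q - (a + e))) = 0.
    by have := htD (p + (q - (a + e))) e; rewrite sum1 e0 ht0; lia.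
  rewrite h0 in i1; rewrite i1 br_jacobil (brC y {[t', z]}) opprK graded_formDr //.
  have Dyz : D (- (p + q)) {[y, z]}.
    have -> : - (p + q) = - (a + e) + e by rewrite pq opprD subrK.
    exact: D_bracket.
  have De : D (- (p + (q + e))) y by rewrite addrA pq.
  have pqht : ht p + ht q = N.+2%:Z by rewrite -htD pq.
  have pqe : ht (p + (q + e)) = ht a by rewrite addrA pq htD e0 addr0.
  have t1 := form_top inv Dp Dq Dyz (mulr_gt0 p0' q0') (congr1 _ pqht).
  have t2 := form_top inv Dp (D_bracket Dq Dz) De.
  rewrite pqe in t2; rewrite -t2 -?t1 ?pq // htD e0 addr0 ?mulr_gt0 //.
  by rewrite pqht.
have -> : {[{[s0, t0]}, y]} = {[s0, {[t0, y]}]} - {[t0, {[s0, y]}]}.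
  by rewrite br_jacobil.
rewrite graded_formDl // formNl (half p0 q0) // (half q0 p0) 1?addrC //.
(* The difference of the two halves contains the wanted value twice; the correction [{[{[s0, t0]},
   z]}] takes it away once, by [form_mid]. *)
have -> : B (ht a) {[s0, {[t0, z]}]} y = B (ht a) {[t0, {[s0, z]}]} y
    + B (ht a) {[{[s0, t0]}, z]} y.
  by rewrite -graded_formDl // br_jacobil addrC subrK.
rewrite (brC t0 s0) formNl opprD opprK.
have DT := D_bracket Ds0 Dt0; rewrite pq0 in DT.
have := form_mid DT Dz e0 Dy; rewrite htD e0 addr0 aN => -> //.
by rewrite (brC z) formNr; ring.
Qed.

(** If some height vanishes, [form_zero] or [form_mid] applies up to symmetry. Otherwise two of the
    three heights have the same sign, and the symmetry of the form reduces to [form_top] for that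
    pair. *)
Lemma graded_form_invariant N : invariant_upto ht lam N.
Proof.
elim: N => [|N IH] a b c x y z abc Dx Dy Dz aN bN cN.
  have a0 : ht a = 0 by lia.
  have b0' : ht b = 0 by lia.
  have c0 : ht c = 0 by lia.
  by rewrite (Dcomm a0 b0' Dx Dy) (Dcomm b0' c0 Dy Dz) -formC !graded_form0r.
have sum0 : ht a + ht b + ht c = 0 by rewrite -!htD abc.
have opp (p q r : G) : p + q + r = 0 -> r = - (p + q).
  by move=> pqr; apply/eqP; rewrite -addr_eq0 addrC pqr.
have cE := opp _ _ _ abc.
have bca : b + c + a = 0 by rewrite addrC addrA.
have cab : c + a + b = 0 by rewrite addrC addrCA addrC -addrA addrCA addrA.
have [small|big] := boolP [&& `|ht a| <= N%:Z, `|ht b| <= N%:Z & `|ht c| <= N%:Z].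
  by case/and3P: small; apply: IH.
have zero (p q r : G) u v w : p + q + r = 0 -> D p u -> D q v -> D r w -> ht r = 0 ->
    `|ht p| = N.+1%:Z -> b0 {[u, v]} w = B (ht p) u {[v, w]}.
  move=> pqr Du Dv Dw r0 pN.
  have pq : ht q = - ht p by have := htD (p + q) r; rewrite pqr ht0 htD; lia.
  have [p0|p0] := lerP 0 (ht p).
    apply: (form_zero IH Du _ Dw r0); last by rewrite -pN ger0_norm.
    by rewrite -(opp p r q) // addrAC.
  have mid := form_mid Dv Dw r0; rewrite -(opp q r p) in mid; last by rewrite addrC addrA.
  rewrite -(formC (ht p)) -pq brC -[b0 _ _]/(B 0 _ _) formNl.
  have := form_zero IH Dv _ Dw r0; rewrite -(opp q r p); last by rewrite addrC addrA.
  rewrite /graded_form eqxx => -> //; last by rewrite pq -pN ltr0_norm.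
  rewrite -[if _ then _ else _]/(B _ _ _) (brC u) formNr opprK -mid //; last by rewrite pq; lia.
  by rewrite htD r0 addr0.
have [c0|cN0] := eqVneq (ht c) 0.
  have -> : ht (a + b) = 0 by rewrite htD; lia.
  by rewrite -[LHS]/(b0 _ _) (zero a b c) //; lia.
have [a0|aN0] := eqVneq (ht a) 0.
  rewrite a0 -[RHS]formC oppr0 -[RHS]/(b0 _ _) (zero b c a) //; last by lia.
  have mid := form_mid Dy Dx a0; rewrite -(opp b a c) in mid; last by rewrite (addrC b).
  rewrite (brC x y) formNl (addrC a) mid //; last by lia.
  by rewrite (brC x) formNr opprK.
have [b0'|bN0] := eqVneq (ht b) 0.
  by apply: form_mid => //; rewrite -cE.
have [ab|ab] := ltrP 0 (ht a * ht b).
  by apply: (form_top IH) => //; [rewrite -cE | nia].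
have [bc|bc] := ltrP 0 (ht b * ht c).
  have Dx' : D (- (c + b)) x by rewrite -(opp c b a) // addrAC.
  have t := form_top IH Dz Dy Dx'; rewrite mulrC in t.
  rewrite -(formC (ht a)) -(formC (ht (a + b))).
  have -> : - ht (a + b) = ht c by rewrite htD; lia.
  have -> : - ht a = ht (c + b) by rewrite htD; lia.
  by rewrite (brC x y) (brC y z) formNr formNl t //; nia.
have Dy1 : D (- (c + a)) y by rewrite -(opp c a b).
have Dy2 : D (- (a + c)) y by rewrite (addrC a).
have t1 := form_top IH Dz Dx Dy1; have t2 := form_top IH Dx Dz Dy2.
rewrite -(formC (ht (a + b))).
have -> : - ht (a + b) = ht c by rewrite htD; lia.
rewrite (brC y) formNr -t1; try nia.
by rewrite -t2; try nia; rewrite (brC z) formNl addrC.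
Qed.

End Invariance.

End InvariantForm.

Section Height.
Variables (n : nat).
Implicit Types (a b : 'rV[int]_n) (i : 'I_n).
Local Notation d_ i := (delta_mx (0 : 'I_1) (i : 'I_n) : 'rV[int]_n).

Definition height a : int := \sum_i a 0 i.

Lemma heightD a b : height (a + b) = height a + height b.
Proof. by rewrite /height -big_split; apply: eq_bigr => i _; rewrite mxE. Qed.

Lemma heightZ (m : int) a : height (m *: a) = m * height a.
Proof. by rewrite /height mulr_sumr; apply: eq_bigr => i _; rewrite mxE. Qed.

Lemma heightN a : height (- a) = - height a.
Proof. by rewrite -scaleN1r heightZ mulN1r. Qed.

Lemma height0 : height 0 = 0.
Proof. by rewrite /height big1 // => i _; rewrite mxE. Qed.

Lemma height_delta i : height (d_ i) = 1.
Proof.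
rewrite /height (bigD1 i) //= mxE !eqxx big1 ?addr0 // => j ji.
by rewrite mxE (negbTE ji) andbF.
Qed.

Lemma height_ge0 a : weight_ge0 a -> 0 <= height a.
Proof. by move=> /weight_ge0P a0; apply: sumr_ge0. Qed.

Lemma le_height a i : weight_ge0 a -> a 0 i <= height a.
Proof. by move=> /weight_ge0P a0; rewrite /height (bigD1 i) //= lerDl sumr_ge0. Qed.

Lemma height_eq0 a : weight_ge0 a -> height a = 0 -> a = 0.
Proof.
move=> a0 ha; apply/rowP => i; rewrite [RHS]mxE; apply/eqP; rewrite eq_le.
by rewrite (weight_ge0P _ a0) -[X in _ <= X]ha le_height.
Qed.

Lemma weight_pick a : weight_ge0 a -> a != 0 -> exists i, 0 < a 0 i.
Proof.
move=> /weight_ge0P a0 aN0; apply: contrapT => H; case/eqP: aN0; apply/rowP => i.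
rewrite [RHS]mxE; apply/eqP; rewrite eq_le a0 andbT leNgt; apply/negP => ai; apply: H.
by exists i.
Qed.

Lemma weight_ge0_subdelta a i : weight_ge0 a -> 0 < a 0 i -> weight_ge0 (a - d_ i).
Proof.
move=> /weight_ge0P a0 ai; apply/weight_ge0P => j; rewrite !mxE eqxx.
have [->|_] := eqVneq j i; first by rewrite subr_ge0.
by rewrite subr0.
Qed.

Lemma height_eq1 a : weight_ge0 a -> height a = 1 -> exists i, a = d_ i.
Proof.
move=> a0 ha; have [|i ai] := weight_pick a0.
  by apply/eqP => a00; rewrite a00 height0 in ha.
exists i; apply/eqP; rewrite -subr_eq0; apply/eqP.
apply: height_eq0; first exact: weight_ge0_subdelta.
by rewrite heightD heightN height_delta ha.
Qed.

End Height.

Section Span.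
Variables (R : realType) (n : nat) (A : 'M[int]_n) (h : realization R A).
Variables (L : lieType R[i]) (X : generators h L).
Hypothesis km : kac_moody_structure X.
Let rel := km_rel km.
Implicit Types (a b : 'rV[int]_n) (i j : 'I_n).
Local Notation d_ i := (delta_mx (0 : 'I_1) (i : 'I_n) : 'rV[int]_n).

Lemma npos_span a x : npos (gen_e X) a x -> 1 < height a ->
  exists y : 'I_n -> L, (forall i, weightsp X (a - d_ i) (y i)) /\
    x = \sum_i {[gen_e X i, y i]}.
Proof.
elim=> [b|i|i b {}x ex _|b k {}x z _ IHx _ IHz] hb.
- exists (fun=> 0); split=> [i|]; first exact: weightsp0.
  by rewrite big1 // => i _; rewrite br0r.
- by rewrite height_delta in hb.
- exists (fun j => if j == i then x else 0); split=> [j|].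
    case: eqP => [->|_]; last exact: weightsp0.
    by rewrite addrC addKr; apply: npos_weightsp.
  by rewrite (bigD1 i) //= eqxx big1 ?addr0 // => j /negbTE ->; rewrite br0r.
- have [y [yb ->]] := IHx hb; have [w [wb ->]] := IHz hb.
  exists (fun i => k *: y i + w i); split=> [i|]; first exact: weightsp_lin.
  rewrite scaler_sumr -big_split; apply: eq_bigr => i _ /=.
  by rewrite brDr brZr.
Qed.

Lemma weightsp_span a x : weightsp X a x -> 1 < height a ->
  exists y : 'I_n -> L, (forall i, weightsp X (a - d_ i) (y i)) /\
    x = \sum_i {[gen_e X i, y i]}.
Proof.
move=> ax ha; have [->|xN0] := eqVneq x 0.
  exists (fun=> 0); split=> [i|]; first exact: weightsp0.
  by rewrite big1 // => i _; rewrite br0r.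
have aN0 : a != 0 by apply: contraTneq ha => ->; rewrite height0.
have /orP[a0|/height_ge0] := weightsp_sign km ax xN0; last by rewrite heightN; lia.
exact: npos_span (weightsp_npos km ax a0 aN0) ha.
Qed.

End Span.

Section KacMoodyForm.
Variables (R : realType) (n : nat) (A : 'M[int]_n) (h : realization R A).
Variables (L : lieType R[i]) (X : generators h L).
Hypothesis km : kac_moody_structure X.
Variable (d : 'I_n -> R[i]).
Hypotheses (d_neq0 : forall i, d i != 0)
  (d_sym : forall i j, d i * (A i j)%:~R = d j * (A j i)%:~R).
Let rel := km_rel km.
Implicit Types (a b : 'rV[int]_n) (s t : h) (i j : 'I_n).
Local Notation d_ i := (delta_mx (0 : 'I_1) (i : 'I_n) : 'rV[int]_n).

Definition coroot_comb (c : 'I_n -> R[i]) : h := \sum_i c i *: tnth (simple_coroot h) i.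

Lemma coroot_combD (c c' : 'I_n -> R[i]) k :
  coroot_comb (fun i => k * c i + c' i) = k *: coroot_comb c + coroot_comb c'.
Proof.
rewrite /coroot_comb scaler_sumr -big_split; apply: eq_bigr => i _ /=.
by rewrite scalerDl scalerA.
Qed.

Lemma coroot_comb0 : coroot_comb (fun=> 0) = 0.
Proof. by rewrite /coroot_comb big1 // => i _; rewrite scale0r. Qed.

Lemma coroot_comb1 i : coroot_comb (fun j => (j == i)%:R) = tnth (simple_coroot h) i.
Proof.
rewrite /coroot_comb (bigD1 i) //= eqxx scale1r big1 ?addr0 // => j /negbTE ->.
by rewrite scale0r.
Qed.

Lemma wt_coroot_comb a c : wt a (coroot_comb c) = \sum_i c i * (pairing A i a)%:~R.
Proof.
by rewrite /coroot_comb wt_sumr; apply: eq_bigr => i _; rewrite wt_coroot.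
Qed.

Let is_comb x := exists c, x = gen_h X (coroot_comb c).

Let is_comb_lin k x y : is_comb x -> is_comb y -> is_comb (k *: x + y).
Proof.
move=> [c ->] [c' ->]; exists (fun i => k * c i + c' i).
by rewrite coroot_combD linearP.
Qed.

Let is_comb0 : is_comb 0.
Proof. by exists (fun=> 0); rewrite coroot_comb0 raddf0. Qed.

Let is_comb_coroot i k : is_comb (k *: gen_h X (tnth (simple_coroot h) i)).
Proof.
rewrite -[_ *: _]addr0; apply: is_comb_lin is_comb0.
by exists (fun j => (j == i)%:R); rewrite coroot_comb1.
Qed.

Lemma weightsp_deltaN i y : weightsp X (- d_ i) y -> exists c, y = c *: gen_f X i.
Proof.
by move=> iy; apply: (weightsp_delta (opp_kac_moody km)); apply/weightsp_opp.
Qed.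

Let npos_comb a x : npos (gen_e X) a x -> forall y, weightsp X (- a) y -> is_comb {[x, y]}.
Proof.
have ef i y : weightsp X (- d_ i) y -> is_comb {[gen_e X i, y]}.
  move=> /weightsp_deltaN[c ->]; rewrite brZr; case: rel => _ -> _ _.
  by rewrite eqxx; apply: is_comb_coroot.
elim=> [b|i|i b {}x ex IH|b k {}x z _ IHx _ IHz] y ay.
- by rewrite br0l.
- exact: ef.
- rewrite br_jacobil addrC -scaleN1r; apply: is_comb_lin.
    apply: IH; have := weightsp_bracket (weightsp_e rel i) ay.
    by rewrite opprD addrA subrr add0r.
  apply: ef; have := weightsp_bracket (npos_weightsp rel ex) ay.
  by rewrite opprD addrCA subrr addr0.
- by rewrite brDl brZl; apply: is_comb_lin; [apply: IHx | apply: IHz].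
Qed.

(** This is why a form on the span of the simple coroots, where [A] and [d] determine it, is
    enough. *)
Lemma weightsp_bracket_comb a x y : a != 0 -> weightsp X a x -> weightsp X (- a) y ->
  exists c, {[x, y]} = gen_h X (coroot_comb c).
Proof.
move=> aN0 ax ay; have [x0|xN0] := eqVneq x 0; first by rewrite x0 br0l; apply: is_comb0.
have /orP[a0|a0] := weightsp_sign km ax xN0.
  exact: (npos_comb (weightsp_npos km ax a0 aN0) ay).
rewrite brC -scaleN1r -[_ *: _]addr0; apply: is_comb_lin is_comb0.
have aN0' : - a != 0 by rewrite oppr_eq0.
by apply: (npos_comb (weightsp_npos km ay a0 aN0')); rewrite opprK.
Qed.

Definition hpart x : h := projT1 (cid ((weightsp0P km _).1 (wcomp_weightsp km 0 x))).

Lemma hpartE x : gen_h X (hpart x) = wcomp km x 0.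
Proof. by rewrite /hpart; case: cid. Qed.

Lemma hpart_lin k x y : hpart (k *: x + y) = k *: hpart x + hpart y.
Proof. by apply: (km_inj km); rewrite linearP !hpartE wcomp_lin. Qed.

Lemma hpart_gen_h s : hpart (gen_h X s) = s.
Proof.
by apply: (km_inj km); rewrite hpartE (wcomp_weight km _ (weightsp_h rel s)) eqxx.
Qed.

Let cc x i : R[i] := coord (simple_coroot h) i (hpart x).

Let cc_lin k x y i : cc (k *: x + y) i = k * cc x i + cc y i.
Proof. by rewrite /cc hpart_lin linearP. Qed.

Let cc_comb c i : cc (gen_h X (coroot_comb c)) i = c i.
Proof.
rewrite /cc hpart_gen_h linear_sum (bigD1 i) //= linearZ /= (tnth_nth 0).
rewrite coord_free ?coroot_free // eqxx mulr1 big1 ?addr0 // => j ji.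
by rewrite linearZ /= (tnth_nth 0) coord_free ?coroot_free // (negbTE ji) mulr0.
Qed.

(** Scalar product with [rho^vee], on which every simple root takes the value one; [1 / d i] is also
    the product of [e_i] and [f_i]. *)
Let lam x : R[i] := \sum_i cc x i / d i.

Let b0 x y : R[i] := \sum_i \sum_j cc x i * cc y j * ((A i j)%:~R / d j).

Let lamP : linear_functional lam.
Proof.
move=> k x y; rewrite /lam mulr_sumr -big_split; apply: eq_bigr => i _ /=.
by rewrite cc_lin mulrDl mulrA.
Qed.

Let b0_linl k x y z : b0 (k *: x + y) z = k * b0 x z + b0 y z.
Proof.
rewrite /b0 mulr_sumr -big_split; apply: eq_bigr => i _ /=.
rewrite mulr_sumr -big_split; apply: eq_bigr => j _ /=.
by rewrite cc_lin !mulrDl !mulrA.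
Qed.

Let Ad_sym i j : (A i j)%:~R / d j = (A j i)%:~R / d i.
Proof.
apply: (canLR (mulfK (d_neq0 j))); rewrite mulrAC; apply: (canRL (mulfK (d_neq0 i))).
by rewrite mulrC d_sym mulrC.
Qed.

Let b0_sym x y : b0 x y = b0 y x.
Proof.
rewrite /b0 exchange_big; apply: eq_bigr => i _; apply: eq_bigr => j _ /=.
by rewrite [X in X * _]mulrC Ad_sym.
Qed.

(** In weight zero only combinations of simple coroots are kept, so the coordinates [cc] are
    evaluated only where they are meaningful. *)
Let D a x := weightsp X a x /\ (a = 0 -> is_comb x).

Let D_bracket a b x y : D a x -> D b y -> D (a + b) {[x, y]}.
Proof.
move=> [ax a0] [bY b0']; split; first exact: weightsp_bracket.
move=> ab; have bE : b = - a by apply/eqP; rewrite -addr_eq0 addrC ab.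
have [a00|aN0] := eqVneq a 0; last by apply: (weightsp_bracket_comb aN0 ax); rewrite -bE.
have [c ->] := a0 a00; have [|c' ->] := b0'; first by rewrite bE a00 oppr0.
by case: rel => -> _ _ _.
Qed.

Let D_height0 a x : D a x -> height a = 0 ->
  x = 0 \/ a = 0 /\ exists c, x = gen_h X (coroot_comb c).
Proof.
move=> [ax a0] ha; have [->|xN0] := eqVneq x 0; [by left | right].
suff aE : a = 0 by split=> //; apply: a0.
have /orP[|] := weightsp_sign km ax xN0 => ap; first exact: height_eq0.
by apply/eqP; rewrite -oppr_eq0; apply/eqP/height_eq0; rewrite ?heightN ?ha ?oppr0.
Qed.

Let D_comm a b x y : height a = 0 -> height b = 0 -> D a x -> D b y -> {[x, y]} = 0.
Proof.
move=> ha hb Dx Dy; have [->|[_ [c ->]]] := D_height0 Dx ha; first by rewrite br0l.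
have [->|[_ [c' ->]]] := D_height0 Dy hb; first by rewrite br0r.
by case: rel => -> _ _ _.
Qed.

Let D_span : commutator_spanned D (@height n).
Proof.
move=> a x ha [ax _]; have [y [yb ->]] := weightsp_span km ax ha.
exists n, (fun i => d_ i), (fun i => a - d_ i), (gen_e X), y; split=> // i.
rewrite addrC subrK height_delta heightD heightN height_delta; split=> //; last lia.
  by split; [exact: weightsp_e | move/eqP; rewrite (negbTE (delta_neq0 i))].
split=> // ai; have := congr1 (@height n) ai.
by rewrite heightD heightN height_delta height0; lia.
Qed.

Let D_spanN : commutator_spanned D (fun a => - height a).
Proof.
move=> a x ha [ax _]; have ax' : weightsp (opp_generators X) (- a) x.
  by apply/weightsp_opp; rewrite opprK.
have [|y [yb ->]] := weightsp_span (opp_kac_moody km) ax'; first by rewrite heightN.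
exists n, (fun i => - d_ i), (fun i => a + d_ i), (gen_f X), y; split=> // i.
rewrite addrC addrK heightN height_delta heightD height_delta; split=> //; last lia.
  split; first exact: weightsp_f.
  by move/eqP; rewrite oppr_eq0 (negbTE (delta_neq0 i)).
split=> [|ai].
  by have /weightsp_opp := yb i; rewrite opprB opprK addrC.
have := congr1 (@height n) ai.
by rewrite heightD height_delta height0; lia.
Qed.

Let D_base a b e x y z : a + b + e = 0 -> D a x -> D b y -> D e z ->
  height a = 1 -> height e = 0 -> b0 {[x, y]} z = lam {[x, {[y, z]}]}.
Proof.
have b00 u : b0 u 0 = 0.
  by rewrite b0_sym; have := b0_linl (-1) 0 0 u; rewrite scaler0 addr0 mulN1r addNr.
have l0 : lam 0 = 0 by have := lamP (-1) 0 0; rewrite scaler0 addr0 mulN1r addNr.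
move=> abe Dx Dy Dz ha he.
have [->|[e0 [c ->]]] := D_height0 Dz he; first by rewrite !br0r b00 l0.
have bE : b = - a by apply/eqP; rewrite -addr_eq0 addrC -abe e0 addr0.
case: Dx Dy => ax _ [bY _]; rewrite bE in bY.
have [->|xN0] := eqVneq x 0.
  by rewrite !br0l l0 b0_sym b00.
have aP : weight_ge0 a.
  by have /orP[//|/height_ge0] := weightsp_sign km ax xN0; rewrite heightN; lia.
have [i ai] := height_eq1 aP ha; rewrite ai in ax bY.
have [k ->] := weightsp_delta km ax; have [k' ->] := weightsp_deltaN bY.
have ef : {[gen_e X i, gen_f X i]} = gen_h X (coroot_comb (fun j => (j == i)%:R)).
  by case: rel => _ -> _ _; rewrite eqxx coroot_comb1.
have lamZ u w : lam (u *: w) = u * lam w.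
  by have := lamP u w 0; rewrite !addr0 l0 addr0.
have b0Z u w w' : b0 (u *: w) w' = u * b0 w w'.
  by have := b0_linl u w 0 w'; rewrite !addr0 (b0_sym 0) b00 addr0.
rewrite !(brZl, brZr) (brC (gen_f X i)) (weightsp_f rel) wtN scaleNr opprK.
rewrite !(brZl, brZr) ef !b0Z !lamZ; congr (_ * (_ * _)).
rewrite /b0 (bigD1 i) //= [X in _ + X]big1 ?addr0 => [|j /negbTE ji]; last first.
  by apply: big1 => l _; rewrite cc_comb /= ji !mul0r.
have -> : lam (gen_h X (coroot_comb (fun j => (j == i)%:R))) = (d i)^-1.
  rewrite /lam (bigD1 i) //= [X in _ + X]big1 ?addr0 => [|j /negbTE ji].
    by rewrite cc_comb /= eqxx mul1r.
  by rewrite cc_comb /= ji mul0r.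
rewrite wt_coroot_comb mulr_suml; apply: eq_bigr => j _.
by rewrite !cc_comb /= ?eqxx mul1r pairing_delta Ad_sym mulrA.
Qed.

(* The left-hand side is the standard form on coroots: modulo the centre,
   [g_a, g_{-a}] lies on the line dual to [a]. *)
Lemma root_bracket_form a x y : a != 0 -> weightsp X a x -> weightsp X (- a) y ->
  exists (c : 'I_n -> R[i]) (p : R[i]), {[x, y]} = gen_h X (coroot_comb c) /\
    forall t : 'I_n -> R[i],
      \sum_i \sum_j c i * t j * ((A i j)%:~R / d j) = p * wt a (coroot_comb t).
Proof.
have pos b u v : 0 < height b -> weightsp X b u -> weightsp X (- b) v ->
    exists (c : 'I_n -> R[i]) (p : R[i]), {[u, v]} = gen_h X (coroot_comb c) /\
    forall t : 'I_n -> R[i],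
      \sum_i \sum_j c i * t j * ((A i j)%:~R / d j) = p * wt b (coroot_comb t).
  move=> hb bu bv; have bN0 : b != 0 by apply: contraTneq hb => ->; rewrite height0.
  have [c cE] := weightsp_bracket_comb bN0 bu bv.
  (* The scalar is the invariant product of [u] and [v]. *)
  exists c, (lam {[u, v]} / (height b)%:~R); split=> // t.
  have Du : D b u by split=> // b00; rewrite b00 eqxx in bN0.
  have Dv : D (- b) v.
    by split=> // /eqP; rewrite oppr_eq0 (negbTE bN0).
  have Dt : D 0 (gen_h X (coroot_comb t)) by split; [exact: weightsp_h | exists t].
  have sum0 : b + - b + 0 = 0 :> 'rV[int]_n by rewrite subrr addr0.
  have := graded_form_invariant D_bracket b0_linl b0_sym lamP (@heightD n) D_comm D_span
    D_spanN D_base (N := `|height b|%N) sum0 Du Dv Dt.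
  rewrite heightN height0 normrN normr0 => H.
  have : graded_form b0 lam (height (b - b)) {[u, v]} (gen_h X (coroot_comb t))
      = graded_form b0 lam (height b) u {[v, gen_h X (coroot_comb t)]} by apply: H; lia.
  have lamZ k w : lam (k *: w) = k * lam w.
    have l0 : lam 0 = 0 by have := lamP (-1) 0 0; rewrite scaler0 addr0 mulN1r addNr.
    by have := lamP k w 0; rewrite !addr0 l0 addr0.
  rewrite subrr height0 /graded_form eqxx gt_eqF // (brC v) bv wtN scaleNr opprK.
  rewrite brZr lamZ => E.
  transitivity (b0 {[u, v]} (gen_h X (coroot_comb t))); last first.
    by rewrite E; ring.
  rewrite cE /b0.
  by apply: eq_bigr => i _; apply: eq_bigr => j _; rewrite !cc_comb.
move=> aN0 ax ay; have [ha|ha|ha] := ltgtP 0 (height a); first exact: pos.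
  have [||c [p [cE H]]] := pos (- a) y x _ ay; rewrite ?heightN ?opprK ?oppr_gt0 //.
  exists (fun i => - c i), p; split=> [|t].
    rewrite brC cE -raddfN; congr (gen_h X _).
    by rewrite /coroot_comb -sumrN; apply: eq_bigr => i _; rewrite scaleNr.
  rewrite -[RHS]opprK -mulrN -wtN -H -sumrN; apply: eq_bigr => i _.
  by rewrite -sumrN; apply: eq_bigr => j _; rewrite !mulNr.
have x0 : x = 0.
  have Dx : D a x by split=> // a0; rewrite a0 eqxx in aN0.
  by have [//|[a0 _]] := D_height0 Dx (esym ha); rewrite a0 eqxx in aN0.
exists (fun=> 0), 0; split=> [|t]; first by rewrite x0 br0l coroot_comb0 raddf0.
by rewrite mul0r big1 // => i _; rewrite big1 // => j _; rewrite !mul0r.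
Qed.

End KacMoodyForm.

(** * The form on the root lattice and the simple reflections *)

Section RootForm.
Variables (R : realType) (n : nat) (A : 'M[int]_n) (d : 'rV[R]_n).
Implicit Types (a b : 'rV[int]_n) (i j : 'I_n).
Local Notation d_ i := (delta_mx (0 : 'I_1) (i : 'I_n) : 'rV[int]_n).
Local Notation S := (symmetrized A d).

Definition realv a : 'rV[R]_n := map_mx intr a.

Lemma realvD a b : realv (a + b) = realv a + realv b.
Proof. exact: map_mxD. Qed.

Lemma realvZ (m : int) a : realv (m *: a) = m%:~R *: realv a.
Proof. exact: map_mxZ. Qed.

Definition ip a b : R := bform S (realv a) (realv b).

Lemma ip_deltar a i : ip a (d_ i) = (realv a *m S) 0 i.
Proof. by rewrite /ip /realv map_delta_mx bform_delta. Qed.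

Lemma ip_row a b : ip a b = \sum_i (realv a *m S) 0 i * (b 0 i)%:~R.
Proof. by rewrite /ip bform_row; apply: eq_bigr => i _; rewrite [realv b _ _]mxE. Qed.

Lemma ipDl a b c : ip (a + b) c = ip a c + ip b c.
Proof. by rewrite /ip realvD bformDl. Qed.

Lemma ipDr a b c : ip c (a + b) = ip c a + ip c b.
Proof. by rewrite /ip realvD bformDr. Qed.

Lemma ipZl (m : int) a c : ip (m *: a) c = m%:~R * ip a c.
Proof. by rewrite /ip realvZ bformZl. Qed.

Lemma ipZr (m : int) a c : ip c (m *: a) = m%:~R * ip c a.
Proof. by rewrite /ip realvZ bformZr. Qed.

Hypothesis S_sym : S^T = S.

Lemma ip_sym a b : ip a b = ip b a.
Proof. exact: bform_sym. Qed.

Lemma realv_mul a i : (realv a *m S) 0 i = d 0 i * (pairing A i a)%:~R.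
Proof.
rewrite -{1}[realv a]trmxK symmetrized_col //; congr (_ * _).
rewrite mxE /pairing rmorph_sum; apply: eq_bigr => j _ /=.
by rewrite !mxE intrM.
Qed.

Lemma ip_delta a i : ip a (d_ i) = d 0 i * (pairing A i a)%:~R.
Proof. by rewrite ip_deltar realv_mul. Qed.

Lemma ip_pairing a b : ip a b = \sum_i (b 0 i)%:~R * (d 0 i * (pairing A i a)%:~R).
Proof. by rewrite ip_row; apply: eq_bigr => i _; rewrite realv_mul mulrC. Qed.

Hypothesis A_gcm : gcm A.

Lemma ip_delta_delta i : ip (d_ i) (d_ i) = 2 * d 0 i.
Proof. by rewrite ip_delta pairing_delta; case: A_gcm => -> _ _; rewrite mulrC. Qed.

Lemma pairing_reflection i a : pairing A i (simple_reflection A i a) = - pairing A i a.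
Proof.
rewrite /simple_reflection -scaleNr pairingD pairingZ pairing_delta.
by case: A_gcm => -> _ _; lia.
Qed.

Lemma simple_reflectionK i : involutive (simple_reflection A i).
Proof.
move=> a; rewrite {1}/simple_reflection pairing_reflection scaleNr opprK.
by rewrite /simple_reflection subrK.
Qed.

Lemma simple_reflectionD i a b :
  simple_reflection A i (a + b) = simple_reflection A i a + simple_reflection A i b.
Proof. by rewrite /simple_reflection pairingD scalerDl opprD addrACA. Qed.

Lemma simple_reflectionZ i (m : int) a :
  simple_reflection A i (m *: a) = m *: simple_reflection A i a.
Proof. by rewrite /simple_reflection pairingZ scalerBr scalerA. Qed.

Lemma ip_reflection i a :
  ip (simple_reflection A i a) (simple_reflection A i a) = ip a a.
Proof.
rewrite /simple_reflection -scaleNr !(ipDl, ipDr, ipZl, ipZr) ip_delta_delta.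
rewrite (ip_sym (d_ i)) ip_delta mulrNz; ring.
Qed.

Lemma height_reflection i a :
  height (simple_reflection A i a) = height a - pairing A i a.
Proof. by rewrite /simple_reflection heightD heightN heightZ height_delta mulr1. Qed.

End RootForm.

(** * Roots and their norms *)

Section RootBounds.
Variables (R : realType) (n : nat) (A : 'M[int]_n) (h : realization R A).
Variables (L : lieType R[i]) (X : generators h L).
Hypothesis km : kac_moody_structure X.
Variable (d : 'rV[R]_n).
Local Notation S := (symmetrized A d).
Hypotheses (d_gt0 : forall i, 0 < d 0 i) (S_sym : S^T = S).
Let rel := km_rel km.
Implicit Types (a b : 'rV[int]_n) (i j : 'I_n).
Local Notation d_ i := (delta_mx (0 : 'I_1) (i : 'I_n) : 'rV[int]_n).
Local Notation s_ i a := (simple_reflection A i a).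

(** The reflection alters only coordinate [i]; if the sign changed, all other coordinates would
    vanish, and [root_multiple] would leave only [d_ i]. *)
Lemma root_reflection_ge0 i a : km_root X a -> weight_ge0 a -> a != d_ i ->
  weight_ge0 (s_ i a).
Proof.
move=> ra a0 ai; have [sa|sa] := root_sign km (root_simple_reflection km i ra); first by [].
have aE : a = a 0 i *: d_ i.
  apply/rowP => j; rewrite !mxE eqxx; have [->|ji] := eqVneq j i; first by rewrite mulr1.
  have := weight_ge0P _ sa j; have := weight_ge0P _ a0 j.
  rewrite /simple_reflection !mxE (negbTE ji) andbF !mulr0 subr0 => aj0 aj1.
  by apply/eqP; rewrite eq_le aj0 andbT -oppr_ge0.
have := ra; rewrite aE => /(root_multiple km)[ai1|ai1].
  by rewrite aE ai1 scale1r eqxx in ai.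
by have := weight_ge0P _ a0 i; rewrite ai1.
Qed.

(** A positive root that is neither simple nor antidominant pairs positively with some simple
    coroot; that reflection lowers its height and keeps it positive. *)
Lemma chamber_ind (P : 'rV[int]_n -> Prop) :
  (forall i, P (d_ i)) ->
  (forall a, km_root X a -> weight_ge0 a -> (forall i, pairing A i a <= 0) -> P a) ->
  (forall i a, km_root X a -> weight_ge0 a -> P (s_ i a) -> P a) ->
  forall a, km_root X a -> weight_ge0 a -> P a.
Proof.
move=> Pd Pch Ps a; have [m] := ubnP `|height a|%N.
elim: m a => // m IH a am ra a0.
have [ch|nch] := pselect (forall i, pairing A i a <= 0); first exact: Pch.
have [i pi] : exists i, 0 < pairing A i a.
  apply: contrapT => H; apply: nch => i; rewrite leNgt; apply/negP => pi.
  by apply: H; exists i.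
have [->|ai] := eqVneq a (d_ i); first exact: Pd.
have sa0 := root_reflection_ge0 ra a0 ai.
apply: (Ps i) => //; apply: IH => //; last exact: root_simple_reflection.
have := height_ge0 sa0; have := height_ge0 a0; rewrite height_reflection; lia.
Qed.

Lemma ip_chamber a b : (forall i, pairing A i a <= 0) -> weight_ge0 b -> ip A d a b <= 0.
Proof.
move=> ch /weight_ge0P b0; rewrite ip_pairing //; apply: sumr_le0 => i _.
apply: mulr_ge0_le0; first by rewrite ler0z.
by rewrite pmulr_rle0 // lerz0.
Qed.

(** Reflections preserve norms, antidominant roots have norm at most zero and simple ones [2 d_i];
    the sum is a common bound. *)
Lemma pos_root_norm_bound a : km_root X a -> weight_ge0 a -> ip A d a a <= \sum_i 2 * d 0 i.
Proof.
have C0 : 0 <= \sum_i 2 * d 0 i by apply: sumr_ge0 => i _; rewrite mulr_ge0 // ltW.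
apply: (chamber_ind (P := fun a => ip A d a a <= \sum_i 2 * d 0 i)) => [i|b rb b0 ch|i b rb b0].
- rewrite (ip_delta_delta S_sym (km_gcm km)) (bigD1 i) //= lerDl.
  by apply: sumr_ge0 => j _; rewrite mulr_ge0 // ltW.
- exact: le_trans (ip_chamber ch b0) C0.
- by rewrite (ip_reflection S_sym (km_gcm km)).
Qed.

End RootBounds.

Section RootExistence.
Variables (R : realType) (n : nat) (A : 'M[int]_n) (h : realization R A).
Variables (L : lieType R[i]) (X : generators h L).
Hypothesis km : kac_moody_structure X.
Variable (d : 'rV[R]_n).
Local Notation S := (symmetrized A d).
Hypotheses (A_indec : indecomposable A) (d_gt0 : forall i, 0 < d 0 i) (S_sym : S^T = S).
Let rel := km_rel km.
Implicit Types (a b : 'rV[int]_n) (i j : 'I_n).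
Local Notation d_ i := (delta_mx (0 : 'I_1) (i : 'I_n) : 'rV[int]_n).
Local Notation s_ i a := (simple_reflection A i a).

Lemma root_norm_bound a : km_root X a -> ip A d a a <= \sum_i 2 * d 0 i.
Proof.
move=> ra; have [a0|a0] := root_sign km ra; first exact: (pos_root_norm_bound km).
have -> : ip A d a a = ip A d (- a) (- a).
  by rewrite -scaleN1r ipZl ipZr !mulN1r opprK.
apply: (pos_root_norm_bound (opp_kac_moody km)) => //.
by apply/root_opp; rewrite opprK.
Qed.

Lemma weightsp_root a x : weightsp X a x -> a != 0 -> x != 0 -> km_root X a.
Proof. by move=> ax aN0 xN0; split=> //; exists x. Qed.

Lemma highest_pairing a x i : weightsp X a x -> x != 0 -> {[gen_e X i, x]} = 0 ->
  0 <= pairing A i a.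
Proof.
move=> ax xN0 ex; have [N fN] := f_locally_nilpotent km i x.
have [p pE] := sl2_highest_nat (sl2_simple km i) (ax _) xN0 ex fN.
by rewrite wt_coroot in pE; rewrite -(@ler0z R[i]) pE ler0n.
Qed.

(* Compare [b] with a root [a <= b] of maximal height. *)
Lemma root_of_negative b : (forall i, 0 < b 0 i) -> (forall i, pairing A i b < 0) -> km_root X b.
Proof.
move=> b0 bneg; have gcmA := km_gcm km.
have bge0 : weight_ge0 b by apply/weight_ge0P => i; rewrite ltW.
pose P (m : nat) := `[< exists a,
  [/\ km_root X a, weight_ge0 a, weight_ge0 (b - a) & height a = m%:Z] >].
have exP : exists m, P m.
  exists 1%N; apply/asboolP; pose i0 := Ordinal A_indec.1; exists (d_ i0).
  rewrite delta_ge0 height_delta; split=> //; first exact: root_delta.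
  exact: weight_ge0_subdelta.
have bndP m : P m -> (m <= `|height b|)%N.
  move=> /asboolP[a [_ a0 ba0 ha]]; have := height_ge0 ba0.
  by rewrite heightD heightN ha; lia.
case: (ex_maxnP exP bndP) => m /asboolP[g [rg g0 bg0 hg]] maxm.
have gb i : g 0 i <= b 0 i.
  by have := weight_ge0P _ bg0 i; rewrite !mxE subr_ge0.
have [gN0 [x xN0 gx]] := rg.
have pg i : g 0 i < b 0 i -> 0 <= pairing A i g.
  move=> gi; apply: (highest_pairing gx xN0); apply/eqP/negPn/negP => eN0.
  have gi0 : weight_ge0 (d_ i + g) by rewrite weight_ge0D ?delta_ge0.
  suff /maxm : P m.+1 by rewrite ltnn.
  apply/asboolP; exists (d_ i + g); split=> //.
  - apply: weightsp_root eN0; first exact: weightsp_bracket (weightsp_e rel i) gx.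
    by rewrite weight_ge0D_neq0 ?delta_ge0 ?delta_neq0.
  - by rewrite opprD addrCA addrC weight_ge0_subdelta // !mxE subr_gt0.
  - by rewrite heightD height_delta hg.
(* Where [g] vanishes it can still grow towards [b], so [pg] gives the sign condition of
   [nonneg_pos]. *)
have g_gt0 i : 0 < g 0 i.
  have zS := symmetrized_npos gcmA d_gt0.
  have irS := symmetrized_irr gcmA A_indec d_gt0.
  suff : 0 < realv R g 0 i by rewrite mxE ltr0z.
  apply: (nonneg_pos zS irS S_sym).
  - by apply: contraNneq gN0 => /rowP g00; apply/eqP/rowP => j; have := g00 j;
      rewrite !mxE => /eqP; rewrite intr_eq0 => /eqP.
  - by move=> j; rewrite mxE ler0z (weight_ge0P _ g0).
  - move=> j; rewrite mxE => /eqP; rewrite intr_eq0 => /eqP gj.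
    by rewrite realv_mul // pmulr_rge0 // ler0z pg // gj.
(* The product of [g] and [b - g] is nonnegative by [pg]. It is also negative: [b - g] pairs
   negatively with the coroots in its support, by [bneg] and [pg], and nonpositively with the
   others, off-diagonal entries being nonpositive. *)
have [->//|bgN0] := eqVneq b g; exfalso.
have wN0 : b - g != 0 by rewrite subr_eq0.
have [i wi] := weight_pick bg0 wN0.
have le0 : ip A d g (b - g) >= 0.
  rewrite ip_pairing //; apply: sumr_ge0 => j _.
  have [gj|gj] := ltP (g 0 j) (b 0 j); last first.
    have -> : (b - g) 0 j = 0 by apply/eqP; rewrite !mxE subr_eq0 eq_le gj gb.
    by rewrite mul0r.
  by rewrite mulr_ge0 ?ler0z ?(weight_ge0P _ bg0) // mulr_ge0 ?ler0z ?pg // ltW.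
move: le0; rewrite ip_sym // leNgt => /negP; apply.
rewrite ip_pairing //.
have term j : (g 0 j)%:~R * (d 0 j * (pairing A j (b - g))%:~R) <= 0 :> R.
  rewrite pmulr_rle0 ?ltr0z // pmulr_rle0 // lerz0.
  have [gj|gj] := ltP (g 0 j) (b 0 j).
    by rewrite -scaleN1r pairingD pairingZ; have := pg j gj; have := bneg j; lia.
  have wj : (b - g) 0 j = 0 by apply/eqP; rewrite !mxE subr_eq0 eq_le gj gb.
  rewrite /pairing; apply: sumr_le0 => l _.
  have [->|lj] := eqVneq l j; first by rewrite wj mulr0.
  rewrite mulr_le0_ge0 ?(weight_ge0P _ bg0) //.
  by case: gcmA => _ -> //; rewrite eq_sym.
rewrite (bigD1 i) //= ltr_nwDl ?sumr_le0 //.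
rewrite pmulr_rlt0 ?ltr0z // pmulr_rlt0 // ltrz0.
have gi : g 0 i < b 0 i by move: wi; rewrite !mxE subr_gt0.
by rewrite -scaleN1r pairingD pairingZ; have := pg i gi; have := bneg i; lia.
Qed.

End RootExistence.

(** * Positivity from a finite reflection-stable set *)

Section FiniteReflections.
Variables (R : realType) (V : zmodType) (f : V -> V -> R).
Hypotheses (fDl : forall a b c, f (a + b) c = f a c + f b c) (fC : forall a b, f a b = f b a).
Variables (Psi Phi : seq V).
Hypotheses (Psi_uniq : uniq Psi) (Phi_sub : {subset Phi <= Psi}).
Hypothesis Phi_pos : forall a, a \in Phi -> 0 < f a a.
Hypothesis Psi_stable : forall a b, a \in Phi -> b \in Psi ->
  exists p : int, p%:~R * f a a = 2 * f b a /\ b - a *~ p \in Psi.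

Let fZl (m : int) a c : f (a *~ m) c = m%:~R * f a c.
Proof.
have f0 : f 0 c = 0 by apply: (addrI (f 0 c)); rewrite -fDl !addr0.
have fn (q : nat) : f (a *+ q) c = q%:R * f a c.
  elim: q => [|q IH]; first by rewrite mulr0n f0 mul0r.
  by rewrite mulrS fDl IH -natr1 mulrDl mul1r addrC.
case: m => m; first by rewrite -pmulrn fn.
rewrite NegzE mulrNz -pmulrn mulrNz mulNr -fn; apply: (addrI (f (a *+ m.+1) c)).
by rewrite -fDl !subrr f0.
Qed.

Let kappa a b : R := \sum_(c <- Psi) f a c * f b c.

(* The trace form of [Psi] is proportional to [f] along each [a \in Phi]: both are
   invariant under the reflection in [a]. *)
Let kappaE a b : a \in Phi -> kappa a b * f a a = f a b * kappa a a.
Proof.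
move=> aPhi; have faa := Phi_pos aPhi.
pose p c := if pselect (c \in Psi) is left cP then projT1 (cid (Psi_stable aPhi cP)) else 0.
have pP c : c \in Psi -> (p c)%:~R * f a a = 2 * f c a /\ c - a *~ p c \in Psi.
  by move=> cP; rewrite /p; case: pselect => // cP'; case: cid.
pose s c := c - a *~ p c.
have fs c e : c \in Psi -> f a a * f (s c) e = f a a * f c e - 2 * f c a * f a e.
  move=> /pP[pc _]; rewrite /s -mulrNz fDl fZl mulrNz -pc; ring.
have s_a c : c \in Psi -> f (s c) a = - f c a.
  move=> cP; apply: (mulfI (lt0r_neq0 faa)); rewrite fs //; ring.
have s_inj : {in Psi &, injective s}.
  move=> c e cP eP ce; have pce : p c = p e.
    apply: (@intr_inj R); apply: (mulIf (lt0r_neq0 faa)).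
    rewrite (pP _ cP).1 (pP _ eP).1; congr (_ * _).
    by apply: oppr_inj; rewrite -!s_a // ce.
  by move: ce; rewrite /s pce => /addIr.
have s_perm : perm_eq [seq s c | c <- Psi] Psi.
  apply: uniq_perm => //; first by rewrite map_inj_in_uniq.
  apply: (uniq_min_size _ _ _).2 => //; last by rewrite size_map.
  - by rewrite map_inj_in_uniq.
  - by move=> _ /mapP[c cP ->]; apply: (pP _ cP).2.
have key : f a a * kappa a b = - (f a a * kappa a b) + 2 * (f a b * kappa a a).
  rewrite {1}/kappa -(perm_big _ s_perm) big_map /= /kappa !mulr_sumr -sumrN -big_split.
  rewrite big_seq [RHS]big_seq; apply: eq_bigr => c cP /=.
  rewrite (fC a (s c)) s_a // mulrA mulrAC (fC b (s c)) fs // (fC c b) (fC c a).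
  ring.
by rewrite mulrC; lra.
Qed.

(** The factor [r a] between [kappa] and [f] is the same for two nonorthogonal elements of [Phi].
    Dividing [y] by its square root turns the sum into a value of [kappa], that is, a sum of squares
    over [Psi]; the hypothesis makes the square at [a0] nonzero. *)
Lemma finite_reflections_pos (y : V -> R) :
  (exists2 a, a \in Phi & \sum_(b <- Phi) y b * f b a != 0) ->
  0 < \sum_(a <- Phi) \sum_(b <- Phi) y a * y b * f a b.
Proof.
move=> [a0 a0P vN0].
pose r a := kappa a a / f a a.
have r_gt0 a : a \in Phi -> 0 < r a.
  move=> aP; have faa := Phi_pos aP; rewrite divr_gt0 //.
  rewrite /kappa (bigD1_seq a) ?Phi_sub //= ltr_pwDl ?mulr_gt0 //.
  by apply: sumr_ge0 => c _; rewrite -expr2 sqr_ge0.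
have kr a b : a \in Phi -> kappa a b = r a * f a b.
  move=> aP; apply: (mulIf (lt0r_neq0 (Phi_pos aP))); rewrite kappaE //.
  by rewrite /r; field; rewrite lt0r_neq0 ?Phi_pos.
have r_eq a b : a \in Phi -> b \in Phi -> f a b != 0 -> r a = r b.
  move=> aP bP fab; apply: (mulIf fab); rewrite -kr // fC -kr //.
  by apply: eq_bigr => c _; rewrite mulrC.
pose z a := y a / Num.sqrt (r a).
have sq a : a \in Phi -> Num.sqrt (r a) != 0 by move=> aP; rewrite gt_eqF // sqrtr_gt0 r_gt0.
have -> : \sum_(a <- Phi) \sum_(b <- Phi) y a * y b * f a b =
          \sum_(c <- Psi) (\sum_(a <- Phi) z a * f a c) ^+ 2.
  transitivity (\sum_(a <- Phi) \sum_(b <- Phi) z a * z b * kappa a b).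
    rewrite big_seq [RHS]big_seq; apply: eq_bigr => a aP.
    rewrite big_seq [RHS]big_seq; apply: eq_bigr => b bP.
    rewrite kr //; have [->|fN0] := eqVneq (f a b) 0; first by rewrite !mulr0.
    have ra : Num.sqrt (r b) ^+ 2 = r b by rewrite sqr_sqrtr // ltW ?r_gt0.
    rewrite /z (r_eq a b) // -{3}ra.
    by field; rewrite sq.
  under eq_bigr => a _ do under eq_bigr => b _ do rewrite mulr_sumr.
  under eq_bigr => a _ do rewrite exchange_big /=.
  rewrite exchange_big /=; apply: eq_bigr => c _.
  rewrite expr2 mulr_suml; apply: eq_bigr => a _; rewrite mulr_sumr.
  by apply: eq_bigr => b _; ring.
rewrite (bigD1_seq a0) ?Phi_sub //= ltr_pwDl //; last first.
  by apply: sumr_ge0 => c _; apply: sqr_ge0.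
rewrite exprn_even_gt0 //=.
suff -> : \sum_(a <- Phi) z a * f a a0 = (\sum_(a <- Phi) y a * f a a0) / Num.sqrt (r a0).
  by rewrite mulf_neq0 // invr_neq0 // sq.
rewrite mulr_suml big_seq [RHS]big_seq; apply: eq_bigr => a aP.
have [->|fN0] := eqVneq (f a a0) 0; first by rewrite !mulr0 mul0r.
by rewrite /z (r_eq a a0) // mulrAC.
Qed.

End FiniteReflections.

Section ImaginaryCone.
Variables (R : realType) (n : nat) (A : 'M[int]_n) (d : 'rV[R]_n).
Implicit Types (a b : 'rV[int]_n) (i j : 'I_n).
Local Notation S := (symmetrized A d).
Hypotheses (A_gcm : gcm A) (A_indec : indecomposable A).
Hypotheses (d_gt0 : forall i, 0 < d 0 i) (S_sym : S^T = S).

Definition negative_weight b := (forall i, 0 < b 0 i) /\ (forall i, pairing A i b < 0).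

(** Move a large multiple [N *: u] of the vector of [perron_neg] to the next integers. This changes
    the [i]-th coordinate of its image under [S] by at most [C i], and [N] is chosen with
    [C i < N q i]. *)
Lemma negative_weight_exists : ~ psd S -> exists b, negative_weight b.
Proof.
move=> npsd.
have [u [u0 uS]] := perron_neg S_sym (symmetrized_npos A_gcm d_gt0)
  (symmetrized_irr A_gcm A_indec d_gt0) npsd.
pose C i := \sum_j `|S j i|.
pose q i : R := - (u *m S) 0 i.
pose N := (\sum_i Num.bound (C i / q i))%N.
have NC i : C i < N%:R * q i.
  rewrite -ltr_pdivrMr ?oppr_gt0 //; apply: (lt_le_trans (archi_boundP _)).
    by rewrite divr_ge0 ?sumr_ge0 // oppr_ge0 ltW.
  by rewrite ler_nat /N (bigD1 i) //= leq_addr.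
pose b : 'rV[int]_n := \row_i (Num.floor (N%:R * u 0 i) + 1).
have bE i : N%:R * u 0 i <= (b 0 i)%:~R <= N%:R * u 0 i + 1.
  have /andP[f1 f2] := floor_itv (N%:R * u 0 i).
  by rewrite mxE ltW //= intrD lerD2r.
have b_gt0 i : 0 < b 0 i.
  by rewrite mxE ltzD1 floor_ge0 mulr_ge0 // ltW.
exists b; split=> // i.
rewrite -(@ltrz0 R) -(pmulr_rlt0 _ (d_gt0 i)) -realv_mul //.
have -> : realv R b = N%:R *: u + (realv R b - N%:R *: u) by rewrite addrC subrK.
rewrite mulmxDl mxE -scalemxAl [X in X + _]mxE.
apply: (@le_lt_trans _ _ (N%:R * (u *m S) 0 i + C i)).
  rewrite lerD2l mxE; apply: ler_sum => j _.
  apply: le_trans (ler_norm _) _; rewrite normrM -[leRHS]mul1r ler_wpM2r //.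
  have /andP[f1 f2] := bE j.
  by rewrite !mxE ger0_norm ?subr_ge0 // ?lerBlDl //; move: f1 f2; rewrite !mxE.
by have := NC i; rewrite /q mulrN; lra.
Qed.

(** Makes each simple root a combination of negative weights. The factor [3] works because [b] has
    pairings at most [-1] and Cartan entries are at most [2]. *)
Lemma negative_weightD b i : negative_weight b ->
  exists m : nat, negative_weight (m%:Z *: b + delta_mx 0 i).
Proof.
move=> [b0 bn]; exists 3%N; split=> j.
  rewrite !mxE; have := b0 j; case: (_ && _) => /=; lia.
rewrite pairingD pairingZ pairing_delta; have := bn j.
case: A_gcm => Aii Aij _; have [<-|ij] := eqVneq j i; first by rewrite Aii; lia.
by have := Aij _ _ ij; lia.
Qed.

End ImaginaryCone.

(** * Root strings and highest roots *)

Section Strings.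
Variables (R : realType) (n : nat) (A : 'M[int]_n) (h : realization R A).
Variables (L : lieType R[i]) (X : generators h L).
Implicit Types (a b : 'rV[int]_n) (i j : 'I_n).
Local Notation d_ i := (delta_mx (0 : 'I_1) (i : 'I_n) : 'rV[int]_n).
Local Notation s_ i a := (simple_reflection A i a).

Definition finite_strings a :=
  forall b, exists B : nat, forall M : int, (B <= `|M|)%N -> ~ km_root X (b + M *: a).

Hypothesis km : kac_moody_structure X.

Lemma finite_strings_reflection i a : finite_strings a -> finite_strings (s_ i a).
Proof.
move=> fa b; have [B HB] := fa (s_ i b); exists B => M /HB H rM; apply: H.
have := root_simple_reflection km i rM; rewrite simple_reflectionD simple_reflectionZ.
by rewrite simple_reflectionK //; apply: km_gcm km.
Qed.

Variable (d : 'rV[R]_n).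
Local Notation S := (symmetrized A d).
Hypotheses (A_indec : indecomposable A) (d_gt0 : forall i, 0 < d 0 i) (S_sym : S^T = S).

(** Simple roots have positive norm and reflections preserve it. An antidominant root cannot have
    finite strings: adding its multiples to a negative weight gives negative weights, which are all
    roots. *)
Lemma pos_string_norm_gt0 a : ~ psd S -> km_root X a -> weight_ge0 a ->
  finite_strings a -> 0 < ip A d a a.
Proof.
move=> npsd ra a0; have gcmA := km_gcm km.
have [b [b0 bneg]] := negative_weight_exists gcmA A_indec d_gt0 S_sym npsd.
move: a ra a0; apply: (chamber_ind km) => [i _|a ra a0 ch fa|i a ra a0 IH fa].
- by rewrite ip_delta_delta // mulr_gt0.
- have [B /(_ B (leqnn _))[]] := fa b.
  apply: (root_of_negative km A_indec d_gt0 S_sym) => i.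
    by rewrite !mxE ltr_pwDl // mulr_ge0 // (weight_ge0P _ a0).
  by rewrite pairingD pairingZ ltr_nwDl // mulr_ge0_le0.
- by rewrite -(ip_reflection S_sym gcmA i); apply/IH/finite_strings_reflection.
Qed.

(** A vector [x] for a positive root of maximal height is killed by all [e_i]. If all pairings
    vanished, all [f_i] would kill it as well, against [lowest_vector_eq0]. *)
Lemma highest_root_exists (M : int) : (forall a, km_root X a -> height a <= M) ->
  exists a, [/\ km_root X a, weight_ge0 a, forall i, 0 <= pairing A i a &
               exists i, pairing A i a != 0].
Proof.
move=> bnd; have rel := km_rel km; pose i0 := Ordinal A_indec.1.
pose P (m : nat) := `[< exists a, [/\ km_root X a, weight_ge0 a & height a = m%:Z] >].
have exP : exists m, P m.
  exists 1%N; apply/asboolP; exists (d_ i0); rewrite delta_ge0 height_delta.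
  by split=> //; apply: root_delta.
have bndP m : P m -> (m <= `|M|)%N by move=> /asboolP[a [/bnd ha _ ma]]; lia.
case: (ex_maxnP exP bndP) => m /asboolP[a [ra a0 ha]] maxm.
have [aN0 [x xN0 ax]] := ra.
have ex0 i : {[gen_e X i, x]} = 0.
  apply/eqP/negPn/negP => eN0; suff /maxm : P m.+1 by rewrite ltnn.
  apply/asboolP; exists (d_ i + a); rewrite weight_ge0D ?delta_ge0 //.
  rewrite heightD height_delta ha; split=> //; apply: weightsp_root eN0.
    exact: weightsp_bracket (weightsp_e rel i) ax.
  by rewrite weight_ge0D_neq0 ?delta_ge0 ?delta_neq0.
exists a; split=> //; first by move=> i; apply: (highest_pairing km ax xN0 (ex0 i)).
apply: contrapT => H; case/eqP: xN0; apply: (lowest_vector_eq0 km ax a0 aN0) => i.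
have pi0 : pairing A i a = 0 by apply: contrapT => /eqP pi; apply: H; exists i.
(* Otherwise [f_i] applied to [x] is a highest vector of weight [-2] under a locally nilpotent
   action. *)
apply/eqP/negPn/negP => fN0.
have sl := sl2_simple km i.
have hx : {[gen_h X (tnth (simple_coroot h) i), x]} = 0.
  by rewrite ax wt_coroot pi0 scale0r.
have ef : {[gen_e X i, {[gen_f X i, x]}]} = 0.
  by case: sl => ef _ _; rewrite br_jacobi ef hx ex0 br0r addr0.
have [N fN] := f_locally_nilpotent km i {[gen_f X i, x]}.
have hf : {[gen_h X (tnth (simple_coroot h) i), {[gen_f X i, x]}]} = - 2 *: {[gen_f X i, x]}.
  by case: sl => _ _ hf; rewrite br_jacobi hf hx br0r addr0 brZl.
have [p /eqP] := sl2_highest_nat sl hf fN0 ef fN.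
by rewrite eqr_oppLR -subr_eq0 opprK -natrD pnatr_eq0.
Qed.

(** A highest root would pair to zero with the positive null vector, although every term is
    nonnegative and one is positive. *)
Lemma roots_unbounded (M : int) : psd S -> ~ pd S ->
  exists2 a, km_root X a & M < height a.
Proof.
move=> psdS npd; apply: contrapT => H; have gcmA := km_gcm km.
have bnd a : km_root X a -> height a <= M.
  by move=> ra; rewrite leNgt; apply/negP => ha; apply: H; exists a.
have [a [ra a0 pa [i pi]]] := highest_root_exists bnd.
have [v vN0 v0] := psd_npd_null psdS npd.
have [w0 wS] := psd_null_absv S_sym (symmetrized_npos gcmA d_gt0)
  (symmetrized_irr gcmA A_indec d_gt0) psdS vN0 v0.
have : bform S (absv v) (realv R a) = 0 by rewrite /bform wS mul0mx mxE.
rewrite bform_sym // bform_row => /eqP; rewrite psumr_eq0 => [/allP/(_ i)|j _].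
  rewrite mem_index_enum => /(_ isT) /=.
  by rewrite realv_mul // !mulf_eq0 intr_eq0 (negbTE pi) (gt_eqF (d_gt0 i)) gt_eqF.
rewrite realv_mul //; apply: mulr_ge0; last exact: ltW.
by apply: mulr_ge0; [exact: ltW | rewrite ler0z].
Qed.

End Strings.

Section StringNorm.
Variables (R : realType) (n : nat) (A : 'M[int]_n) (h : realization R A).
Variables (L : lieType R[i]) (X : generators h L).
Hypothesis km : kac_moody_structure X.
Variable (d : 'rV[R]_n).
Local Notation S := (symmetrized A d).
Hypotheses (A_indec : indecomposable A) (d_gt0 : forall i, 0 < d 0 i) (S_sym : S^T = S).

Lemma string_norm_gt0 a : ~ psd S -> km_root X a ->
  finite_strings X a -> 0 < ip A d a a.
Proof.
move=> npsd ra fa; have [a0|a0] := root_sign km ra; first exact: (pos_string_norm_gt0 km).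
have -> : ip A d a a = ip A d (- a) (- a).
  by rewrite -scaleN1r ipZl ipZr !mulN1r opprK.
apply: (pos_string_norm_gt0 (opp_kac_moody km)) => //.
  by apply/root_opp; rewrite opprK.
move=> b; have [B HB] := fa (- b); exists B => M /HB H /root_opp rM; apply: H.
by rewrite opprD scalerN opprK in rM.
Qed.

End StringNorm.

Section SimpleStrings.
Variables (R : realType) (n : nat) (A : 'M[int]_n) (h : realization R A).
Variables (L : lieType R[i]) (X : generators h L).
Hypothesis km : kac_moody_structure X.
Implicit Types (a b : 'rV[int]_n) (i j : 'I_n).
Local Notation d_ i := (delta_mx (0 : 'I_1) (i : 'I_n) : 'rV[int]_n).

(** For large [M] the [i]-th coordinates of a root [q] of the string and of its reflection have
    opposite signs, while the other coordinates agree; a nonzero one of these would make one of the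
    two roots of mixed sign. If there is none, [q] is a multiple of [d_ i]. *)
Lemma simple_strings_finite i b : exists B : nat, forall M : int, (B <= `|M|)%N ->
  b + M *: d_ i != 0 /\ ~ km_root X (b + M *: d_ i).
Proof.
pose u := b 0 i; pose w := pairing A i b.
exists (`|u| + `|w| + 2)%N => M MB; rewrite /u /w in MB; set q := b + M *: d_ i.
have qi : q 0 i = b 0 i + M by rewrite !mxE !eqxx mulr1.
split; first by apply/eqP => /rowP/(_ i); rewrite qi mxE; lia.
move=> rq; have Aii : A i i = 2 by case: (km_gcm km).
have rsq := root_simple_reflection km i rq.
have sqi : (simple_reflection A i q) 0 i = b 0 i - pairing A i b - M.
  rewrite /simple_reflection mxE [X in _ + X]mxE [X in - X]mxE [X in _ * X]mxE !eqxx qi mulr1.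
  by rewrite pairingD pairingZ pairing_delta Aii; lia.
have [[l li bl]|H] := pselect (exists2 l, l != i & b 0 l != 0).
  have ql : q 0 l = b 0 l by rewrite !mxE (negbTE li) andbF mulr0 addr0.
  have sql : (simple_reflection A i q) 0 l = b 0 l.
    by rewrite /simple_reflection mxE [X in _ + X]mxE [X in - X]mxE [X in _ * X]mxE
      (negbTE li) andbF mulr0 subr0.
  have [q0|q0] := root_sign km rq; have [s0|s0] := root_sign km rsq;
    have := weight_ge0P _ q0 i; have := weight_ge0P _ q0 l;
    have := weight_ge0P _ s0 i; have := weight_ge0P _ s0 l;
    rewrite ?[(- _ : 'rV__) _ _]mxE ?sqi ?sql ?qi ?ql; lia.
have qE : q = (b 0 i + M) *: d_ i.
  apply/rowP => l; rewrite [RHS]mxE [X in _ = _ * X]mxE eqxx.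
  have [->|li] := eqVneq l i; first by rewrite qi mulr1.
  rewrite mulr0 !mxE (negbTE li) andbF mulr0 addr0.
  by apply: contrapT => /eqP bl; apply: H; exists l.
by move: rq; rewrite qE => /(root_multiple km); lia.
Qed.

End SimpleStrings.

(** * Restriction to the grading subalgebra *)

Section Restriction.
Variables (R : realType) (n k : nat) (A : 'M[int]_n) (B : 'M[int]_k).
Variables (h : realization R A) (a : realization R B) (g m : lieType R[i]).
Variables (Xg : generators h g) (Xm : generators a m) (j : {linear m -> g}).
Hypotheses (kmg : kac_moody_structure Xg) (kmm : kac_moody_structure Xm).
Hypotheses (j_morph : lie_morphism j) (j_inj : injective j).
Hypothesis j_cartan : forall t : a, exists s : h, j (gen_h Xm t) = gen_h Xg s.
Let Sigma0 : set (dual a) := (root_system (gen_h Xm) `|` [set 0])%classic.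
Let V (c : dual a) := weight_space (j \o gen_h Xm) c.
Hypothesis j_graded : forall x : g, exists (r : seq (dual a)) (v : dual a -> g),
  (forall c, c \in r -> Sigma0 c /\ V c (v c)) /\ x = \sum_(c <- r) v c.
Hypothesis j_fd : forall c, Sigma0 c -> finite_dimensional (V c).
Let relg := km_rel kmg.
Let relm := km_rel kmm.
Implicit Types (b : 'rV[int]_n) (p : 'rV[int]_k).

Definition cartan_map (t : a) : h := projT1 (cid (j_cartan t)).

Lemma cartan_mapE t : j (gen_h Xm t) = gen_h Xg (cartan_map t).
Proof. by rewrite /cartan_map; case: cid. Qed.

Lemma cartan_map_lin (u : R[i]) t t' :
  cartan_map (u *: t + t') = u *: cartan_map t + cartan_map t'.
Proof. by apply: (km_inj kmg); rewrite -cartan_mapE !linearP -!cartan_mapE. Qed.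

Fact wt_restrict_linear b : linear (fun t => wt b (cartan_map t) : R[i]^o).
Proof. by move=> u t t'; rewrite cartan_map_lin wt_linear. Qed.

Definition restrict_dual b : dual a :=
  linfun (HB.pack (fun t => wt b (cartan_map t) : R[i]^o)
    (GRing.isLinear.Build _ _ _ _ _ (wt_restrict_linear b)) : {linear a -> R[i]^o}).

Lemma restrict_dualE b t : restrict_dual b t = wt b (cartan_map t).
Proof. by rewrite lfunE. Qed.

Fact wt_linear_fun p : linear (fun t : a => wt p t : R[i]^o).
Proof. by move=> u t t'; rewrite wt_linear. Qed.

Definition weight_dual p : dual a :=
  linfun (HB.pack (fun t : a => wt p t : R[i]^o)
    (GRing.isLinear.Build _ _ _ _ _ (wt_linear_fun p)) : {linear a -> R[i]^o}).

Lemma weight_dualE p t : weight_dual p t = wt p t.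
Proof. by rewrite lfunE. Qed.

(** If [c] were not in [r], the decomposition of [x] would be a relation between distinct weights;
    [w] gathers equal ones, as [r] may have repetitions. *)
Lemma graded_weight (c : dual a) x : x != 0 -> V c x -> Sigma0 c.
Proof.
move=> xN0 cx; have [r [v [rv xE]]] := j_graded x.
have [cr|cr] := boolP (c \in r); first by case: (rv c cr).
pose w (e : dual a) : g := if e == c then - x else \sum_(e' <- r | e' == e) v e'.
have : w c = 0.
  apply: (weights_independent (f := j \o gen_h Xm) (w := fun (e : dual a) t => e t)
    (r := c :: undup r)) (mem_head _ _).
  - by rewrite /= mem_undup cr undup_uniq.
  - move=> e e' _ _ ee'; apply: contrapT => H; case/eqP: ee'; apply/lfunP => t.
    by apply: contrapT => /eqP ?; apply: H; exists t.
  - move=> e er t; rewrite /w; case: eqP er => [->|ec]; first by rewrite brNr cx scalerN.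
    rewrite inE mem_undup => /predU1P[//|er].
    rewrite br_sumr scaler_sumr big_seq_cond [RHS]big_seq_cond.
    by apply: eq_bigr => e' /andP[e'r /eqP e'e]; rewrite -e'e (rv e' e'r).2.
  - rewrite big_cons /w eqxx.
    have -> : \sum_(e <- undup r) (if e == c then - x else \sum_(e' <- r | e' == e) v e') = x.
      rewrite [RHS]xE.
      have -> : \sum_(e <- r) v e = \sum_(e <- undup r) \sum_(e' <- r | e' == e) v e'.
        rewrite (exchange_big_dep xpredT) //= big_seq [RHS]big_seq.
        apply: eq_bigr => e er; rewrite -big_filter.
        have -> : [seq i <- undup r | e == i] = [:: e].
          rewrite (eq_filter (a2 := pred1 e)); last by move=> i; rewrite /= eq_sym.
          by rewrite filter_pred1_uniq ?undup_uniq ?mem_undup.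
        by rewrite big_seq1.
      rewrite big_seq [RHS]big_seq; apply: eq_bigr => e.
      by rewrite mem_undup => er; case: eqP => // ec; rewrite -ec er in cr.
    by rewrite addNr.
by rewrite /w eqxx => /eqP; rewrite oppr_eq0 (negbTE xN0).
Qed.

(** Passes from elements of the dual space to integer rows: any nonzero root component of the weight
    vector [y] has the same weight function. *)
Lemma dual_root (c : dual a) : Sigma0 c ->
  exists p, (forall t, wt p t = c t) /\ (p = 0 \/ km_root Xm p).
Proof.
case=> [[cN0 [y [yN0 cy]]]|->]; last first.
  by exists 0; split=> [t|]; [rewrite wt0 zero_lfunE | left].
have [p pN0] : exists p, wcomp kmm y p != 0.
  apply: contrapT => H; apply: yN0; have [r [_ _ _ ->]] := wcompP kmm y.
  by rewrite big1 // => p _; apply: contrapT => /eqP ?; apply: H; exists p.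
have pc t : wt p t = c t.
  have := wcomp_bracket kmm y p (weightsp_h relm t); rewrite subr0 cy wcompZ.
  rewrite (wcomp_weightsp kmm p y) => /eqP.
  by rewrite -subr_eq0 -scalerBl scaler_eq0 (negbTE pN0) orbF subr_eq0 => /eqP.
exists p; split=> //; right; split; last by exists (wcomp kmm y p) => //; apply: wcomp_weightsp.
by apply/eqP => p0; apply: cN0; apply/lfunP => t; rewrite -pc p0 wt0 zero_lfunE.
Qed.

Lemma weightsp_restrict b x : weightsp Xg b x -> V (restrict_dual b) x.
Proof. by move=> bx t; rewrite /= cartan_mapE bx restrict_dualE. Qed.

Lemma restrict_exists b : km_root Xg b ->
  exists p, (forall t, wt b (cartan_map t) = wt p t) /\ (p = 0 \/ km_root Xm p).
Proof.
move=> [_ [x xN0 /weightsp_restrict/(graded_weight xN0)/dual_root[p [pc pr]]]].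
by exists p; split=> // t; rewrite pc restrict_dualE.
Qed.

(* Row [i] expresses the restriction to [a] of the simple root [i] of [g] in the
   simple roots of [m]. *)
Definition restriction_mx : 'M[int]_(n, k) :=
  \matrix_(i, l) (projT1 (cid (restrict_exists (root_delta kmg i)))) 0 l.
Local Notation M := restriction_mx.

Lemma wt_restrict b t : wt b (cartan_map t) = wt (b *m M) t.
Proof.
have E i : wt (delta_mx 0 i) (cartan_map t) = wt (row i M) t.
  rewrite (_ : row i M = projT1 (cid (restrict_exists (root_delta kmg i)))).
    by case: cid => p [].
  by apply/rowP => l; rewrite !mxE.
rewrite {1}/wt; under eq_bigr => i _ do rewrite -wt_delta E /wt mulr_sumr.
rewrite exchange_big /=; apply: eq_bigr => l _.
rewrite [X in X%:~R]mxE rmorph_sum mulr_suml; apply: eq_bigr => i _ /=.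
by rewrite intrM mulrA !mxE.
Qed.

Lemma root_restrict b : km_root Xg b -> b *m M = 0 \/ km_root Xm (b *m M).
Proof.
move=> /restrict_exists[p [pE pr]]; suff -> : b *m M = p by [].
by apply: (@wt_inj _ _ _ a) => t; rewrite -wt_restrict pE.
Qed.

(** A root vector restricting to [p] is a combination of finitely many elements of [V_p], so its
    root occurs among the finitely many weights of their components. This is where finite
    dimensionality enters. *)
Lemma restrict_cover p : p = 0 \/ km_root Xm p ->
  exists r : seq 'rV[int]_n, forall b, km_root Xg b -> b *m M = p -> b \in r.
Proof.
move=> pr; have Sp : Sigma0 (weight_dual p).
  case: pr => [->|[pN0 [y yN0 py]]].
    by right; apply/lfunP => t; rewrite weight_dualE wt0 zero_lfunE.
  left; split.
    move=> p0; case/eqP: pN0; apply: (@wt_inj _ _ _ a) => t.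
    by rewrite -weight_dualE p0 zero_lfunE wt0.
  by exists y; split; [exact/eqP | move=> t; rewrite weight_dualE py].
have [e [f [_ span]]] := j_fd Sp.
pose r := flatten [seq projT1 (cid (wcompP kmg (f q))) | q <- enum 'I_e].
exists r => b [bN0 [x xN0 bx]] bp.
have [|cf xE] := span x; first by move=> t /=; rewrite cartan_mapE bx wt_restrict bp weight_dualE.
have : wcomp kmg x b != 0 by rewrite (wcomp_weight kmg b bx) eqxx.
rewrite xE wcomp_sum => sN0.
have [q qN0] : exists q, wcomp kmg (f q) b != 0.
  apply: contrapT => H; case/eqP: sN0; rewrite big1 // => q _; rewrite wcompZ.
  by apply: contrapT => /eqP qN0; apply: H; exists q; apply: contraNneq qN0 => ->; rewrite scaler0.
apply/flattenP; exists (projT1 (cid (wcompP kmg (f q)))).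
  by apply: map_f; rewrite mem_enum.
case: cid => rq [_ _ z _] /=; apply/negPn/negP => /z q0.
by rewrite q0 eqxx in qN0.
Qed.

End Restriction.

Lemma absz_shift (u : int) (N : nat) : (`|u| <= N)%N ->
  u = (`|(u + N%:Z)%R|%N)%:Z - N%:Z /\ (`|(u + N%:Z)%R| < (N + N).+1)%N.
Proof. by move=> uN; split; lia. Qed.

Section RealParts.
Variable R : realType.
Implicit Types (x y : R[i]) (r : R).
Local Notation rc := (real_complex R).

Lemma ReD x y : complex.Re (x + y) = complex.Re x + complex.Re y.
Proof. by case: x y => [? ?] [? ?]. Qed.

Lemma ImD x y : complex.Im (x + y) = complex.Im x + complex.Im y.
Proof. by case: x y => [? ?] [? ?]. Qed.

Lemma Re_sum I (s : seq I) (F : I -> R[i]) :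
  complex.Re (\sum_(i <- s) F i) = \sum_(i <- s) complex.Re (F i).
Proof. by apply: big_morph => // x y; apply: ReD. Qed.

Lemma Im_sum I (s : seq I) (F : I -> R[i]) :
  complex.Im (\sum_(i <- s) F i) = \sum_(i <- s) complex.Im (F i).
Proof. by apply: big_morph => // x y; apply: ImD. Qed.

Lemma ReMr x r : complex.Re (x * rc r) = complex.Re x * r.
Proof. by case: x => u v /=; rewrite mulr0 subr0. Qed.

Lemma ImMr x r : complex.Im (x * rc r) = complex.Im x * r.
Proof. by case: x => u v /=; rewrite mulr0 add0r. Qed.

Lemma intr_real_complex (z : int) : z%:~R = rc z%:~R.
Proof. by rewrite rmorph_int. Qed.

Lemma complex_eqP x y : complex.Re x = complex.Re y -> complex.Im x = complex.Im y -> x = y.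
Proof. by case: x y => [? ?] [? ?] /= -> ->. Qed.

End RealParts.

(** * The coroots of the grading subalgebra inside [g] *)

Section CorootDecomposition.
Variables (R : realType) (n k : nat) (A : 'M[int]_n) (B : 'M[int]_k).
Variables (h : realization R A) (a : realization R B) (g m : lieType R[i]).
Variables (Xg : generators h g) (Xm : generators a m) (j : {linear m -> g}).
Hypotheses (kmg : kac_moody_structure Xg) (kmm : kac_moody_structure Xm).
Hypotheses (j_morph : lie_morphism j) (j_inj : injective j).
Variables (sigma : a -> h) (M : 'M[int]_(n, k)).
Hypothesis sigmaE : forall t, j (gen_h Xm t) = gen_h Xg (sigma t).
Hypothesis wt_sigma : forall b t, wt b (sigma t) = wt (b *m M) t.
Variable d : 'rV[R]_n.
Local Notation S := (symmetrized A d).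
Hypotheses (d_gt0 : forall i, 0 < d 0 i) (S_sym : S^T = S).
Let relg := km_rel kmg.
Let relm := km_rel kmm.
Implicit Types (b : 'rV[int]_n) (p : 'rV[int]_k) (l : 'I_k).
Local Notation d_ i := (delta_mx (0 : 'I_1) i : 'rV[int]_ _).
Local Notation rc := (real_complex R).
Local Notation H l := (tnth (simple_coroot a) l).

Lemma wcomp_restrict p y b : weightsp Xm p y -> wcomp kmg (j y) b != 0 -> b *m M = p.
Proof.
move=> py bN0; apply: (@wt_inj _ _ _ a) => t.
have := wcomp_bracket kmg (j y) b (weightsp_h relg (sigma t)); rewrite subr0.
rewrite -sigmaE -j_morph py linearZ wcompZ sigmaE (wcomp_weightsp kmg b (j y)) => /eqP.
by rewrite -subr_eq0 -scalerBl scaler_eq0 (negbTE bN0) orbF subr_eq0 wt_sigma => /eqP ->.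
Qed.

(* [x b] and [y b] are the components of [e_l] and [f_l] in the root spaces of [b] and
   [-b]; [q b] is their scalar product. *)
Record coroot_data l (r : seq 'rV[int]_n) (x y : 'rV[int]_n -> g)
    (c : 'rV[int]_n -> 'I_n -> R[i]) (q : 'rV[int]_n -> R[i]) : Prop := CorootData {
  cd_uniq : uniq r;
  cd_nil : r != [::];
  cd_x : forall b, b \in r -> weightsp Xg b (x b) /\ x b != 0;
  cd_y : forall b, b \in r -> weightsp Xg (- b) (y b);
  cd_restrict : forall b, b \in r -> b *m M = d_ l;
  cd_bracket : forall b, b \in r -> {[x b, y b]} = gen_h Xg (coroot_comb h (c b));
  cd_form : forall b, b \in r -> forall t : 'I_n -> R[i],
    \sum_i \sum_i' c b i * t i' * ((A i i')%:~R / rc (d 0 i')) = q b * wt b (coroot_comb h t);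
  cd_sum : sigma (H l) = coroot_comb h (fun i => \sum_(b <- r) c b i) }.

Lemma coroot_data_exists l : exists r x y c q, coroot_data l r x y c q.
Proof.
have dC_neq0 i : rc (d 0 i) != 0 by rewrite fmorph_eq0 gt_eqF.
have dC_sym i i' : rc (d 0 i) * (A i i')%:~R = rc (d 0 i') * (A i' i)%:~R.
  rewrite !intr_real_complex -!rmorphM; congr (rc _).
  by rewrite -!symmetrizedE -[in LHS]S_sym mxE.
pose E := j (gen_e Xm l); pose F := j (gen_f Xm l).
have [r0 [u0 _ z0 sumE]] := wcompP kmg E.
pose r := [seq b <- r0 | wcomp kmg E b != 0].
have rP b : b \in r -> wcomp kmg E b != 0 by rewrite mem_filter => /andP[].
have rM b : b \in r -> b *m M = d_ l.
  by move/rP; apply: wcomp_restrict; apply: weightsp_e.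
have rN0 b : b \in r -> b != 0.
  by move=> /rM; apply: contra_eqN => /eqP ->; rewrite mul0mx eq_sym delta_neq0.
have sumE' : E = \sum_(b <- r) wcomp kmg E b.
  rewrite big_filter [LHS]sumE [RHS]big_mkcond; apply: eq_bigr => b _.
  by case: eqP.
have ch b : exists cq : ('I_n -> R[i]) * R[i], b \in r ->
    {[wcomp kmg E b, wcomp kmg F (- b)]} = gen_h Xg (coroot_comb h cq.1) /\
    forall t : 'I_n -> R[i],
    \sum_i \sum_i' cq.1 i * t i' * ((A i i')%:~R / rc (d 0 i')) = cq.2 * wt b (coroot_comb h t).
  have [br|] := boolP (b \in r); last by exists (fun=> 0, 0).
  have [c [q [cE cq]]] := root_bracket_form kmg dC_neq0 dC_sym (rN0 b br)
    (wcomp_weightsp kmg b E) (wcomp_weightsp kmg (- b) F).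
  by exists (c, q).
have [cq cqP] := choice ch.
exists r, (wcomp kmg E), (fun b => wcomp kmg F (- b)), (fun b => (cq b).1), (fun b => (cq b).2).
split.
- by rewrite filter_uniq.
- apply/eqP => r_nil; move: sumE'; rewrite r_nil big_nil -(raddf0 j) => /j_inj/eqP.
  by rewrite (negbTE (gen_e_neq0 kmm l)).
- by move=> b /rP; split=> //; apply: wcomp_weightsp.
- by move=> b _; apply: wcomp_weightsp.
- exact: rM.
- by move=> b /cqP[].
- by move=> b /cqP[].
apply: (km_inj kmg); rewrite -sigmaE.
have -> : gen_h Xm (H l) = {[gen_e Xm l, gen_f Xm l]}.
  by case: relm => _ -> _ _; rewrite eqxx.
have -> : coroot_comb h (fun i => \sum_(b <- r) (cq b).1 i) =
    \sum_(b <- r) coroot_comb h (cq b).1.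
  rewrite /coroot_comb exchange_big /=; apply: eq_bigr => i _.
  by rewrite scaler_suml.
rewrite raddf_sum /= j_morph -/E -/F.
(* The bracket has weight zero, so only pairs of components in opposite weights contribute. *)
have -> : {[E, F]} = wcomp kmg {[E, F]} 0.
  rewrite (wcomp_weight kmg (a := 0)) ?eqxx //.
  rewrite -j_morph; case: relm => _ -> _ _; rewrite eqxx sigmaE; exact: weightsp_h.
rewrite {1}sumE' br_suml wcomp_sum big_seq [RHS]big_seq; apply: eq_bigr => b br.
by rewrite (wcomp_bracket kmg _ _ (wcomp_weightsp kmg b E)) sub0r (cqP b br).1.
Qed.

Lemma coroot_form l r x y c q (t : 'I_n -> R[i]) : coroot_data l r x y c q ->
  \sum_i \sum_i' (\sum_(b <- r) c b i) * t i' * ((A i i')%:~R / rc (d 0 i')) =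
  \sum_(b <- r) q b * wt b (coroot_comb h t).
Proof.
move=> cd.
transitivity (\sum_(b <- r) \sum_i \sum_i' c b i * t i' * ((A i i')%:~R / rc (d 0 i'))).
  rewrite [RHS]exchange_big; apply: eq_bigr => i _; rewrite [RHS]exchange_big.
  by apply: eq_bigr => i' _; rewrite !mulr_suml.
by rewrite big_seq [RHS]big_seq; apply: eq_bigr => b br; apply: (cd_form cd).
Qed.

Lemma coroot_component_wt l r x y c q b' b : coroot_data l r x y c q -> b' \in r ->
  wt b (coroot_comb h (c b')) = q b' * rc (ip A d b' b).
Proof.
(* The coroot combination with coordinates [t] is the dual of [b] under the form. *)
move=> cd b'r; pose t i := rc (d 0 i) * (b 0 i)%:~R.
transitivity (q b' * wt b' (coroot_comb h t)); last first.
  congr (_ * _); rewrite wt_coroot_comb ip_pairing //.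
  rewrite rmorph_sum; apply: eq_bigr => i _ /=.
  by rewrite /t !rmorphM !intr_real_complex mulrA [in RHS](mulrC (rc _%:~R)).
rewrite -(cd_form cd b'r) wt_coroot_comb; apply: eq_bigr => i _.
rewrite /pairing rmorph_sum mulr_sumr; apply: eq_bigr => i' _ /=.
rewrite /t intrM.
have dN0 : rc (d 0 i') != 0 by rewrite fmorph_eq0 gt_eqF.
by field.
Qed.

Lemma coroot_wt_form l r x y c q b : coroot_data l r x y c q ->
  wt b (sigma (H l)) = \sum_(b' <- r) q b' * rc (ip A d b' b).
Proof.
move=> cd; rewrite (cd_sum cd) wt_coroot_comb.
under eq_bigr => i _ do rewrite mulr_suml.
rewrite exchange_big /= big_seq [RHS]big_seq; apply: eq_bigr => b' b'r.
by rewrite -(coroot_component_wt b cd b'r) wt_coroot_comb.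
Qed.

Lemma coroot_gram l l' r x y c q r' x' y' c' q' :
  coroot_data l r x y c q -> coroot_data l' r' x' y' c' q' ->
  \sum_i \sum_i' (\sum_(b <- r) c b i) * (\sum_(b <- r') c' b i') *
     ((A i i')%:~R / rc (d 0 i')) = (\sum_(b <- r) q b) * (B l' l)%:~R.
Proof.
move=> cd cd'; rewrite (coroot_form (fun i' => \sum_(b <- r') c' b i') cd) mulr_suml.
rewrite -(cd_sum cd') big_seq [RHS]big_seq; apply: eq_bigr => b br.
by rewrite wt_sigma (cd_restrict cd br) wt_coroot pairing_delta.
Qed.

(* Roots take integral values on the coroots of [m], so passing to real parts changes
   these by elements which are killed by all roots, that is, by central ones. *)
Definition real_coords (r : seq 'rV[int]_n) (c : 'rV[int]_n -> 'I_n -> R[i]) : 'rV[R]_n :=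
  \row_i (complex.Re (\sum_(b <- r) c b i) / d 0 i).

Lemma coroot_restrict l b : wt b (sigma (H l)) = (pairing B l (b *m M))%:~R.
Proof. by rewrite wt_sigma wt_coroot. Qed.

Lemma coroot_delta l r x y c q i : coroot_data l r x y c q ->
  \sum_i' (\sum_(b <- r) c b i') * rc (A i' i)%:~R = rc (pairing B l (d_ i *m M))%:~R.
Proof.
move=> cd; rewrite -intr_real_complex -coroot_restrict (cd_sum cd) wt_coroot_comb.
by apply: eq_bigr => i' _; rewrite pairing_delta intr_real_complex.
Qed.

(** Dividing by [d] converts coordinates in the coroots into coordinates in the simple roots, for
    which [S] is the Gram matrix. *)
Lemma real_coords_mul l r x y c q : coroot_data l r x y c q ->
  real_coords r c *m S = \row_i (pairing B l (d_ i *m M))%:~R.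
Proof.
move=> cd; apply/rowP => i; rewrite !mxE.
have /(congr1 (@complex.Re R)) := coroot_delta i cd; rewrite Re_sum /= => <-.
apply: eq_bigr => i' _; rewrite symmetrizedE mxE ReMr.
by field; rewrite gt_eqF.
Qed.

Lemma imag_coords_mul l r x y c q i : coroot_data l r x y c q ->
  \sum_i' complex.Im (\sum_(b <- r) c b i') * (A i' i)%:~R = 0 :> R.
Proof.
move=> cd; have /(congr1 (@complex.Im R)) := coroot_delta i cd; rewrite Im_sum /= => E.
by rewrite -[RHS]E; apply: eq_bigr => i' _; rewrite ImMr.
Qed.

(** One factor enters only through its integral pairings with the simple roots ([coroot_delta]), so
    real parts need be taken in the other factor alone. *)
Lemma real_coords_gram l l' r x y c q r' x' y' c' q' :
  coroot_data l r x y c q -> coroot_data l' r' x' y' c' q' ->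
  bform S (real_coords r c) (real_coords r' c') =
  complex.Re (\sum_(b <- r) q b) * (B l' l)%:~R.
Proof.
move=> cd cd'; have := coroot_gram cd cd'; rewrite intr_real_complex.
move/(congr1 (@complex.Re R)); rewrite ReMr => <-.
rewrite bform_row (real_coords_mul cd) exchange_big Re_sum; apply: eq_bigr => i' _.
have -> : \sum_i (\sum_(b <- r) c b i) * (\sum_(b <- r') c' b i') *
     ((A i i')%:~R / rc (d 0 i')) = (\sum_(b <- r') c' b i') *
     rc ((pairing B l (d_ i' *m M))%:~R / d 0 i').
  set C' := \sum_(b <- r') c' b i'; clearbody C'.
  rewrite rmorphM /= fmorphV -(coroot_delta i' cd) mulr_suml mulr_sumr.
  apply: eq_bigr => i _; rewrite intr_real_complex.
  have dN0 : rc (d 0 i') != 0 by rewrite fmorph_eq0 gt_eqF.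
  by field.
by rewrite ReMr !mxE mulrCA.
Qed.

Hypothesis root_restrict : forall b, km_root Xg b -> b *m M = 0 \/ km_root Xm (b *m M).
Hypothesis restrict_cover : forall p, p = 0 \/ km_root Xm p ->
  exists r : seq 'rV[int]_n, forall b, km_root Xg b -> b *m M = p -> b \in r.
Hypothesis A_indec : indecomposable A.

(** The string restricts to a string of the simple root [l] of [m], whose far members are neither
    zero nor roots. *)
Lemma finite_strings_restrict l b : b *m M = d_ l -> finite_strings Xg b.
Proof.
move=> bl b0; have [N HN] := simple_strings_finite kmm l (b0 *m M).
exists N => z /HN[zN0 znr] /root_restrict; rewrite mulmxDl -scalemxAl bl => -[|//].
by move=> z0; rewrite z0 eqxx in zN0.
Qed.

Lemma adn_finite_strings b x b' v : b != 0 -> finite_strings Xg b -> weightsp Xg b x ->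
  weightsp Xg b' v -> exists N, adn N x v = 0.
Proof.
move=> bN0 fs bx b'v; have [N HN] := fs b'.
have H P : (N <= P)%N -> adn P x v != 0 -> b' + P%:Z *: b = 0.
  move=> NP vN0; apply: contrapT => /eqP wN0; apply: (HN P%:Z) => //.
  by split=> //; exists (adn P x v) => //; apply: weightsp_adn.
(* Finite strings do not exclude the weight zero, but two consecutive members of a string cannot
   both be zero. *)
exists N.+1; apply: contrapT => /eqP v1.
have v0 : adn N x v != 0 by apply: contraNneq v1; rewrite adnS => ->; rewrite br0r.
have e0 := H _ (leqnn N) v0; have := H _ (leqnSn N) v1.
by rewrite intS scalerDl scale1r addrCA e0 addr0 => /eqP; rewrite (negbTE bN0).
Qed.

Lemma finite_stringsN b : finite_strings Xg b -> finite_strings Xg (- b).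
Proof.
move=> fs b0; have [N HN] := fs b0; exists N => z zN.
by rewrite scalerN -scaleNr; apply: HN; rewrite abszN.
Qed.

Lemma coroot_norm_gt0 l r x y c q : ~ psd S -> coroot_data l r x y c q ->
  0 < complex.Re (\sum_(b <- r) q b).
Proof.
move=> npsd cd; pose z b := complex.Re (q b).
have rN0 b : b \in r -> b != 0.
  by move=> /(cd_restrict cd); apply: contra_eqN => /eqP ->; rewrite mul0mx eq_sym delta_neq0.
have rroot b : b \in r -> km_root Xg b.
  by move=> br; have [bx xN0] := cd_x cd br; split; [exact: rN0|exists (x b)].
have rpos b : b \in r -> 0 < ip A d b b.
  move=> br; apply: (string_norm_gt0 kmg A_indec d_gt0 S_sym npsd (rroot b br)).
  exact: finite_strings_restrict (cd_restrict cd br).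
(* Only roots with [q b != 0] give sl2-triples; the others drop out of every sum weighted by [z]. *)
pose Phi := [seq b <- r | q b != 0].
have PhiP b : b \in Phi -> b \in r /\ q b != 0 by rewrite mem_filter => /andP[].
have sumPhi (F : 'rV[int]_n -> R) :
    \sum_(b <- r) z b * F b = \sum_(b <- Phi) z b * F b.
  rewrite big_filter [RHS]big_mkcond; apply: eq_bigr => b _.
  by case: eqP => //= q0; rewrite /z q0 mul0r.
(* The equation [<alpha_l, H_l> = 2], pulled back to each root of [r]. It gives both the
   nonvanishing asked by [finite_reflections_pos] and the final identity. *)
have sum2 b : b \in r -> \sum_(b' <- Phi) z b' * ip A d b' b = 2.
  move=> br; rewrite -(sumPhi (fun b' => ip A d b' b)).
  have := coroot_wt_form b cd; rewrite coroot_restrict (cd_restrict cd br) pairing_delta.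
  case: (km_gcm kmm) => -> _ _ /(congr1 (@complex.Re R)); rewrite intr_real_complex Re_sum /=.
  by under eq_bigr => b' _ do rewrite ReMr; move=> <-.
have PhiN0 : exists b, b \in Phi.
  case rE : r (cd_nil cd) => [//|b r'] _; apply: contrapT => Phi0.
  have := sum2 b; rewrite rE mem_head => /(_ isT).
  rewrite big1_seq => [/esym/eqP|b' /andP[_ b'P]]; first by rewrite pnatr_eq0.
  by case: Phi0; exists b'.
(* A multiple of [d_ l] that is zero or a root of [m] is [0], [d_ l] or [- d_ l]; the three covers
   make [Psi] finite. *)
have [r1 r1P] := restrict_cover (or_introl (erefl (0 : 'rV[int]_k))).
have [r2 r2P] := restrict_cover (or_intror (root_delta kmm l)).
have [r3 r3P] := restrict_cover (or_intror ((root_opp Xm (d_ l)).1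
  (root_delta (opp_kac_moody kmm) l))).
pose good b := km_root Xg b /\ (exists e : int, b *m M = e *: d_ l).
pose Psi := [seq b <- undup (r1 ++ r2 ++ r3) | `[< good b >]].
have PsiP b : b \in Psi <-> good b.
  rewrite mem_filter; split=> [/andP[/asboolP]//|gb]; apply/andP; split; first exact/asboolP.
  rewrite mem_undup !mem_cat; case: gb => rb [e be].
  have [b0|] := root_restrict rb; first by rewrite r1P.
  rewrite be => /(root_multiple kmm)[e1|e1]; rewrite e1 ?scale1r ?scaleN1r in be.
    by rewrite r2P ?orbT.
  by rewrite r3P ?orbT.
have Phi_sub : {subset Phi <= Psi}.
  move=> b /PhiP[br _]; apply/PsiP; split; first exact: rroot.
  by exists 1; rewrite (cd_restrict cd br) scale1r.
have stable b b' : b \in Phi -> b' \in Psi -> exists p : int,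
    p%:~R * ip A d b b = 2 * ip A d b' b /\ b' - b *~ p \in Psi.
  move=> /PhiP[br qN0] /PsiP[rb' [e b'e]].
  have [bx xN0] := cd_x cd br; have by_ := cd_y cd br.
  have ipN0 : rc (ip A d b b) != 0 by rewrite fmorph_eq0 gt_eqF ?rpos.
  (* The normalization for which [b] takes the value [2] on the coroot [s]. *)
  pose u := 2 / (q b * rc (ip A d b b)).
  pose s := u *: coroot_comb h (c b).
  have wts e' : wt e' s = u * (q b * rc (ip A d b e')).
    have w0 : wt e' (0 : h) = 0.
      by have := wt_linear e' 1 (0 : h) 0; rewrite scale1r addr0 mul1r => /eqP;
        rewrite -[X in X == _]addr0 (inj_eq (addrI _)) eq_sym => /eqP.
    by have := wt_linear e' u (coroot_comb h (c b)) 0; rewrite addr0 w0 addr0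
      (coroot_component_wt e' cd br).
  have wtb : wt b s = 2 by rewrite wts /u divfK // mulf_neq0.
  have sl : sl2_triple (x b) (u *: y b) (gen_h Xg s).
    split; first by rewrite brZr (cd_bracket cd br) linearZ.
      by rewrite bx wtb.
    by rewrite brZr by_ wtN wtb !scalerA mulrC.
  have fs := finite_strings_restrict (cd_restrict cd br).
  have bN0 := rN0 b br; have bN0' : - b != 0 by rewrite oppr_eq0.
  have [||p [ps rp]] := root_reflection bx (weightspZ u by_) wtb sl _ _ rb'.
  - by move=> e' v; apply: (adn_finite_strings bN0 fs bx).
  - by move=> e' v; apply: (adn_finite_strings bN0' (finite_stringsN fs)); apply: weightspZ.
  exists p; split.
    apply: (@complexI R); rewrite !rmorphM /= -intr_real_complex -ps wts (ip_sym S_sym b' b).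
    rewrite rmorph_nat /u.
    by move: (rc (ip A d b b)) (rc (ip A d b b')) ipN0 => v w vN0; field; rewrite ?vN0 ?qN0.
  rewrite (_ : b *~ p = p *: b); last by rewrite -{2}[p]intz scaler_int.
  apply/PsiP; split=> //; exists (e - p).
  by rewrite mulmxBl -scalemxAl (cd_restrict cd br) b'e scalerBl.
have key := finite_reflections_pos (f := ip A d) (@ipDl _ _ _ _) (ip_sym S_sym)
  (filter_uniq _ (undup_uniq _)) Phi_sub (fun b bP => rpos b (PhiP b bP).1) stable (y := z).
have : 0 < \sum_(b <- Phi) \sum_(b' <- Phi) z b * z b' * ip A d b b'.
  apply: key; have [b bP] := PhiN0; exists b => //.
  by rewrite (sum2 _ (PhiP b bP).1) pnatr_eq0.
rewrite Re_sum -[X in _ -> 0 < X]/(\sum_(b <- r) z b).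
have -> : \sum_(b <- r) z b = \sum_(b <- Phi) z b.
  by have := sumPhi (fun=> 1); under eq_bigr do rewrite mulr1;
    under [in RHS]eq_bigr do rewrite mulr1.
(* By [sum2] the inner sums are all [2], so the positive quantity is twice the one in question. *)
have -> : \sum_(b <- Phi) \sum_(b' <- Phi) z b * z b' * ip A d b b' =
    2 * \sum_(b <- Phi) z b.
  rewrite mulr_sumr big_seq [RHS]big_seq; apply: eq_bigr => b /PhiP[br _].
  rewrite -(sum2 b br) mulr_suml; apply: eq_bigr => b' _.
  by rewrite (ip_sym S_sym b b'); ring.
by rewrite pmulr_rgt0.
Qed.

(** Evaluated at a root of [r], the pairing is [<alpha_l, H_l> = 2]. *)
Lemma real_coords_neq0 l r x y c q : coroot_data l r x y c q -> real_coords r c *m S != 0.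
Proof.
move=> cd; rewrite (real_coords_mul cd); apply/eqP => /rowP N0.
case rE : r (cd_nil cd) => [//|b r'] _; have br : b \in r by rewrite rE mem_head.
have : pairing B l (b *m M) = 0; last first.
  by rewrite (cd_restrict cd br) pairing_delta; case: (km_gcm kmm) => ->.
rewrite [b]row_sum_delta mulmx_suml /pairing.
under eq_bigr => i _ do rewrite summxE mulr_sumr.
rewrite exchange_big big1 //= => i _.
have := N0 i; rewrite !mxE => /eqP; rewrite intr_eq0 => /eqP; rewrite /pairing => p0.
rewrite -[RHS](mulr0 (b 0 i)) -[in RHS]p0 mulr_sumr; apply: eq_bigr => l' _.
by rewrite -scalemxAl mxE mulrCA.
Qed.

Lemma gram_data : exists (U : 'M[R]_(k, n)) (c : 'I_k -> R),
  [/\ forall l, 0 < c l,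
      forall l l', bform S (row l U) (row l' U) = c l * (B l' l)%:~R,
      forall l, row l U *m S = \row_i (pairing B l (d_ i *m M))%:~R &
      S \in unitmx -> row_free U].
Proof.
have [r rP] := choice coroot_data_exists; have [x {}rP] := choice rP.
have [y {}rP] := choice rP; have [c {}rP] := choice rP; have [q {}rP] := choice rP.
pose U : 'M[R]_(k, n) := \matrix_(l, i) real_coords (r l) (c l) 0 i.
have rowU l : row l U = real_coords (r l) (c l) by apply/rowP => i; rewrite !mxE.
exists U, (fun l => complex.Re (\sum_(b <- r l) q l b)); split.
(* In the semidefinite case [2 c_l] is a norm, hence nonnegative; norm zero would put the vector in
   the kernel of [S]. *)
- move=> l; have [psdS|npsd] := pselect (psd S); last exact: coroot_norm_gt0 (rP l).
  have := real_coords_gram (rP l) (rP l); have := psdS (real_coords (r l) (c l)).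
  case: (km_gcm kmm) => -> _ _ + E; rewrite E pmulr_lge0 // le_eqVlt => /predU1P[e0|//].
  have E0 : bform S (real_coords (r l) (c l)) (real_coords (r l) (c l)) = 0.
    by rewrite E -e0 mul0r.
  by have /eqP := psd_null_ker S_sym psdS E0; rewrite (negbTE (real_coords_neq0 (rP l))).
- by move=> l l'; rewrite !rowU; apply: real_coords_gram.
- by move=> l; rewrite rowU (real_coords_mul (rP l)).
move=> uS; rewrite -kermx_eq0; apply/rowV0P => v /sub_kermxP vU; apply/rowP => l.
pose X l i := \sum_(b <- r l) c l b i.
(* For invertible [S] the imaginary parts, which all simple roots kill, vanish. A relation between
   rows of [U] is then a relation between the coroots of [m], which are free. *)
have imX l' i : complex.Im (X l' i) = 0.
  pose w : 'rV[R]_n := \row_i (complex.Im (X l' i) / d 0 i).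
  have wS : w *m S = 0.
    apply/rowP => i'; rewrite mxE [RHS]mxE -[RHS](imag_coords_mul i' (rP l')).
    apply: eq_bigr => i'' _; rewrite symmetrizedE mxE.
    by field; rewrite gt_eqF.
  have w0 : w = 0 by rewrite -[w](mulmxK uS) wS mul0mx.
  have /rowP/(_ i) := w0; rewrite !mxE => /eqP.
  by rewrite mulf_eq0 invr_eq0 (gt_eqF (d_gt0 i)) orbF => /eqP.
have sumX i : \sum_l' rc (v 0 l') * X l' i = 0.
  apply: complex_eqP; rewrite ?Re_sum ?Im_sum /=.
    have /rowP/(_ i) := vU; rewrite !mxE => /(congr1 (fun z => z * d 0 i)); rewrite mul0r.
    rewrite mulr_suml => E; rewrite -[RHS]E; apply: eq_bigr => l' _.
    by rewrite mulrC ReMr !mxE -[in RHS]mulrA divfK ?gt_eqF // mulrC.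
  by rewrite big1 // => l' _; rewrite mulrC ImMr imX mul0r.
have t0 : \sum_l' rc (v 0 l') *: tnth (simple_coroot a) l' = 0.
  apply: (km_inj kmm); apply: j_inj; rewrite !raddf0 !raddf_sum /=.
  have -> : \sum_l' j (gen_h Xm (rc (v 0 l') *: H l')) =
      gen_h Xg (coroot_comb h (fun i => \sum_l' rc (v 0 l') * X l' i)).
    rewrite /coroot_comb raddf_sum /=.
    under [RHS]eq_bigr => i _ do rewrite scaler_suml raddf_sum /=.
    rewrite exchange_big /=; apply: eq_bigr => l' _.
    rewrite !linearZ /= sigmaE (cd_sum (rP l')) /coroot_comb raddf_sum scaler_sumr.
    by apply: eq_bigr => i _; rewrite -scalerA linearZ.
  by rewrite (_ : coroot_comb _ _ = 0) ?raddf0 // /coroot_comb big1 // => i _; rewrite sumX scale0r.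
have /freeP/(_ (fun l => rc (v 0 l)))-H0 := coroot_free a.
rewrite [RHS]mxE; apply: (@complexI R); rewrite rmorph0; apply: H0.
by rewrite -[RHS]t0; apply: eq_bigr => l' _; rewrite -tnth_nth.
Qed.

(** * Excluding the mixed pairs of types *)

Section Comparison.
Variable e : 'rV[R]_k.
Local Notation SB := (symmetrized B e).
Hypotheses (e_gt0 : forall l, 0 < e 0 l) (SB_sym : SB^T = SB).

(* Multiples of a strictly negative weight [b] are roots, so the bound on the norms of
   the roots of [m] makes the restriction of [b] isotropic; such [b] span all weights. *)
Lemma comparison_indefinite : ~ psd S -> psd SB ->
  (exists l i, pairing B l (d_ i *m M) != 0) -> False.
Proof.
move=> npsd psdB [l0 [i0 pi]]; have gcmA := km_gcm kmg.
have key b : negative_weight A b -> forall l, pairing B l (b *m M) = 0.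
  move=> [b0 bn] l.
  have bound (N : nat) : N.+1%:R ^+ 2 * ip B e (b *m M) (b *m M) <= \sum_l 2 * e 0 l.
    have Nb : km_root Xg (N.+1%:Z *: b).
      apply: (root_of_negative kmg A_indec d_gt0 S_sym) => i; first by rewrite mxE pmulr_rgt0.
      by rewrite pairingZ pmulr_rlt0.
    have -> : N.+1%:R ^+ 2 * ip B e (b *m M) (b *m M) =
        ip B e ((N.+1%:Z *: b) *m M) ((N.+1%:Z *: b) *m M).
      by rewrite -!scalemxAl ipZl ipZr mulrA.
    have [->|rm] := root_restrict Nb; last exact: (root_norm_bound kmm e_gt0 SB_sym).
    rewrite /ip (_ : realv R 0 = 0) ?bform0l; last by apply/rowP => i; rewrite !mxE.
    by apply: sumr_ge0 => l' _; rewrite mulr_ge0 // ltW.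
  set w := ip B e _ _ in bound; set C := \sum_l _ in bound.
  have w0 : w = 0.
    apply/eqP; rewrite eq_le psdB andbT leNgt; apply/negP => w_gt0.
    have := bound (Num.bound (C / w)); rewrite leNgt => /negP; apply.
    have C0 : 0 <= C by apply: sumr_ge0 => l' _; rewrite mulr_ge0 // ltW.
    have := archi_boundP (divr_ge0 C0 (ltW w_gt0)); rewrite ltr_pdivrMr // => h1.
    apply: (lt_le_trans h1); rewrite ler_pM2r // -natrX ler_nat expnS expn1.
    by apply: leq_trans (leqnSn _) _; rewrite leq_pmulr.
  have /rowP/(_ l) := psd_null_ker SB_sym psdB w0.
  rewrite realv_mul // mxE => /eqP; rewrite mulf_eq0 gt_eqF //= intr_eq0.
  by move/eqP.
have [b bneg] := negative_weight_exists gcmA A_indec d_gt0 S_sym npsd.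
(* Both [b] and [z *: b + d_ i0] are negative weights, so the pairing vanishes on [d_ i0] too. *)
have [z /key/(_ l0)] := negative_weightD gcmA i0 bneg.
rewrite mulmxDl -scalemxAl pairingD pairingZ key // mulr0 add0r => p0.
by rewrite p0 eqxx in pi.
Qed.

(** Coercivity and the norm bound confine the coordinates of the roots of [m] to a finite box; the
    finitely many roots of [g] above it would have bounded height, against [roots_unbounded]. *)
Lemma comparison_affine : psd S -> ~ pd S -> ~ pd SB.
Proof.
move=> psdS npd pdB.
have [eps eps0 coer] := pd_coercive SB_sym pdB.
pose C := \sum_l 2 * e 0 l; pose N := Num.bound (C / eps).
have C0 : 0 <= C by apply: sumr_ge0 => l' _; rewrite mulr_ge0 // ltW.
have entry_bound p l : km_root Xm p -> (`|p 0%R l| <= N)%N.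
  move=> rp; have le_pC := root_norm_bound kmm e_gt0 SB_sym rp.
  have : eps * (p 0 l)%:~R ^+ 2 <= C.
    apply: le_trans le_pC; apply: le_trans (coer _); rewrite ler_pM2l //.
    rewrite (bigD1 l) //= [realv _ _ _ _]mxE lerDl; apply: sumr_ge0 => l' _.
    exact: sqr_ge0.
  rewrite mulrC -ler_pdivlMr // => h1.
  have := le_lt_trans h1 (archi_boundP (divr_ge0 C0 (ltW eps0))).
  rewrite -/N -rmorphXn /= -[N%:R]/(N%:Z%:~R) ltr_int; nia.
clearbody N.
(* All points of the box: [2 N + 1] values per coordinate, shifted by [N]. *)
pose Ps : seq 'rV[int]_k :=
  [seq (\row_l ((f l : nat)%:Z - N%:Z)) | f : {ffun 'I_k -> 'I_(N + N).+1}].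
have PsP p : (forall l, (`|p 0%R l| <= N)%N) -> p \in Ps.
  move=> bp; apply/mapP; exists [ffun l => inord `|(p 0%R l + N%:Z)%R|%N].
    by rewrite mem_enum.
  by apply/rowP => l; rewrite mxE ffunE inordK; have [] := absz_shift (bp l).
have ex_cov p : exists r : seq 'rV[int]_n,
    p = 0 \/ km_root Xm p -> forall b, km_root Xg b -> b *m M = p -> b \in r.
  have [pr|npr] := pselect (p = 0 \/ km_root Xm p); last by exists [::].
  by have [r rP] := restrict_cover pr; exists r.
have [cov covP] := choice ex_cov.
pose rs := flatten [seq cov p | p <- Ps].
have rsP b : km_root Xg b -> b \in rs.
  move=> rb; have pr := root_restrict rb; apply/flattenP; exists (cov (b *m M)); last exact: covP.
  apply/map_f/PsP => l; case: pr => [->|rp]; last exact: entry_bound.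
  by rewrite mxE.
have [b rb] := roots_unbounded kmg A_indec d_gt0 S_sym (\sum_(b <- rs) `|height b|) psdS npd.
rewrite ltNge => /negP; apply; rewrite (big_rem b) ?rsP //=.
by rewrite (le_trans (ler_norm _)) // lerDl; apply: sumr_ge0.
Qed.

End Comparison.

Lemma graded_symmetrizer : indecomposable B ->
  exists (e : 'rV[R]_k) (U : 'M[R]_(k, n)),
  [/\ forall l, 0 < e 0 l,
      (symmetrized B e)^T = symmetrized B e,
      forall u v, bform (symmetrized B e) u v = bform S (u *m U) (v *m U),
      S \in unitmx -> row_free U &
      [/\ pd S -> pd (symmetrized B e),
          psd S -> ~ pd S -> psd (symmetrized B e) /\ ~ pd (symmetrized B e) &
          ~ psd S -> ~ psd (symmetrized B e)]].
Proof.
move=> B_indec; have [U [c [c0 gram mulU free]]] := gram_data.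
pose e : 'rV[R]_k := \row_l (c l)^-1.
have e0 l : 0 < e 0 l by rewrite mxE invr_gt0.
pose U' := diag_mx e *m U.
have SB : symmetrized B e = U' *m S *m U'^T.
  apply/matrixP => l l'; rewrite symmetrizedE.
  have -> : (U' *m S *m U'^T) l l' = bform S (row l U') (row l' U').
    rewrite /bform tr_row -row_mul [RHS]mxE [LHS]mxE; apply: eq_bigr => i _.
    by rewrite [row _ _ _ _]mxE [col _ _ _ _]mxE.
  have rowU' l1 : row l1 U' = e 0 l1 *: row l1 U.
    by apply/rowP => i; rewrite /U' mul_diag_mx !mxE.
  rewrite !rowU' bformZl bformZr bform_sym // gram mxE [e 0 l']mxE.
  by field; rewrite !gt_eqF.
have SBsym : (symmetrized B e)^T = symmetrized B e.
  by rewrite SB trmx_mul trmxK (trmx_mul U' S) S_sym mulmxA.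
have SBform u v : bform (symmetrized B e) u v = bform S (u *m U') (v *m U').
  by rewrite /bform SB (trmx_mul v U') !mulmxA.
have eu : diag_mx e \in unitmx.
  by rewrite unitmxE det_diag unitfE; apply/prodf_neq0 => l _; rewrite gt_eqF.
have free' : S \in unitmx -> row_free U'.
  by move=> /free; rewrite /row_free /U' eqmxMfull // row_full_unit.
have psdSB : psd S -> psd (symmetrized B e) by move=> psdS u; rewrite SBform.
exists e, U'; split=> //; split.
- move=> pdS u uN0; have fU := free' (pd_unitmx pdS); rewrite SBform; apply: pdS.
  by apply: contraNneq uN0 => /eqP; rewrite mulmx_free_eq0.
- by move=> psdS npd; split; [apply: psdSB | apply: comparison_affine].
- move=> npsd psdB; apply: (comparison_indefinite e0 SBsym npsd psdB).
  (* If every restricted simple root paired to zero with [H_l0], its norm [2 c_l0] would vanish. *)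
  pose l0 := Ordinal B_indec.1; exists l0.
  apply: contrapT => H; have := gram l0 l0; rewrite /bform mulU.
  rewrite (_ : \row_i _ = 0) ?mul0mx ?mxE => [|]; last first.
    apply/rowP => i; rewrite !mxE; apply/eqP; rewrite intr_eq0; apply: contrapT => /negP pi.
    by apply: H; exists i.
  case: (km_gcm kmm) => -> _ _ /esym/eqP.
  by rewrite mulf_eq0 gt_eqF //= intr_eq0.
Qed.

End CorootDecomposition.

(** * Lorentzian forms *)

Section Congruence.
Variable R : realType.

Lemma bform_polar n (M : 'M[R]_n) : M^T = M -> (forall u, bform M u u = 0) -> M = 0.
Proof.
move=> symM M0; apply/matrixP => i l; rewrite [RHS]mxE.
have := M0 (delta_mx 0 i + delta_mx 0 l).
rewrite bformDl !bformDr !M0 add0r addr0 (bform_sym (delta_mx 0 l)) // -mulr2n.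
by move/eqP; rewrite mulrn_eq0 /= bform_delta -rowE mxE => /eqP.
Qed.

(** Split off a nonisotropic vector and diagonalize the Schur complement [C'] by induction. *)
Lemma congruent_diag n (M : 'M[R]_n) : M^T = M ->
  exists (P : 'M[R]_n) (d : 'rV[R]_n), P \in unitmx /\ P *m M *m P^T = diag_mx d.
Proof.
elim: n M => [|n IH] M symM.
  by exists 1%:M, 0; split; [exact: unitmx1 | rewrite [LHS]flatmx0 [RHS]flatmx0].
have [M0|[u uN0]] : M = 0 \/ exists u, bform M u u != 0.
  have [H|H] := pselect (exists u, bform M u u != 0); [by right | left].
  by apply: bform_polar => // u; apply: contrapT => /eqP ?; apply: H; exists u.
  exists 1%:M, 0; split; first exact: unitmx1.
  by rewrite M0 mulmx0 mul0mx; apply/matrixP => i l; rewrite !mxE mul0rn.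
(* An invertible matrix whose first row is proportional to [u]. *)
pose P0 := row_ebase u; have P0u : P0 \in unitmx := row_ebase_unit u.
have [c uE] : exists c, u = c *: row 0 P0.
  exists (col_ebase u 0 0); rewrite -{1}(mulmx_ebase u).
  have r1 : \rank u = 1%N.
    by rewrite rank_rV; have -> : u != 0 by apply: contraNneq uN0 => ->; rewrite bform0l.
  rewrite r1 [col_ebase u]mx11_scalar mul_scalar_mx -scalemxAl mxE eqxx mulr1n.
  congr (_ *: _); rewrite rowE; congr (_ *m _); apply/rowP => i.
  by rewrite !mxE; case: i => [[|i] Hi].
pose M1 : 'M[R]_(1 + n) := P0 *m M *m P0^T.
have symM1 : M1^T = M1 by rewrite /M1 trmx_mul trmxK trmx_mul symM mulmxA.
have al : M1 0 0 != 0.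
  have -> : M1 0 0 = bform M (row 0 P0) (row 0 P0).
    rewrite /bform tr_row -row_mul /M1 [RHS]mxE [LHS]mxE; apply: eq_bigr => i _.
    by rewrite [row _ _ _ _]mxE [col _ _ _ _]mxE.
  by move: uN0; rewrite uE bformZl bformZr !mulf_eq0 !negb_or => /and3P[].
pose b := ursubmx M1; pose C := drsubmx M1; pose al' := M1 0 0.
have M1E : M1 = block_mx al'%:M b b^T C.
  rewrite -{1}(submxK M1); congr block_mx.
    apply/matrixP => i l; rewrite !ord1 [RHS]mxE eqxx mulr1n [LHS]mxE [LHS]mxE.
    by rewrite /al'; congr (M1 _ _); apply: val_inj.
  by rewrite trmx_ursub symM1.
pose C' := C - al'^-1 *: (b^T *m b).
have symC' : C'^T = C'.
  rewrite /C' linearB linearZ /= trmx_mul trmxK; congr (_ - _).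
  by rewrite trmx_drsub symM1.
have [P2 [d2 [P2u P2E]]] := IH C' symC'.
pose P1 : 'M[R]_(1 + n) := block_mx 1%:M 0 (- al'^-1 *: b^T) 1%:M.
have P1u : P1 \in unitmx by rewrite unitmxE det_lblock !det1 mulr1 unitr1.
pose P3 : 'M[R]_(1 + n) := block_mx 1%:M 0 0 P2.
have P3u : P3 \in unitmx by rewrite unitmxE det_lblock det1 mul1r -unitmxE.
have E1 : P1 *m M1 *m P1^T = block_mx al'%:M 0 0 C'.
  rewrite M1E /P1 tr_block_mx !mulmx_block !trmx1 !trmx0 linearZ /= trmxK.
  rewrite !mul1mx !mul0mx !mulmx1 !mulmx0 !addr0.
  rewrite mul_mx_scalar scalerA mulrN divff // scaleN1r addNr.
  rewrite mul0mx add0r mul_scalar_mx scalerA mulrN divff // scaleN1r addNr.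
  by congr block_mx; rewrite /C' -scalemxAl scaleNr addrC.
exists (P3 *m P1 *m P0), (row_mx (al'%:M) d2); split; first by rewrite !unitmx_mul P3u P1u.
rewrite !trmx_mul !mulmxA.
have -> : P3 *m P1 *m P0 *m M *m P0^T *m P1^T *m P3^T = P3 *m (P1 *m M1 *m P1^T) *m P3^T.
  by rewrite /M1 !mulmxA.
rewrite E1 /P3 tr_block_mx !mulmx_block !trmx1 !trmx0.
rewrite !mul1mx !mul0mx !mulmx1 !mulmx0 !addr0 !add0r P2E.
transitivity (block_mx (diag_mx (al'%:M : 'rV_1)) 0 0 (diag_mx d2)).
  have -> : diag_mx (al'%:M : 'rV_1) = al'%:M by apply/matrixP => i l; rewrite !mxE !ord1.
  by rewrite mul0mx.
by rewrite -diag_mx_row.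
Qed.

End Congruence.

Section LorentzForms.
Variables (R : realType).

(** A basis-free version of the signature, which passes to subspaces ([lorentz_form_pullback]).
    Semidefinite forms satisfy it vacuously, hence the separate [~ psd] in [lorentz_signature]. *)
Definition lorentz_form n (M : 'M[R]_n) := forall u v, bform M v v < 0 ->
  bform M u v = 0 -> u != 0 -> 0 < bform M u u.

Lemma bform_congruent n (M P : 'M[R]_n) (d : 'rV[R]_n) x y :
  P *m M *m P^T = diag_mx d ->
  bform M (x *m P) (y *m P) = \sum_i d 0 i * x 0 i * y 0 i.
Proof.
move=> PM; rewrite /bform trmx_mul !mulmxA -(mulmxA x) -(mulmxA x) PM mul_mx_diag mxE.
by apply: eq_bigr => i _; rewrite !mxE (mulrC (x 0 i)).
Qed.

Lemma signature_lorentz n (M : 'M[R]_n) : (0 < n)%N ->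
  has_signature M n.-1 1 -> lorentz_form M.
Proof.
move=> n0 [symM [P [d [Pu PM pos neg]]]].
have [i0 negE] := mem_card1 neg.
have di0 : d 0 i0 < 0 by have := negE i0; rewrite !inE eqxx.
have dpos i : i != i0 -> 0 < d 0 i.
  move=> ii0; have sub : [pred i | 0 < d 0 i] \subset predC1 i0.
    apply/fintype.subsetP => i'; rewrite !inE; apply: contraTneq => ->.
    by rewrite ltNge ltW.
  have cd : #|[pred i | 0 < d 0 i]| = #|predC1 i0| by rewrite pos cardC1 card_ord.
  by have := (subset_cardP cd sub) i; rewrite !inE ii0.
move=> u v; rewrite -[u](mulmxKV Pu) -[v](mulmxKV Pu).
move: (u *m _) (v *m _) => x y; rewrite !(bform_congruent _ _ PM) => yy xy xPN0.
have xN0 : x != 0 by apply: contraNneq xPN0 => ->; rewrite mul0mx.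
rewrite ltNge; apply/negP => xx.
(* The combination without negative coordinate has norm at least zero; by orthogonality its norm is
   also a sum of two nonpositive terms. So everything vanishes, which forces [x = 0]. *)
pose z := x 0 i0 *: y - y 0 i0 *: x.
have zi0 : z 0 i0 = 0 by rewrite !mxE mulrC subrr.
have zz : \sum_i d 0 i * z 0 i * z 0 i =
    x 0 i0 ^+ 2 * (\sum_i d 0 i * y 0 i * y 0 i)
    + y 0 i0 ^+ 2 * (\sum_i d 0 i * x 0 i * x 0 i).
  transitivity (x 0 i0 ^+ 2 * (\sum_i d 0 i * y 0 i * y 0 i)
    + y 0 i0 ^+ 2 * (\sum_i d 0 i * x 0 i * x 0 i)
    - 2 * x 0 i0 * y 0 i0 * (\sum_i d 0 i * x 0 i * y 0 i)); last first.
    by rewrite xy mulr0 subr0.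
  rewrite !mulr_sumr -big_split -sumrB; apply: eq_bigr => i _ /=.
  by rewrite !mxE; ring.
have term i : 0 <= d 0 i * z 0 i * z 0 i.
  have [->|ii0] := eqVneq i i0; first by rewrite zi0 mulr0.
  by rewrite -mulrA; apply: mulr_ge0; [exact/ltW/dpos | rewrite -expr2; apply: sqr_ge0].
have z_ge0 : 0 <= \sum_i d 0 i * z 0 i * z 0 i by apply: sumr_ge0.
have x2 := sqr_ge0 (x 0 i0); have y2 := sqr_ge0 (y 0 i0).
have t1 : x 0 i0 ^+ 2 * (\sum_i d 0 i * y 0 i * y 0 i) <= 0 by rewrite mulr_ge0_le0 // ltW.
have t2 : y 0 i0 ^+ 2 * (\sum_i d 0 i * x 0 i * x 0 i) <= 0 by rewrite mulr_ge0_le0.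
have yi0 : y 0 i0 != 0.
  apply: contraTneq yy => y0; rewrite -leNgt; apply: sumr_ge0 => i _.
  have [->|ii0] := eqVneq i i0; first by rewrite y0 mulr0.
  by rewrite -mulrA; apply: mulr_ge0; [exact/ltW/dpos | rewrite -expr2; apply: sqr_ge0].
have z0 : z = 0.
  apply/rowP => i; rewrite [RHS]mxE; have [->|ii0] := eqVneq i i0; first exact: zi0.
  have /eqP : \sum_i d 0 i * z 0 i * z 0 i = 0 by apply/eqP; rewrite eq_le z_ge0 zz; lra.
  rewrite psumr_eq0 // => /allP/(_ i (mem_index_enum i)) /=.
  by rewrite -mulrA mulf_eq0 gt_eqF ?dpos //= -expr2 sqrf_eq0 => /eqP.
have x0 : x 0 i0 = 0.
  have : x 0 i0 ^+ 2 * (\sum_i d 0 i * y 0 i * y 0 i) = 0.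
    by move: zz; rewrite z0 big1 => [|i _]; [lra | rewrite !mxE !mulr0].
  by move=> /eqP; rewrite mulf_eq0 (lt_eqF yy) orbF sqrf_eq0 => /eqP.
case/eqP: xN0; apply/rowP => i; rewrite [RHS]mxE; apply/eqP.
have /rowP/(_ i) := z0; rewrite !mxE x0 mul0r sub0r => /eqP.
by rewrite oppr_eq0 mulf_eq0 (negbTE yi0).
Qed.

(** Some diagonal entry is negative since the form is not semidefinite; the other basis vectors are
    orthogonal to that one, hence of positive norm. *)
Lemma lorentz_signature n (M : 'M[R]_n) : M^T = M -> lorentz_form M -> ~ psd M ->
  has_signature M n.-1 1 /\ \det M != 0.
Proof.
move=> symM lorM npsd; have [P [d [Pu PM]]] := congruent_diag symM.
have dE i l : bform M (row i P) (row l P) = if i == l then d 0 i else 0.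
  rewrite !rowE (bform_congruent _ _ PM) (bigD1 i) //= !mxE !eqxx /= mulr1 big1 ?addr0.
    by case: (i == l); rewrite ?mulr1 ?mulr0.
  by move=> i' /negbTE ii'; rewrite !mxE ii' andbF mulr0 mul0r.
have [i0 di0] : exists i0, d 0 i0 < 0.
  apply: contrapT => H; apply: npsd => u; rewrite -[u](mulmxKV Pu) (bform_congruent _ _ PM).
  apply: sumr_ge0 => i _; rewrite -mulrA; apply: mulr_ge0; last by rewrite -expr2; apply: sqr_ge0.
  by rewrite leNgt; apply/negP => di; apply: H; exists i.
have dpos i : i != i0 -> 0 < d 0 i.
  move=> ii0; have := lorM (row i P) (row i0 P); rewrite !dE !eqxx (negbTE ii0); apply=> //.
  apply/eqP => ri0.
  have /rowP/(_ i) : row i P *m invmx P = row i 1%:M by rewrite -row_mul mulmxV.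
  by rewrite ri0 mul0mx !mxE eqxx => /eqP; rewrite eq_sym oner_eq0.
split.
  split=> //; exists P, d; split=> //.
    rewrite -[n in n.-1](card_ord n) -(cardC1 i0); apply: eq_card => i; rewrite !inE.
    by have [->|/dpos->//] := eqVneq i i0; rewrite ltNge ltW.
  transitivity #|pred1 i0|; last exact: card1.
  apply: eq_card => i; rewrite !inE.
  by have [->|/dpos di] := eqVneq i i0; [rewrite di0 | rewrite ltNge ltW].
have := congr1 determinant PM; rewrite !det_mulmx det_tr det_diag => E.
apply/eqP => M0; move/eqP: E; rewrite M0 mulr0 mul0r eq_sym; apply/negP/prodf_neq0 => i _.
by have [->|/dpos di] := eqVneq i i0; [rewrite lt_eqF | rewrite gt_eqF].
Qed.

End LorentzForms.

Section Conclusion.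
Variable R : realType.

(** The entries of [d] have equal signs at linked indices, hence by indecomposability at all; change
    the sign if they are negative. *)
Lemma positive_symmetrizer n (A : 'M[int]_n) : gcm A -> indecomposable A -> symmetrizable R A ->
  exists d : 'rV[R]_n, (forall i, 0 < d 0 i) /\ (symmetrized A d)^T = symmetrized A d.
Proof.
move=> [_ Aneg Azero] [n0 irr] [d [dN0 dA]].
have dsym i l : d 0 i * (A i l)%:~R = d 0 l * (A l i)%:~R.
  by rewrite -!symmetrizedE /symmetrized -{1}dA mxE.
have same i l : A i l != 0 -> 0 < d 0 i -> 0 < d 0 l.
  move=> Ail di; have il : A l i != 0 by apply: contraNneq Ail => /Azero ->.
  have [->//|ilN] := eqVneq l i.
  have A1 : A l i < 0 by rewrite lt_neqAle il Aneg.
  have A2 : A i l < 0 by rewrite lt_neqAle Ail Aneg // eq_sym.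
  have A1R : (A l i)%:~R < 0 :> R by rewrite ltrz0.
  have A2R : (A i l)%:~R < 0 :> R by rewrite ltrz0.
  by rewrite -(nmulr_llt0 _ A1R) -dsym nmulr_llt0.
pose J := [set i | 0 < d 0 i].
have [dpos|ndpos] := pselect (forall i, 0 < d 0 i); first by exists d.
have [dneg|ndneg] := pselect (forall i, ~ 0 < d 0 i).
  exists (- d); split=> [i|].
    by rewrite mxE oppr_gt0 lt_neqAle dN0 /= leNgt; apply/negP/dneg.
  by rewrite /symmetrized linearN mulNmx linearN /= dA.
exfalso; have [|i [l [Ji Jl H]]] := irr J.
  apply/andP; split.
    rewrite card_gt0; apply/set0Pn; apply: contrapT => H; apply: ndneg => i di.
    by apply: H; exists i; rewrite inE.
  rewrite -[X in (_ < X)%N]card_ord -(cardsC J) -[X in (X < _)%N]addn0 ltn_add2l.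
  rewrite card_gt0; apply/set0Pn; apply: contrapT => H; apply: ndpos => i.
  by apply: contrapT => /negP di; apply: H; exists i; rewrite !inE.
have Ail : A i l != 0 by case/orP: H => // Ali; apply: contraNneq Ali => /Azero ->.
by move: Ji Jl; rewrite !inE => /(same _ _ Ail) ->.
Qed.

Lemma lorentz_form_pullback n k (M : 'M[R]_n) (N : 'M[R]_k) (U : 'M[R]_(k, n)) :
  row_free U -> (forall u v, bform N u v = bform M (u *m U) (v *m U)) ->
  lorentz_form M -> lorentz_form N.
Proof.
move=> fU NM lorM u v; rewrite !NM => vv uv uN0; apply: (lorM _ _ vv uv).
by apply: contraNneq uN0 => /eqP; rewrite mulmx_free_eq0.
Qed.

End Conclusion.

Theorem proposition3p3 (R : realType) (n k : nat)
    (A : 'M[int]_n) (B : 'M[int]_k)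
    (h : realization R A) (a : realization R B)
    (g m : lieType R[i]) (Xg : generators h g) (Xm : generators a m)
    (j : {linear m -> g}) (Sigma : set (dual a))
    (g_km : is_kac_moody Xg)
    (A_indec : indecomposable A) (A_sym : symmetrizable R A)
    (g_graded : finitely_graded Xg Xm j Sigma)
    (B_indec : indecomposable B) :
  [/\ finite_type R A <-> finite_type R B,
      affine_type R A <-> affine_type R B &
      indefinite_type R A <-> indefinite_type R B]
  /\ (indefinite_type R A -> lorentzian R A -> lorentzian R B).
Proof.
have kmg := is_kac_moodyP g_km.
have [[m_km j_morph j_inj <-] j_cartan j_graded j_fd] := g_graded.
have kmm := is_kac_moodyP m_km.
have gcmA := km_gcm kmg; have gcmB := km_gcm kmm.
pose M := restriction_mx kmg kmm j_cartan j_graded.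
have rM b : km_root Xg b -> b *m M = 0 \/ km_root Xm (b *m M) by apply: root_restrict.
have cM p : p = 0 \/ km_root Xm p ->
    exists r : seq 'rV[int]_n, forall b, km_root Xg b -> b *m M = p -> b \in r.
  by move=> pr; apply: (restrict_cover kmg kmm j_cartan j_graded j_fd pr).
(* Kept general in [d]: the first claim takes any positive symmetrizer, the second the one that
   comes with the signature. *)
have comparison (d : 'rV[R]_n) (d0 : forall i, 0 < d 0 i)
    (S_sym : (symmetrized A d)^T = symmetrized A d) :=
  graded_symmetrizer kmg kmm j_morph j_inj (cartan_mapE j_cartan)
    (wt_restrict kmg kmm j_cartan j_graded) d0 S_sym rM cM A_indec B_indec.
split.
  have [d [d0 S_sym]] := positive_symmetrizer gcmA A_indec A_sym.
  have [e [U [e0 SB_sym _ _ [pdAB psdAB npsdAB]]]] := comparison d d0 S_sym.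
  have fA := finite_typeP gcmA A_indec d0 S_sym.
  have aA := affine_typeP gcmA A_indec d0 S_sym.
  have iA := indefinite_typeP gcmA A_indec d0 S_sym.
  have fB := finite_typeP gcmB B_indec e0 SB_sym.
  have aB := affine_typeP gcmB B_indec e0 SB_sym.
  have iB := indefinite_typeP gcmB B_indec e0 SB_sym.
  have [psdA|npsdA] := pselect (psd (symmetrized A d)); last first.
    have npsdB := npsdAB npsdA.
    split; [rewrite fA fB | rewrite aA aB | by rewrite iA iB].
      by split=> /pd_psd.
    by split=> -[].
  have [pdA|npdA] := pselect (pd (symmetrized A d)).
    have pdB := pdAB pdA; have psdB := pd_psd pdB.
    by split; [rewrite fA fB | rewrite aA aB; split=> -[] | rewrite iA iB; split].
  have [psdB npdB] := psdAB psdA npdA.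
  by split; [rewrite fA fB | rewrite aA aB | rewrite iA iB; split].
move=> iA [_ _ detA [d [d0 sigA]]]; have S_sym := sigA.1.
have [e [U [e0 SB_sym SBU freeU [_ _ npsdAB]]]] := comparison d d0 S_sym.
have npsdB := npsdAB ((indefinite_typeP gcmA A_indec d0 S_sym).1 iA).
have S_unit : symmetrized A d \in unitmx.
  rewrite unitmxE det_mulmx unitrM !unitfE detA andbT det_diag.
  by apply/prodf_neq0 => i _; rewrite gt_eqF.
have lorB := lorentz_form_pullback (freeU S_unit) SBU (signature_lorentz A_indec.1 sigA).
have [sigB detB] := lorentz_signature SB_sym lorB npsdB.
split=> //.
- by exists e; split=> // i; rewrite gt_eqF.
- by move: detB; rewrite det_mulmx mulf_eq0 negb_or => /andP[].
- by exists e.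
Qed.
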